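(* Let $\theta$ be a primitive character of $E^\times$ of level $r_0\ge 2$. (a) Suppose that $r_0$ is odd and let $m=\frac{n(r_0-1)}{2}+1$. There is a unique character $\widetilde\theta$ of $E^\times\cdot U_D^m$ that restricts to $\theta$ on $E^\times$ and is trivial on $1+(C'\cap P_D^m)$. The representation $\rho=\mathrm{Ind}_{E^\times\cdot U_D^m}^{D^\times}(\widetilde\theta)$ of $D^\times$ is irreducible. (b) Suppose that $r_0$ is even and let $m=\frac{n(r_0-2)}{2}+1$. There is an irreducible representation $\sigma$ of $E^\times\cdot U_D^m$ such that $\mathrm{tr}\,\sigma(x)=(-1)^{n-1}\cdot\theta(x)$ for each very regular element $x\in\mathcal O_E^\times$ and such that the restriction of $\sigma$ to $F^\times\cdot U_E^1\cdot U_D^{nr_0/2}$ is a direct sum of copies of a character that equals $\theta$ on $F^\times\cdot U_E^1$ and is trivial on $1+(C'\cap P_D^{nr_0/2})$. With this $\sigma$, the representation $\rho=\mathrm{Ind}_{E^\times\cdot U_D^m}^{D^\times}(\sigma)$ of $D^\times$ is irreducible. (c) In both cases, $\rho$ has central character $\theta|_{F^\times}$ and satisfies $\rho\cong\rho\otimes(\epsilon\circ\mathrm{Nrd}_{D/F})$, and $\mathrm{tr}\,\rho(x)=(-1)^{(r_0-1)(n-1)}\cdot\sum_{\gamma\in\mathscr G}\theta^\gamma(x)$ for each very regular element $x\in\mathcal O_E^\times$.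
   Context: $F$ is a nondiscrete locally compact non-Archimedean field with uniformizer $\varpi$, ring of integers $\mathcal O_F$ and residue field $\mathbb F_q$ of characteristic $p$; $n\ge 2$ is an integer; $E\supset F$ is an unramified extension of degree $n$ with ring of integers $\mathcal O_E$ and residue field $\mathbb F_{q^n}$; $\mathscr G=\mathrm{Gal}(E/F)$, identified with $\mathrm{Gal}(\mathbb F_{q^n}/\mathbb F_q)$. For $m\in\mathbb Z$, $P_E^m=\varpi^m\mathcal O_E$; $U_E^0=\mathcal O_E^\times$ and $U_E^m=1+P_E^m$ for $m\ge1$. An element $x\in\mathcal O_E^\times$ is very regular if its image in $\mathcal O_E^\times/U_E^1=\mathbb F_{q^n}^\times$ has trivial $\mathscr G$-stabilizer. All representations have coefficients in $\overline{\mathbb Q}_\ell$ for a fixed prime $\ell\ne p$; a character of a topological group is a homomorphism to $\overline{\mathbb Q}_\ell^\times$ with open kernel; representations are smooth and $\mathrm{Ind}$ is smooth induction. The level of a character $\theta$ of $E^\times$ is the smallest integer $r\ge0$ with $\theta|_{U_E^r}\equiv1$. For $\gamma\in\mathscr G$, $\theta^\gamma(x)=\theta(\gamma(x))$. A character $\theta$ of level $r_0\ge 2$ is primitive if $\theta/\theta^\gamma$ has level $r_0$ for each $1\ne\gamma\in\mathscr G$. $\epsilon$ is a fixed character of $F^\times$ whose kernel is the image of the norm $N_{E/F}:E^\times\to F^\times$. Let $\varphi\in\mathscr G$ be the generator inducing $a\mapsto a^q$ on $\mathbb F_{q^n}$. $E\langle\Pi\rangle$ is the twisted polynomial ring with $\Pi\cdot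 a=\varphi(a)\cdot\Pi$ for $a\in E$, and $D=E\langle\Pi\rangle/(\Pi^n-\varpi)$, a central division algebra over $F$ with invariant $1/n$; $\mathrm{Nrd}_{D/F}:D^\times\to F^\times$ is the reduced norm; $E^\times\subset D^\times$. $D=\bigoplus_{j=0}^{n-1}E\cdot\Pi^j$, $\mathcal O_D=\sum_{j=0}^{n-1}\mathcal O_E\cdot\Pi^j$, $P_D^m=\Pi^m\mathcal O_D$ for $m\in\mathbb Z$, and $U_D^m=1+P_D^m$ for $m\ge1$ (a normal compact open subgroup of $D^\times$). $C'=\sum_{j=1}^{n-1}E\cdot\Pi^j$ is the orthogonal complement of $E$ in $D$ for the reduced trace pairing. *)

(* Defs.v *)
From HB Require Import structures.
From mathcomp Require Import all_boot all_order all_fingroup all_algebra.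
From mathcomp Require Import all_field.
From mathcomp Require Import all_classical all_reals topology.

Set Implicit Arguments.
Unset Strict Implicit.
Unset Printing Implicit Defensive.

Import Order.TTheory GRing.Theory Num.Theory.

Local Open Scope classical_set_scope.
Local Open Scope ring_scope.

Record nonarch_abs (R : realType) (K : fieldType) := NonarchAbs {
  nabs :> K -> R;
  nabs_ge0 : forall x, 0 <= nabs x;
  nabs_eq0 : forall x, (nabs x == 0) = (x == 0);
  nabsM : forall x y, nabs (x * y) = nabs x * nabs y;
  nabsD : forall x y, nabs (x + y) <= Num.max (nabs x) (nabs y) }.

Definition valued (R : realType) (K : fieldType) (v : nonarch_abs R K) : Type :=
  K.

Section ValuedMetric.
Variables (R : realType) (K : fieldType) (v : nonarch_abs R K).

Definition vdist (x y : valued v) : R := v ((x : K) - (y : K)).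

Lemma nabs1 : v 1 = 1.
Proof.
have v1 : v 1 != 0 by rewrite nabs_eq0 oner_eq0.
by apply: (mulfI v1); rewrite mulr1 -nabsM mulr1.
Qed.

Lemma nabsN x : v (- x) = v x.
Proof.
have vN1 : v (- 1) = 1.
  have : v (- 1) ^+ 2 == 1 by rewrite expr2 -nabsM mulrNN mulr1 nabs1.
  rewrite sqrf_eq1 => /orP[/eqP//|/eqP vE].
  by have := nabs_ge0 v (- 1); rewrite vE oppr_ge0 ler10.
by rewrite -mulN1r nabsM vN1 mul1r.
Qed.

Lemma vdistxx x : vdist x x = 0.
Proof. by apply/eqP; rewrite /vdist nabs_eq0 subrr. Qed.

Lemma vdist_positivity x y : vdist x y = 0 -> x = y.
Proof. by move/eqP; rewrite /vdist nabs_eq0 subr_eq0 => /eqP. Qed.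

Lemma vdist_sym x y : vdist x y = vdist y x.
Proof. by rewrite /vdist -[LHS]nabsN opprB. Qed.

Lemma vdist_triangle y x z : vdist x z <= vdist x y + vdist y z.
Proof.
rewrite /vdist.
have -> : (x : K) - (z : K) = ((x : K) - (y : K)) + ((y : K) - (z : K)).
  by rewrite addrA subrK.
apply: (le_trans (nabsD _ _ _)); rewrite ge_max.
by rewrite lerDl nabs_ge0 lerDr nabs_ge0.
Qed.

HB.instance Definition _ := Choice.copy (valued v) K.
HB.instance Definition _ := @isMetric.Build R (valued v) vdist
  vdistxx vdist_positivity vdist_sym vdist_triangle.
End ValuedMetric.

Section LocalField.
Variables (R : realType) (K : fieldType) (v : nonarch_abs R K).

Definition local_field : Prop :=
  (exists x : valued v, ~ open [set x]) /\ locally_compact [set: valued v].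

Definition int_ring : set K := [set x | v x <= 1].

Definition max_ideal : set K := [set x | v x < 1].

Definition uniformizer (w : K) : Prop :=
  max_ideal = [set w * y | y in int_ring].

Definition ideal_pow (w : K) (m : nat) : set K :=
  [set w ^+ m * y | y in int_ring].

(* The residue field, as the set of cosets of the maximal ideal in the ring   *)
(* of integers, has q elements.                                               *)
Definition residue_card (q : nat) : Prop :=
  ([set [set y | max_ideal (y - x)] | x in int_ring] #= `I_q)%card.

End LocalField.

(* The residue extension of a finite extension of local fields is separable,  *)
(* so being unramified means that uniformizers remain uniformizers.           *)
Definition unramified (R : realType) (F : fieldType) (E : fieldExtType F)
    (vF : nonarch_abs R F) (vE : nonarch_abs R E) : Prop :=
  forall w, uniformizer vF w -> uniformizer vE (w%:A).

(* This characterizes the field of l-adic numbers up to isomorphism.          *)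
Definition ladic_field (R : realType) (K : fieldType) (v : nonarch_abs R K)
    (l : nat) : Prop :=
  [/\ local_field v, uniformizer v l%:R & residue_card v l].

Definition algebraic_closure (k : fieldType) (K : closedFieldType)
    (iota : {rmorphism k -> K}) : Prop :=
  forall x : K, algebraicOver iota x.

Record units (A : unitRingType) := Units {
  uval :> A;
  uvalP : uval \is a GRing.unit }.

HB.instance Definition _ (A : unitRingType) := [isSub for @uval A].
HB.instance Definition _ (A : unitRingType) := [Choice of units A by <:].

Section UnitGroup.
Variable A : unitRingType.
Implicit Types x y z : units A.

Fact units_mul_subproof x y : (x : A) * (y : A) \is a GRing.unit.
Proof. by rewrite unitrMl ?uvalP. Qed.
Fact units_inv_subproof x : (x : A)^-1 \is a GRing.unit.
Proof. by rewrite unitrV uvalP. Qed.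

Definition units_one : units A := Units (@unitr1 A).
Definition units_mul x y : units A := Units (units_mul_subproof x y).
Definition units_inv x : units A := Units (units_inv_subproof x).

Fact units_mulA : associative units_mul.
Proof. by move=> x y z; apply: val_inj => /=; rewrite mulrA. Qed.
Fact units_mul1 : left_id units_one units_mul.
Proof. by move=> x; apply: val_inj => /=; rewrite mul1r. Qed.
Fact units_mulr1 : right_id units_one units_mul.
Proof. by move=> x; apply: val_inj => /=; rewrite mulr1. Qed.
Fact units_mulV : left_inverse units_one units_inv units_mul.
Proof. by move=> x; apply: val_inj => /=; rewrite mulVr ?uvalP. Qed.
Fact units_mulrV : right_inverse units_one units_inv units_mul.
Proof. by move=> x; apply: val_inj => /=; rewrite mulrV ?uvalP. Qed.

HB.instance Definition _ := isGroup.Build (units A)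
  units_mulA units_mul1 units_mulr1 units_mulV units_mulrV.
End UnitGroup.

Definition units_map (A B : unitRingType) (f : {rmorphism A -> B})
    (x : units A) : units B :=
  Units (rmorph_unit f (uvalP x)).

(* U^0 is the unit group of the ring of integers, U^m = 1 + P^m for m >= 1.   *)
Definition unit_filt (R : realType) (K : fieldType) (v : nonarch_abs R K)
    (w : K) (m : nat) : set (units K) :=
  [set x : units K | if m is 0 then int_ring v (uval x) /\ int_ring v (uval x)^-1
           else ideal_pow v w m (uval x - 1)].

Definition setmul (G : groupType) (A B : set G) : set G :=
  [set (x * y)%g | x in A & y in B].

(* A linear action on the subspace rep_carrier of rep_space; the values of    *)
(* rep_act outside of rep_carrier, or at elements outside of the acting       *)
(* subgroup, are irrelevant.                                                  *)
Record prerep (K : fieldType) (G : groupType) := Prerep {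
  rep_space : lmodType K;
  rep_carrier : set rep_space;
  rep_act : G -> rep_space -> rep_space }.

Arguments rep_carrier {K G} rho _ : rename.
Arguments rep_act {K G} rho g x : rename.

Section LinearAlgebra.
Variables (K : fieldType) (V : lmodType K).

Definition lin_subspace (S : set V) : Prop :=
  S 0 /\ forall (a : K) (x y : V), S x -> S y -> S (a *: x + y).

Definition linear_on (W : lmodType K) (S : set V) (f : V -> W) : Prop :=
  forall (a : K) (x y : V), S x -> S y -> f (a *: x + y) = a *: f x + f y.

Definition basis_on (S : set V) (d : nat) (b : 'I_d -> V) : Prop :=
  (forall i, S (b i)) /\
  forall x, S x -> exists! c : 'rV[K]_d, x = \sum_i c 0 i *: b i.

(* S is finite dimensional and the endomorphism f of S has trace t.           *)
Definition has_trace (S : set V) (f : V -> V) (t : K) : Prop :=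
  exists (d : nat) (b : 'I_d -> V) (A : 'M[K]_d),
    [/\ basis_on S b, (forall j, f (b j) = \sum_i A i j *: b i) & \tr A = t].

End LinearAlgebra.

(* N is a fundamental system of neighbourhoods of 1 in G, and H a subgroup.   *)
Section SmoothRepresentations.
Variables (K : fieldType) (G : groupType) (N : nat -> set G) (H : set G).
Implicit Types (chi : G -> K) (rho : prerep K G).

Definition is_character chi : Prop :=
  [/\ forall g, H g -> chi g != 0,
      forall g h, H g -> H h -> chi (g * h)%g = chi g * chi h
    & exists k, forall g, H g -> N k g -> chi g = 1].

Definition smooth_rep rho : Prop :=
  let S := rep_carrier rho in
  let act := rep_act rho in
  [/\ lin_subspace S,
      forall g, H g -> linear_on S (act g) /\ (forall x, S x -> S (act g x)),
      forall x, S x -> act 1%g x = x,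
      forall g h x, H g -> H h -> S x -> act (g * h)%g x = act g (act h x)
    & forall x, S x -> exists k, forall g, H g -> N k g -> act g x = x].

Definition irreducible_rep rho : Prop :=
  let S := rep_carrier rho in
  [/\ smooth_rep rho, S <> [set 0]
    & forall T : set (rep_space rho), T `<=` S -> lin_subspace T ->
        (forall g x, H g -> T x -> T (rep_act rho g x)) ->
        T = [set 0] \/ T = S].

Definition rep_iso rho1 rho2 : Prop :=
  exists T : rep_space rho1 -> rep_space rho2,
    [/\ linear_on (rep_carrier rho1) T,
        set_bij (rep_carrier rho1) (rep_carrier rho2) T
      & forall g x, H g -> rep_carrier rho1 x ->
          T (rep_act rho1 g x) = rep_act rho2 g (T x)].

(* The restriction of rho to H is a (finite) direct sum of copies of psi.     *)
Definition sum_of_copies rho (psi : G -> K) : Prop :=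
  exists (d : nat) (b : 'I_d -> rep_space rho),
    basis_on (rep_carrier rho) b /\
    forall g i, H g -> rep_act rho g (b i) = psi g *: b i.

Definition rep_trace rho (g : G) (t : K) : Prop :=
  has_trace (rep_carrier rho) (rep_act rho g) t.

End SmoothRepresentations.

Definition char_rep (K : fieldType) (G : groupType) (chi : G -> K) :
    prerep K G :=
  @Prerep K G K^o setT (fun g x => chi g *: x).

Definition rep_twist (K : fieldType) (G : groupType) (rho : prerep K G)
    (chi : G -> K) : prerep K G :=
  @Prerep K G (rep_space rho) (rep_carrier rho)
    (fun g x => chi g *: rep_act rho g x).

(* Smooth induction from H to G: G acts by right translations on functions    *)
(* that are left equivariant under H and right invariant under an open        *)
(* subgroup of G.                                                             *)
Definition smooth_ind (K : fieldType) (G : groupType) (N : nat -> set G)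
    (H : set G) (sigma : prerep K G) : prerep K G :=
  @Prerep K G (G -> rep_space sigma)
    [set f | [/\ forall g, rep_carrier sigma (f g),
                 forall h g, H h -> f (h * g)%g = rep_act sigma h (f g)
               & exists k, forall g u, N k u -> f (g * u)%g = f g]]
    (fun g f x => f (x * g)%g).

(* Coefficients are written on the left: sum_i a_i Pi^i is the polynomial     *)
(* sum_i a_i 'X^i of {poly E}, and Pi a = phi(a) Pi.                          *)
Definition twpoly (E : fieldType) (phi : {rmorphism E -> E}) : Type := {poly E}.

Section TwistedPolynomials.
Variables (E : fieldType) (phi : {rmorphism E -> E}).
Local Notation T := (twpoly phi).

HB.instance Definition _ := GRing.Zmodule.copy T {poly E}.

(* Left multiplication by Pi, since Pi b_j Pi^j = phi(b_j) Pi^(j+1).         *)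
Definition twshift (q : {poly E}) : {poly E} := map_poly phi q * 'X.

Definition twmul (p q : T) : T :=
  \sum_(i < size (p : {poly E})) (p : {poly E})`_i *: iter i twshift q.

Definition twC (a : E) : T := a%:P.
Definition twX : T := 'X.

Let shD i (p q : {poly E}) :
  iter i twshift (p + q) = iter i twshift p + iter i twshift q.
Proof. by elim: i => //= i ->; rewrite /twshift rmorphD mulrDl. Qed.

Let sh0 i : iter i twshift 0 = 0.
Proof. by elim: i => //= i ->; rewrite /twshift rmorph0 mul0r. Qed.

Let shZ i a (p : {poly E}) :
  iter i twshift (a *: p) = iter i phi a *: iter i twshift p.
Proof.
by elim: i => //= i ->; rewrite /twshift map_polyZ scalerAl.
Qed.

Let sh_sum i I (r : seq I) (F : I -> {poly E}) :
  iter i twshift (\sum_(j <- r) F j) = \sum_(j <- r) iter i twshift (F j).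
Proof.
by elim: r => [|j r IH]; rewrite ?big_nil ?sh0// !big_cons shD IH.
Qed.

Let shX i j : iter i twshift 'X^j = 'X^(i + j).
Proof.
by elim: i => //= i ->; rewrite /twshift map_polyXn -exprSr.
Qed.

Let twmulE k (p q : {poly E}) : (size p <= k)%N ->
  twmul p q = \sum_(i < k) p`_i *: iter i twshift q.
Proof.
move=> pk; rewrite /twmul (big_ord_widen k (fun i => p`_i *: iter i twshift q) pk).
rewrite [RHS](bigID (fun i : 'I_k => i < size p)%N)/=.
rewrite [X in _ = _ + X]big1 ?addr0// => i.
by rewrite -leqNgt => /leq_sizeP -> //; rewrite scale0r.
Qed.

Let twmulDl : left_distributive twmul +%R.
Proof.
move=> p q r; pose k := maxn (size (p : {poly E})) (size (q : {poly E})).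
rewrite !(@twmulE k) ?leq_maxl ?leq_maxr//; last exact: size_polyD.
by rewrite -big_split; apply: eq_bigr => i _; rewrite coefD scalerDl.
Qed.

Let twmulDr : right_distributive twmul +%R.
Proof.
move=> p q r; rewrite /twmul -big_split; apply: eq_bigr => i _.
by rewrite shD scalerDr.
Qed.

Let twmul0l r : twmul 0 r = 0.
Proof. by rewrite /twmul size_poly0 big_ord0. Qed.

Let twmul_suml I (s : seq I) (F : I -> {poly E}) r :
  twmul (\sum_(j <- s) F j) r = \sum_(j <- s) twmul (F j) r.
Proof.
elim: s => [|j s IH]; first by rewrite !big_nil twmul0l.
by rewrite !big_cons twmulDl IH.
Qed.

Let twmulZX a i r : twmul (a *: 'X^i) r = a *: iter i twshift r.
Proof.
rewrite (@twmulE i.+1); last by rewrite (leq_trans (size_scale_leq _ _))// size_polyXn.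
rewrite big_ord_recr/= big1 ?add0r => [|j _]; last first.
  by rewrite coefZ coefXn ltn_eqF// mulr0 scale0r.
by rewrite coefZ coefXn eqxx mulr1.
Qed.

Let twmulA : associative twmul.
Proof.
move=> p q r; rewrite {1}/twmul [X in _ = twmul X _]/twmul twmul_suml.
apply: eq_bigr => i _.
have -> : iter i twshift q =
    \sum_(j < size (q : {poly E})) iter i twshift ((q : {poly E})`_j *: 'X^j).
  by rewrite -sh_sum -poly_def coefK.
rewrite [X in iter _ _ X]/twmul sh_sum.
rewrite !scaler_sumr twmul_suml; apply: eq_bigr => j _.
by rewrite !shZ shX !scalerA twmulZX iterD.
Qed.

Let twmulC a (r : {poly E}) : twmul a%:P r = a *: r.
Proof. by rewrite -alg_polyC -(expr0 'X) twmulZX. Qed.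

Let twmul1l : left_id (1 : {poly E}) twmul.
Proof. by move=> p; rewrite /twmul size_poly1 big_ord1 coef1 scale1r. Qed.

Let twmul1r : right_id (1 : {poly E}) twmul.
Proof.
move=> p; rewrite -[RHS](@coefK E) poly_def; apply: eq_bigr => i _.
by rewrite -(expr0 'X) shX addn0.
Qed.

Let twone_neq0 : (1 : {poly E}) != 0 :> T.
Proof. exact: (oner_neq0 {poly E}). Qed.

HB.instance Definition _ := GRing.Zmodule_isNzRing.Build T
  twmulA twmul1l twmul1r twmulDl twmulDr twone_neq0.

Fact twC_is_zmod_morphism : zmod_morphism twC.
Proof. by move=> a b; rewrite /twC polyCB. Qed.

Fact twC_is_monoid_morphism : monoid_morphism twC.
Proof.
by split=> // a b; rewrite [RHS]twmulC /twC polyCM mul_polyC.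
Qed.

HB.instance Definition _ :=
  GRing.isZmodMorphism.Build E T twC twC_is_zmod_morphism.
HB.instance Definition _ :=
  GRing.isMonoidMorphism.Build E T twC twC_is_monoid_morphism.

Lemma twXC (a : E) : twX * twC a = twC (phi a) * twX.
Proof.
have -> : twX * twC a = twmul (1 *: 'X^1) (twC a) by rewrite scale1r expr1.
rewrite [RHS]twmulC twmulZX scale1r /= /twshift /twC map_polyC/=.
by rewrite mul_polyC.
Qed.

End TwistedPolynomials.

Definition two_sided_ideal (A : pzRingType) (t : A) : set A :=
  [set x | exists s : seq (A * A), x = \sum_(ab <- s) ab.1 * t * ab.2].

Section DivisionAlgebra.
Variables (R : realType) (F : fieldType) (E : fieldExtType F).
Variables (vE : nonarch_abs R E) (phi : {rmorphism E -> E}) (n : nat) (w : F).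
Variables (D : unitRingType) (pi : {rmorphism twpoly phi -> D}).

(* pi identifies D with E<Pi> / (Pi^n - w).                                   *)
Definition is_cyclic_quotient : Prop :=
  (forall d : D, exists p, pi p = d) /\
  (forall p, pi p = 0 <->
     two_sided_ideal (twX phi ^+ n - twC phi w%:A) p).

Definition embD : {rmorphism E -> D} := [the {rmorphism E -> D} of pi \o twC phi].

Definition PiD : D := pi (twX phi).

Definition OD : set D :=
  [set \sum_(j < n) embD (a j) * PiD ^+ j
     | a in [set a : 'I_n -> E | forall j, int_ring vE (a j)]].

Definition PD (m : nat) : set D := [set PiD ^+ m * y | y in OD].

(* C' = sum_(1 <= j < n) E Pi^j.                                              *)
Definition Cperp : set D :=
  [set \sum_(j < n | (0 < j)%N) embD (a j) * PiD ^+ j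
     | a in [set: 'I_n -> E]].

(* U_D^m = 1 + P_D^m, to be used only for m >= 1.                             *)
Definition UD (m : nat) : set (units D) := [set g : units D | PD m ((g : D) - 1)].

Definition D_nbhs (k : nat) : set (units D) := UD k.+1.

(* 1 + (C' cap P_D^m).                                                        *)
Definition UC (m : nat) : set (units D) :=
  [set g : units D | (Cperp `&` PD m) ((g : D) - 1)].

Definition Eunits : set (units D) := range (units_map embD).

Definition unitsFE : units F -> units E := units_map (in_alg E).

Definition Funits : set (units D) := range (units_map embD \o unitsFE).

(* D splits over E: it acts by right multiplication on the left E-vector      *)
(* space D with basis 1, Pi, .., Pi^(n-1). The reduced norm of g is the       *)
(* determinant of the matrix of g, which lies in F.                           *)
Definition Nrd (g : D) : F :=
  xget 0 [set t | exists2 A : 'M[E]_n,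
    (forall i : 'I_n, PiD ^+ i * g = \sum_(j < n) embD (A i j) * PiD ^+ j)
    & \det A = t%:A].

Definition Nrd_units (g : units D) : units F := insubd (1%g : units F) (Nrd g : F).

End DivisionAlgebra.

Section PrimitiveCharacters.
Variables (R : realType) (F : fieldType) (E : splittingFieldType F).
Variables (vE : nonarch_abs R E) (w : E) (K : fieldType).
Implicit Types theta : units E -> K.

Definition gal_units (g : gal_of {:E}) : units E -> units E := units_map g.

Definition has_level theta (r : nat) : Prop :=
  (forall x, unit_filt vE w r x -> theta x = 1) /\
  forall s, (forall x, unit_filt vE w s x -> theta x = 1) -> (r <= s)%N.

Definition primitive_character theta (r : nat) : Prop :=
  [/\ is_character (unit_filt vE w) setT theta, has_level theta r, (2 <= r)%N
    & forall g, g \in 'Gal({:E} / 1)%g -> g != 1%g ->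
        has_level (fun x => theta x / theta (gal_units g x)) r].

Definition very_regular (x : units E) : Prop :=
  unit_filt vE w 0 x /\
  forall g, g \in 'Gal({:E} / 1)%g ->
    unit_filt vE w 1 (gal_units g x * x^-1)%g -> g = 1%g.

End PrimitiveCharacters.

(* Main.v *)
(* Write h = n (r0 - 1), let pr : D -> E be the projection along C' and put    *)
(* Theta g = theta (pr g). Theta is multiplicative on U_D^i U_D^j for          *)
(* i + j > h, because pr (d d') - pr d pr d' only sees the components of d and *)
(* d' in C'. If g stabilises the restriction of Theta to U_D^s, then n divides *)
(* the valuation of g, since conjugation by Pi^j twists the leading term of    *)
(* theta by the j-th power of the Frobenius and theta is primitive; testing on *)
(* 1 + b Pi^(h - i) then removes the degree i component of g for the           *)
(* successive i < M not divisible by n, so that g lies in E^x U_D^M. Mackey's  *)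
(* criterion gives irreducibility, and since a very regular x only fixes the   *)
(* cosets of the powers of Pi, the induced trace is a sum over Galois          *)
(* conjugates. For even r0 the representation sigma is itself induced: from    *)
(* Theta on E^x U_D^((h + 1)/2) if n is odd; if n is even, from E^x U_D^(h/2), *)
(* modulo the kernel of Theta an extension of a Heisenberg group by E^x, with  *)
(* Theta times the Weil representation of the norm one elements u of F_(Q^2)   *)
(* over F_Q, Q = q^(n/2), whose trace is -1 for u <> 1. Finally eps o Nrd is   *)
(* trivial on E^x U_D^1, as this group is generated up to arbitrarily deep     *)
(* subgroups by E^x and commutators.                                           *)
Require Import Defs.
From HB Require Import structures.
From mathcomp Require Import all_boot all_order all_fingroup all_algebra.
From mathcomp Require Import all_field.
From mathcomp Require Import all_classical all_reals topology.
From mathcomp Require Import ring zify.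

Set Implicit Arguments.
Unset Strict Implicit.
Unset Printing Implicit Defensive.

Import Order.TTheory GRing.Theory Num.Theory.

Local Open Scope classical_set_scope.
Local Open Scope ring_scope.

(** * Smooth representations and induction *)

(** All computations rest on two structures on D. The maximum [dnorm] of |a_j| c^j, where c^n = |w|,
    is a multiplicative norm. The symbols [sy i] identify P_D^i / P_D^(i+1) with the residue field k
    of E and multiply by the twisted rule [syM]. Commutators therefore have explicit symbols
    ([conj_symbol]), and in degrees divisible by n a symbol can be removed by a unit of E
    ([UD_strip]).

    Put t = r0 - 1 and h = n t. On U_E^t the character theta is an additive character psi of k, and
    primitivity says that no power of the Frobenius outside the n-th ones fixes psi ([psi_prim]).
    The function [Theta], theta composed with the projection along C', is multiplicative on E^x
    U_D^s once 2s > h ([Theta_mul]), since the error comes from products of C' parts. For odd r0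
    this covers s = m, so [Theta] is the required extension; it is unique by [UD_split]. For even r0
    it does not reach down to m. If n is odd, sigma is induced from [Theta] on E^x U_D^((h + 1)/2).
    If n is even, multiplicativity just fails at s = h/2, where symbols form a Heisenberg group over
    k and E^x acts through elements of norm one. The explicit operators of [heisenberg_weil] extend
    the Heisenberg representation to them with trace -1, which is the sign (-1)^(n - 1)
    ([even_level_rep]).

    Irreducibility of rho uses only that a deep group U_D^s acts through [Theta], so it applies to
    every admissible sigma: by [Theta_stabiliser] distinct cosets carry distinct conjugates of
    [Theta], and [ind_on_irreducible] concludes. For traces, [fixed_coset] shows that a very regular
    x fixes only the cosets of Pi^j with j < n, and conjugation by Pi^j is the j-th power of the
    Frobenius, so [ind_on_trace] gives the Galois sum. The twist by eps o Nrd is harmless because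
    this character is trivial on the inducing subgroup ([eps_Nrd_trivial], [smooth_ind_twist]). The
    facts on E / F come from a counting argument in [unramified_residue]. *)

Section Transversals.
Variable G : groupType.
Implicit Types (H L : set G).

Definition subgroup H : Prop :=
  [/\ H 1%g, forall x y, H x -> H y -> H (x * y)%g
    & forall x, H x -> H x^-1%g].

Lemma subgroupT : subgroup setT.
Proof. by []. Qed.

Definition transversal H L (I : finType) (r : I -> G) : Prop :=
  [/\ forall i, L (r i), forall g, L g -> exists i, H (g * (r i)^-1)%g
    & forall i j, H (r i * (r j)^-1)%g -> i = j].

(** Lying in the same coset of [H] is an equivalence on the indices; one index per class is kept,
    and only if its element lies in [L]. *)
Lemma transversal_exists H L (X : finType) (r : X -> G) :
    subgroup H -> subgroup L -> H `<=` L ->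
    (forall g, L g -> exists x, H (g * (r x)^-1)%g) ->
  exists (I : finType) (r' : I -> G), transversal H L r'.
Proof.
move=> [H1 HM HV] [L1 LM LV] HL cov.
pose e x y := `[< H (r x * (r y)^-1)%g >].
have exx x : e x x by apply/asboolP; rewrite mulgV.
have esym x y : e x y -> e y x.
  by move=> /asboolP /HV h; apply/asboolP; rewrite invMg invgK in h.
have etr x y z : e x y -> e y z -> e x z.
  move=> /asboolP h1 /asboolP h2; apply/asboolP.
  by have := HM _ _ h1 h2; rewrite mulgA mulgKV.
(* [pick] depends only on the values of its predicate, so equivalent indices receive the same
   canonical index; the default cannot occur since [e x x] holds. *)
pose f x := odflt x [pick y | e x y].
have ef x : e x (f x).
  by rewrite /f; case: pickP => [y //|/(_ x)]; rewrite exx.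
have fe x y : e x y -> f x = f y.
  move=> exy; rewrite /f.
  have -> : [pick z | e x z] = [pick z | e y z].
    apply: eq_pick => z; apply/idP/idP => ez; last exact: etr ez.
    by apply: etr ez; exact: esym.
  by case: pickP => // /(_ y); rewrite exx.
pose I := {x : X | (f x == x) && `[< L (r x) >]}.
exists I, (fun i : I => r (val i)); split.
- by move=> i; have /andP[_ /asboolP] := valP i.
- move=> g Lg; have [x Hx] := cov g Lg.
  have /asboolP Hx' := ef x.
  have Hg : H (g * (r (f x))^-1)%g by have := HM _ _ Hx Hx'; rewrite mulgA mulgKV.
  have Lf : L (r (f x)).
    by have := LM _ _ (LV _ (HL _ Hg)) Lg; rewrite invMg invgK mulgKV.
  have If : (f (f x) == f x) && `[< L (r (f x)) >].
    by rewrite (fe (f x) x) ?eqxx; [apply/asboolP|exact: esym].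
  by exists (Sub (f x) If).
move=> i j Hij; apply: val_inj.
have /andP[/eqP <- _] := valP i; have /andP[/eqP <- _] := valP j.
by apply: fe; apply/asboolP.
Qed.

End Transversals.

Lemma sum_enum_val (V : nmodType) (B : finType) (f : B -> V) :
  \sum_b f b = \sum_(i < #|B|) f (enum_val i).
Proof. by rewrite (reindex _ (onW_bij _ (@enum_val_bij B))). Qed.

Section FiniteBases.
Variables (K : fieldType) (V : lmodType K) (S : set V).

(** Any finite index type is allowed, so that bases of induced representations can be indexed by
    pairs of a coset and a basis index. *)
Definition fin_basis (B : finType) (e : B -> V) : Prop :=
  [/\ forall b, S (e b),
      forall x, S x -> exists c : B -> K, x = \sum_b c b *: e b
    & forall c : B -> K, \sum_b c b *: e b = 0 -> forall b, c b = 0].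

Lemma fin_basis_basis_on (B : finType) (e : B -> V) :
  fin_basis e -> basis_on S (fun i : 'I_#|B| => e (enum_val i)).
Proof.
move=> [Se span ind]; split=> // x Sx.
have [c cE] := span x Sx.
exists (\row_i c (enum_val i)); split.
  rewrite cE (@sum_enum_val _ B) /=.
  by apply: eq_bigr => i _; rewrite mxE.
move=> c' c'E; apply/rowP => i; rewrite mxE.
have /ind/(_ (enum_val i)) : \sum_b (c b - c' 0 (enum_rank b)) *: e b = 0.
  under eq_bigr do rewrite scalerBl.
  rewrite sumrB -cE [X in _ - X]sum_enum_val.
  by under [X in _ - X]eq_bigr do rewrite enum_valK; rewrite -c'E subrr.
by rewrite enum_valK => /eqP; rewrite subr_eq0 => /eqP.
Qed.

Lemma has_trace_fin (B : finType) (e : B -> V) (f : V -> V) (A : B -> B -> K) :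
    fin_basis e -> (forall b, f (e b) = \sum_b' A b' b *: e b') ->
  has_trace S f (\sum_b A b b).
Proof.
move=> eB fE; exists #|B|, (fun i : 'I_#|B| => e (enum_val i)).
exists (\matrix_(i, j) A (enum_val i) (enum_val j)); split.
- exact: fin_basis_basis_on.
- move=> j; rewrite fE (@sum_enum_val _ B) /=.
  by apply: eq_bigr => i _; rewrite mxE.
rewrite /mxtrace [RHS](@sum_enum_val _ B) /=.
by apply: eq_bigr => i _; rewrite mxE.
Qed.

(** [S] is not known to contain 0 here, so uniqueness is applied to the expansion of [b i], to which
    the vanishing combination is added. *)
Lemma basis_on_fin d (b : 'I_d -> V) : basis_on S b -> fin_basis b.
Proof.
move=> [Sb span]; split=> // [x Sx|c c0 i].
  by have [c [cE _]] := span x Sx; exists (c 0).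
have [d0 Hd] : exists d0 : 'rV[K]_d, \sum_j d0 0 j *: b j = b i
    /\ forall d' : 'rV[K]_d, b i = \sum_j d' 0 j *: b j -> d0 = d'.
  by have [d0 [H1 H2]] := span _ (Sb i); exists d0.
have {Hd} [d0E Hd] := Hd.
have /Hd : b i = \sum_j (d0 + \row_j c j) 0 j *: b j.
  rewrite -d0E -[LHS]addr0 -[X in _ + X]c0 -big_split /=.
  by apply: eq_bigr => j _; rewrite !mxE scalerDl.
by move/eqP; rewrite -subr_eq0 opprD addNKr oppr_eq0 => /eqP/rowP/(_ i); rewrite !mxE.
Qed.

End FiniteBases.
Section SmoothReps.
Variables (K : fieldType) (G : groupType) (N : nat -> set G) (H : set G).

Lemma smooth_act_sum (sigma : prerep K G) (I : finType) (c : I -> K)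
    (b : I -> rep_space sigma) h :
    smooth_rep N H sigma -> H h -> (forall i, rep_carrier sigma (b i)) ->
  rep_act sigma h (\sum_i c i *: b i) = \sum_i c i *: rep_act sigma h (b i).
Proof.
move=> [[S0 SD] lin _ _ _] Hh Sb.
have [lh _] := lin h Hh.
have act0 : rep_act sigma h 0 = 0.
  have := lh 1 0 0 S0 S0; rewrite scaler0 addr0 scale1r => /eqP.
  by rewrite -subr_eq0 opprD addNKr oppr_eq0 => /eqP.
suff [_ ->//] : rep_carrier sigma (\sum_i c i *: b i) /\ rep_act sigma h
    (\sum_i c i *: b i) = \sum_i c i *: rep_act sigma h (b i) by [].
apply: (big_rec2 (fun x y => rep_carrier sigma x /\ rep_act sigma h x = y)) => //.
by move=> i x y _ [Sy xE]; split; [exact: SD|rewrite lh// xE].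
Qed.

Lemma smooth_act0 (sigma : prerep K G) h :
  smooth_rep N H sigma -> H h -> rep_act sigma h 0 = 0.
Proof.
move=> sm Hh; have := @smooth_act_sum sigma 'I_0 (fun=> 0) (fun=> 0) h sm Hh.
by rewrite !big_ord0; apply; case.
Qed.

Lemma smooth_sum (sigma : prerep K G) (I : finType) (c : I -> K)
    (b : I -> rep_space sigma) :
    smooth_rep N H sigma -> (forall i, rep_carrier sigma (b i)) ->
  rep_carrier sigma (\sum_i c i *: b i).
Proof.
move=> [[S0 SD] _ _ _ _] Sb.
by apply: (big_rec (rep_carrier sigma)) => // i x _ Sx; exact: SD.
Qed.

(** In the translated basis h b_i the matrix of h g h^-1 is that of g in the basis b_i. *)
Lemma has_trace_conj (sigma : prerep K G) h g t :
    subgroup H -> smooth_rep N H sigma -> H h -> H g ->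
  rep_trace sigma g t -> rep_trace sigma (h * g * h^-1)%g t.
Proof.
move=> [H1 HM HV] sm Hh Hg [d [b [A [bB bA trA]]]].
have [_ lin act1 actM _] := sm.
have [Sb span ind] := basis_on_fin bB.
have Sact k x : H k -> rep_carrier sigma x -> rep_carrier sigma (rep_act sigma k x).
  by move=> Hk; have [_] := lin k Hk; exact.
have hV := HV _ Hh.
rewrite /rep_trace -trA.
apply: (@has_trace_fin K _ _ _ (fun i => rep_act sigma h (b i)) _ (fun i j => A i j)).
  split=> [i|x Sx|c c0].
  - exact: Sact.
  - have [c cE] := span _ (Sact _ _ hV Sx).
    exists c; rewrite -smooth_act_sum// -cE -actM// mulgV act1//.
  apply: ind; rewrite -[LHS]act1; last exact: smooth_sum.
  rewrite -(mulVg h) actM//; last exact: smooth_sum.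
  by rewrite smooth_act_sum// c0 smooth_act0.
move=> j.
have Hhg := HM _ _ Hh Hg.
have Shj := Sact h _ Hh (Sb j).
rewrite actM// -[X in rep_act _ (h * g) X]actM// mulVg act1//.
by rewrite actM// bA smooth_act_sum.
Qed.

Section CharRep.
Variable (chi : G -> K).
Hypothesis chiP : is_character N H chi.
Hypothesis HG : subgroup H.

Lemma char_rep_smooth : smooth_rep N H (char_rep chi).
Proof.
have [chi0 chiM [k chik]] := chiP; have [H1 _ _] := HG.
split=> //=.
- move=> g Hg; split=> // a x y _ _.
  by rewrite scalerDr !scalerA mulrC.
- move=> x _; have : chi 1%g * chi 1%g = chi 1%g * 1 by rewrite -chiM// mulg1 mulr1.
  by move/(mulfI (chi0 _ H1)) => ->; rewrite scale1r.
- by move=> g h x Hg Hh _; rewrite chiM// scalerA.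
by move=> x _; exists k => g Hg Ng; rewrite chik// scale1r.
Qed.

Lemma char_rep_irreducible : irreducible_rep N H (char_rep chi).
Proof.
split; first exact: char_rep_smooth.
  by move/seteqP => [/(_ 1 I)/= /eqP]; rewrite oner_eq0.
move=> T _ [T0 TD] _; have [T00|] := pselect (T = [set 0]); first by left.
move=> /eqP TN0; right; apply/seteqP; split=> // y _.
have [x [Tx /eqP x0]] : exists x, T x /\ x <> 0.
  apply: contrapT => /forallNP TE; case/eqP: TN0; apply/seteqP; split=> x /=.
    by move=> Tx; apply: contrapT => x0; apply: (TE x).
  by move=> ->.
have := TD (y / x : K) x 0 Tx T0; rewrite addr0.
by have -> : ((y : K) / x : K) *: (x : K^o) = y by rewrite -[LHS]/(_ * _) divfK.
Qed.

Definition one_basis (i : 'I_1) : rep_space (char_rep chi) := 1 : K^o.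

Lemma char_rep_basis : fin_basis (rep_carrier (char_rep chi)) one_basis.
Proof.
split=> // [x _|c]; first by exists (fun=> x : K); rewrite big_ord1 -[RHS]/(_ * _) mulr1.
by rewrite big_ord1 -[LHS]/(_ * _) mulr1 => c0 b; rewrite ord1.
Qed.

Lemma char_rep_trace g : rep_trace (char_rep chi) g (chi g).
Proof.
have <- : \sum_(i < 1) chi g = chi g by rewrite big_ord1.
apply: (has_trace_fin (A := fun _ _ => chi g) char_rep_basis) => b.
by rewrite big_ord1.
Qed.

End CharRep.
End SmoothReps.

Lemma lincomb_fctE (T : Type) (K : pzRingType) (V : lmodType K) (a : K)
  (f g : T -> V) x : (a *: f + g) x = a *: f x + g x.
Proof. by []. Qed.

(** * Induced representations: bases, traces and Mackey irreducibility *)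

Section Induction.
Variables (K : fieldType) (G : groupType) (N : nat -> set G) (H L : set G).
Variable sigma : prerep K G.

(** Induction to an intermediate group [L] uses functions on all of [G] vanishing off [L], so the
    ambient space does not depend on [L], and [L = setT] gives [smooth_ind]. *)
Definition ind_on : prerep K G :=
  @Prerep K G (G -> rep_space sigma)
    [set f | [/\ forall g, rep_carrier sigma (f g),
                 forall h g, H h -> f (h * g)%g = rep_act sigma h (f g),
                 exists k, forall g u, N k u -> f (g * u)%g = f g
               & forall g, ~ L g -> f g = 0]]
    (fun g f x => f (x * g)%g).

Hypotheses (HG : subgroup H) (LG : subgroup L) (HL : H `<=` L).
Hypotheses (Nsub : forall k, N k.+1 `<=` N k)
  (Nconj : forall k g u, N k u -> N k (g * u * g^-1)%g)
  (NH : exists k, N k `<=` H).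
Hypothesis sm : smooth_rep N H sigma.

Local Notation S := (rep_carrier sigma).
Local Notation act := (rep_act sigma).

Lemma Nsub_le j k : (j <= k)%N -> N k `<=` N j.
Proof.
move=> /subnK <-; elim: (k - j)%N => // i IH x /=.
by rewrite addSn => /Nsub/IH.
Qed.

Lemma ind_on_smooth : smooth_rep N L ind_on.
Proof.
have [L1 LM LV] := LG; have [[S0 SD] lin act1 actM _] := sm.
split=> /=.
- split.
    split=> //; [|by exists 0%N].
    by move=> h g Hh; rewrite [RHS](smooth_act0 sm).
  move=> a f1 f2 [f1S f1H [k1 f1N] f1L] [f2S f2H [k2 f2N] f2L]; split.
  + by move=> g; apply: SD.
  + move=> h g Hh; rewrite lincomb_fctE.
    have [lh _] := lin h Hh.
    by rewrite [RHS](lh a _ _ (f1S g) (f2S g)) f1H// f2H.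
  + exists (maxn k1 k2) => g u Nu.
    rewrite !lincomb_fctE f1N ?f2N//.
      exact: (Nsub_le (leq_maxr _ _) Nu).
    exact: (Nsub_le (leq_maxl _ _) Nu).
  + by move=> g Lg; rewrite lincomb_fctE f1L// f2L// scaler0 addr0.
- move=> g Lg; split=> // f [fS fH [k fN] fL]; split=> //.
  + by move=> h x Hh; rewrite -mulgA; exact: fH.
  + exists k => x u Nu; rewrite -(fN (x * g)%g (g^-1 * u * g)%g).
      by rewrite !mulgA mulgK.
    by have := Nconj g^-1%g Nu; rewrite invgK.
  + move=> x Lx; apply: fL => Lxg; apply: Lx.
    by have := LM _ _ Lxg (LV _ Lg); rewrite mulgK.
- by move=> f _; apply/funext => x; rewrite mulg1.
- by move=> g h f _ _ _; apply/funext => x; rewrite mulgA.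
by move=> f [_ _ [k fN] _]; exists k => g _ Ng; apply/funext => x; rewrite fN.
Qed.

Definition coset_fun (v : rep_space sigma) (t : G) : rep_space ind_on :=
  fun g => if `[< H (g * t^-1)%g >] then act (g * t^-1)%g v else 0.

Lemma coset_funE v t g : H (g * t^-1)%g -> coset_fun v t g = act (g * t^-1)%g v.
Proof. by move=> h; rewrite /coset_fun; case: asboolP. Qed.

Lemma coset_fun0 v t g : ~ H (g * t^-1)%g -> coset_fun v t g = 0.
Proof. by move=> h; rewrite /coset_fun; case: asboolP. Qed.

Lemma coset_fun_in v t : S v -> L t -> rep_carrier ind_on (coset_fun v t).
Proof.
move=> Sv Lt; have [H1 HM HV] := HG; have [L1 LM LV] := LG.
have [[S0 SD] lin act1 actM smv] := sm.
split.
- move=> g; rewrite /coset_fun; case: asboolP => // h.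
  by have [_] := lin _ h; exact.
- move=> h g Hh; have [Hg|Hg] := pselect (H (g * t^-1)%g).
    have Hhg : H (h * g * t^-1)%g by rewrite -mulgA; exact: HM.
    by rewrite !coset_funE// -mulgA actM.
  rewrite !coset_fun0 ?(smooth_act0 sm)// => Hhg; apply: Hg.
  by have := HM _ _ (HV _ Hh) Hhg; rewrite !mulgA mulVg mul1g.
- have [k1 NH1] := NH; have [k2 fix2] := smv v Sv.
  exists (maxn k1 k2) => g u Nu.
  have Nu' := Nconj t Nu.
  have Hu' := NH1 _ (Nsub_le (leq_maxl _ _) Nu').
  have E : (g * u * t^-1 = (g * t^-1) * (t * u * t^-1))%g by rewrite !mulgA mulgKV.
  have [Hg|Hg] := pselect (H (g * t^-1)%g).
    have Hgu := HM _ _ Hg Hu'.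
    rewrite !coset_funE ?E// actM// fix2//; exact: (Nsub_le (leq_maxr _ _) Nu').
  rewrite !coset_fun0 ?E// => Hgu; apply: Hg.
  by have := HM _ _ Hgu (HV _ Hu'); rewrite mulgK.
- move=> g Lg; rewrite coset_fun0// => /HL Lgt; apply: Lg.
  by have := LM _ _ Lgt Lt; rewrite mulgKV.
Qed.

Lemma coset_fun_sum (I : finType) (c : I -> K) (b : I -> rep_space sigma) t :
    (forall i, S (b i)) ->
  coset_fun (\sum_i c i *: b i) t = \sum_i c i *: coset_fun (b i) t.
Proof.
move=> Sb; apply/funext => g; rewrite fct_sumE.
have [Hg|Hg] := pselect (H (g * t^-1)%g).
  rewrite coset_funE// (smooth_act_sum _ sm)//; apply: eq_bigr => i _.
  by rewrite -[RHS]/(c i *: coset_fun (b i) t g) coset_funE.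
rewrite coset_fun0// big1// => i _.
by rewrite -[LHS]/(c i *: coset_fun (b i) t g) coset_fun0// scaler0.
Qed.

Lemma coset_fun_act v t x : rep_act ind_on x (coset_fun v t) = coset_fun v (t * x^-1).
Proof. by apply/funext => g; rewrite /= /coset_fun invMg invgK !mulgA. Qed.

Lemma coset_fun_mull v t h : S v -> H h ->
  coset_fun v (h^-1 * t) = coset_fun (act h v) t.
Proof.
move=> Sv Hh; have [H1 HM HV] := HG; have [_ lin _ actM _] := sm.
apply/funext => g; have E : (g * (h^-1 * t)^-1 = g * t^-1 * h)%g.
  by rewrite invMg invgK mulgA.
have [Hg|Hg] := pselect (H (g * t^-1)%g).
  have Hgh : H (g * t^-1 * h)%g := HM _ _ Hg Hh.
  by rewrite [LHS]coset_funE E// coset_funE// actM.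
rewrite !coset_fun0 ?E// => Hgu; apply: Hg.
by have := HM _ _ Hgu (HV _ Hh); rewrite mulgK.
Qed.

Section Transversal.
Variables (I : finType) (r : I -> G).
Hypothesis rP : transversal H L r.

Lemma transversal_uniq i j g : H (g * (r i)^-1)%g -> H (g * (r j)^-1)%g -> i = j.
Proof.
have [H1 HM HV] := HG; have [_ _ rI] := rP => gi gj.
by apply: rI; have := HM _ _ (HV _ gi) gj; rewrite invMg invgK mulgA mulgKV.
Qed.

Lemma ind_on_decomp f : rep_carrier ind_on f ->
  f = \sum_i coset_fun (f (r i)) (r i).
Proof.
move=> [fS fH _ fL]; have [H1 HM HV] := HG; have [Lr rcov _] := rP.
have [L1 LM LV] := LG.
apply/funext => g; rewrite fct_sumE.
have [Lg|Lg] := pselect (L g).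
  have [i Hi] := rcov g Lg.
  rewrite (bigD1 i)//= coset_funE// -fH// mulgKV big1 ?addr0// => j ji.
  by apply: coset_fun0 => Hj; case/eqP: ji; exact: transversal_uniq Hj Hi.
rewrite fL// big1// => i _; apply: coset_fun0 => /HL Lgi; apply: Lg.
by have := LM _ _ Lgi (Lr i); rewrite mulgKV.
Qed.

(** The basis of [sigma] may vary with the coset; [ind_on_trace] needs this because each of its
    trace hypotheses comes with its own basis. *)
Lemma ind_on_basis (d : I -> nat) (b : forall i, 'I_(d i) -> rep_space sigma) :
    (forall i, fin_basis S (b i)) ->
  fin_basis (rep_carrier ind_on)
    (fun p : {i : I & 'I_(d i)} => coset_fun (b (tag p) (tagged p)) (r (tag p))).
Proof.
move=> bP; have [Lr rcov _] := rP; have [H1 HM HV] := HG.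
have [_ lin act1 _ _] := sm.
split=> [p|f fI|c c0].
- by apply: coset_fun_in => //; have [Sb _ _] := bP (tag p); exact: Sb.
(* Coefficients are taken on [nat], extended by 0 beyond [d i], so that [choice] need not return a
   dependent function. *)
- have /choice [c cE] : forall i, exists c : nat -> K,
      f (r i) = \sum_(k < d i) c k *: b i k.
    move=> i; have [_ span _] := bP i; have [fS _ _ _] := fI.
    have [c ->] := span _ (fS (r i)).
    by exists (fun m => oapp c 0 (insub m)); apply: eq_bigr => k _; rewrite valK.
  exists (fun p => c (tag p) (nat_of_ord (tagged p))).
  rewrite [LHS]ind_on_decomp//.
  transitivity (\sum_i \sum_(k < d i) c i k *: coset_fun (b i k) (r i)).
    apply: eq_bigr => i _; rewrite cE coset_fun_sum// => k.
    by have [Sb _ _] := bP i.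
  by rewrite (sig_big_dep xpredT (fun=> xpredT)
    (fun i (k : 'I_(d i)) => c i k *: coset_fun (b i k) (r i))).
case=> i k.
have [Sb _ ind] := bP i.
apply: (ind (fun k => c (Tagged (fun i => 'I_(d i)) k)) _ k).
have E0 : (\sum_p c p *: coset_fun (b (tag p) (tagged p)) (r (tag p))) (r i) = 0.
  by rewrite c0.
rewrite -[RHS]E0 {E0}.
rewrite (_ : \sum_p _ = \sum_j \sum_(k : 'I_(d j))
   c (Tagged _ k) *: coset_fun (b j k) (r j)); last first.
  rewrite (sig_big_dep xpredT (fun=> xpredT)
    (fun j (k : 'I_(d j)) => c (Tagged _ k) *: coset_fun (b j k) (r j))).
  by apply: eq_bigr => -[].
rewrite fct_sumE (bigD1 i)//= [X in _ + X]big1 ?addr0 => [|j ji].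
  rewrite fct_sumE. apply: eq_bigr => l _.
  rewrite -[RHS]/(c (Tagged _ l) *: coset_fun (b i l) (r i) (r i)).
  by rewrite coset_funE mulgV// act1.
rewrite fct_sumE big1// => l _.
rewrite -[LHS]/(c (Tagged _ l) *: coset_fun (b j l) (r j) (r i)).
rewrite coset_fun0 ?scaler0// => Hij; case/eqP: ji; apply/esym.
by have [_ _ +] := rP; apply.
Qed.

(** Frobenius formula: [x] permutes the summands supported on single cosets, so only fixed cosets
    meet the diagonal, each contributing the trace of a conjugate of [x]. *)
Lemma ind_on_trace x (t : I -> K) : L x ->
    (exists d (b : 'I_d -> rep_space sigma), basis_on S b) ->
    (forall i, H (r i * x * (r i)^-1)%g ->
       rep_trace sigma (r i * x * (r i)^-1)%g (t i)) ->
  rep_trace ind_on x (\sum_(i | `[< H (r i * x * (r i)^-1)%g >]) t i).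
Proof.
move=> Lx [d0 [b0 b0B]] trx; have [Lr rcov _] := rP; have [H1 HM HV] := HG.
have [L1 LM LV] := LG; have [_ lin _ _ _] := sm.
pose dat := {d : nat & (('I_d -> rep_space sigma) * 'M[K]_d)%type}.
have /choice [F FP] : forall i, exists F : dat,
    let b := (tagged F).1 in let A := (tagged F).2 in
    [/\ fin_basis S b
      & H (r i * x * (r i)^-1)%g ->
        (forall k, act (r i * x * (r i)^-1)%g (b k) = \sum_l A l k *: b l)
        /\ \tr A = t i].
  move=> i; have [Hi|Hi] := pselect (H (r i * x * (r i)^-1)%g).
    have [d [b [A [bB bA trA]]]] := trx i Hi.
    exists (@Tagged nat d (fun d => (('I_d -> rep_space sigma) * 'M[K]_d)%type) (b, A)).
    by split => //=; exact: basis_on_fin.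
  (* On a coset moved by [x] any basis will do; the default one is paired with the matrix 0. *)
  exists (@Tagged nat d0 (fun d => (('I_d -> rep_space sigma) * 'M[K]_d)%type) (b0, 0)).
  by split => //=; exact: basis_on_fin.
pose d i := tag (F i); pose b i := (tagged (F i)).1; pose A i := (tagged (F i)).2.
have bP i : fin_basis S (b i) by have [] := FP i.
pose B := {i : I & 'I_(d i)}.
pose e (p : B) := coset_fun (b (tag p) (tagged p)) (r (tag p)).
have /choice [M MP] : forall p : B, exists c : B -> K,
    rep_act ind_on x (e p) = \sum_q c q *: e q /\
    c p = if `[< H (r (tag p) * x * (r (tag p))^-1)%g >]
          then A (tag p) (tagged p) (tagged p) else 0.
  case=> i k; rewrite /e /=.
  have [j Hj] : exists j, H (r i * x^-1 * (r j)^-1)%g.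
    by apply: rcov; apply: LM => //; exact: LV.
  have Hh : H (r j * x * (r i)^-1)%g.
    by have := HV _ Hj; rewrite !invMg !invgK mulgA.
  have [Sb _ _] := bP i; have [Sbj span _] := bP j.
  (* Coset [j] is the image of coset [i]. When they agree, the diagonal coefficient has to be that
     of [A i]; [ecast] carries the index across the equality. *)
  have [C [CE Cfix]] : exists C : 'I_(d j) -> K,
      act (r j * x * (r i)^-1)%g (b i k) = \sum_l C l *: b j l /\
      (forall (ij : i = j), C (ecast z 'I_(d z) ij k) = A i k k).
    have [ij|ij] := eqVneq i j.
      case: j / ij Hj Hh {Sbj span} => Hj Hh.
      have [_ /(_ Hh) [AE _]] := FP i.
      exists (fun l => A i l k); split=> [|ij]; first exact: AE.
      by rewrite eq_axiomK.
    have Sv : S (act (r j * x * (r i)^-1)%g (b i k)).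
      by have [_ Slin] := lin _ Hh; apply: Slin.
    have [C CE] := span _ Sv.
    by exists C; split=> // ij'; case/eqP: ij.
  exists (fun q => \sum_(l | Tagged (fun i => 'I_(d i)) l == q) C l); split.
    rewrite -[LHS]/(rep_act ind_on x (coset_fun (b i k) (r i))) coset_fun_act.
    have -> : (r i * x^-1 = (r j * x * (r i)^-1)^-1 * r j)%g.
      by rewrite !invMg !invgK mulgA mulgKV.
    rewrite coset_fun_mull// CE coset_fun_sum//.
    transitivity (\sum_(q : B) \sum_(l | Tagged (fun i => 'I_(d i)) l == q)
        C l *: coset_fun (b j l) (r j)).
      rewrite (exchange_big_dep xpredT)//=; apply: eq_bigr => l _.
      by rewrite (big_pred1 (Tagged (fun i => 'I_(d i)) l))// => q; rewrite eq_sym.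
    apply: eq_bigr => q _; rewrite scaler_suml.
    by apply: eq_bigr => l /eqP <-.
  case: asboolP => Hi.
    have ij : i = j.
      apply: (transversal_uniq _ Hj).
      by have := HV _ Hi; rewrite !invMg !invgK mulgA.
    rewrite (big_pred1 (ecast z 'I_(d z) ij k)) ?Cfix// => l.
    by case: j / ij l {Hj Hh Sbj span C CE Cfix} => l; rewrite eq_Tagged.
  rewrite big1// => l /eqP E; case: Hi.
  by have := congr1 tag E => /= <-; move: Hh; have := congr1 tag E => /= ->.
have := @has_trace_fin K _ _ _ e (rep_act ind_on x) (fun q p => M p q)
  (ind_on_basis bP) (fun p => (MP p).1).
rewrite (_ : \sum_p _ = \sum_(i | `[< H (r i * x * (r i)^-1)%g >]) t i)//.
under eq_bigr do rewrite (MP _).2.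
rewrite -(sig_big_dep xpredT (fun=> xpredT) (fun i (k : 'I_(d i)) =>
  if `[< H (r i * x * (r i)^-1)%g >] then A i k k else 0)) [RHS]big_mkcond /=.
apply: eq_bigr => i _; case: asboolP => Hi; last by rewrite big1.
by have [_ /(_ Hi)[_ <-]] := FP i.
Qed.

Lemma coset_fun_lin a u v t : S u -> S v ->
  coset_fun (a *: u + v) t = a *: coset_fun u t + coset_fun v t.
Proof.
move=> Su Sv; have [_ lin _ _ _] := sm; apply/funext => g.
rewrite lincomb_fctE; have [Hg|Hg] := pselect (H (g * t^-1)%g).
  by rewrite !coset_funE//; have [lg _] := lin _ Hg; exact: lg.
by rewrite !coset_fun0// scaler0 addr0.
Qed.

Lemma coset_funZ a u t : S u -> coset_fun (a *: u) t = a *: coset_fun u t.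
Proof.
move=> Su; have [[S0 _] _ _ _ _] := sm.
have := coset_fun_lin a t Su S0; rewrite addr0 => ->.
rewrite [X in _ + X](_ : _ = 0) ?addr0//; apply/funext => g.
by rewrite /coset_fun; case: asboolP => // h; rewrite (smooth_act0 sm).
Qed.

Section Irreducibility.
Variables (A : set G) (psi : G -> K).
Hypotheses (AH : A `<=` H)
  (Aconj : forall g a, L g -> A a -> A (g * a * g^-1)%g)
  (sigA : forall a v, A a -> S v -> act a v = psi a *: v)
  (stab : forall g, L g ->
     (forall a, A a -> psi (g * a * g^-1)%g = psi a) -> H g).

Lemma coset_fun_eigen a v t : A a -> S v -> L t ->
  rep_act ind_on a (coset_fun v t) = psi (t * a * t^-1)%g *: coset_fun v t.
Proof.
move=> Aa Sv Lt; have At := Aconj Lt Aa; rewrite coset_fun_act.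
have -> : (t * a^-1 = (t * a * t^-1)^-1 * t)%g.
  by rewrite !invMg !invgK !mulgA mulgKV.
by rewrite coset_fun_mull ?sigA ?coset_funZ//; exact: AH.
Qed.

(* The A-eigencharacters of the summands supported on distinct cosets differ, *)
(* so an A-stable subspace contains each component of its elements.           *)
Lemma ind_on_separate (T : set (rep_space ind_on)) f i :
    lin_subspace T -> (forall g x, L g -> T x -> T (rep_act ind_on g x)) ->
    rep_carrier ind_on f -> T f ->
  T (coset_fun (f (r i)) (r i)).
Proof.
move=> [T0 TD] Tinv fI Tf; have [Lr rcov rI] := rP; have [L1 LM LV] := LG.
pose F j := coset_fun (f (r j)) (r j).
have Sf j : S (f (r j)) by have [+ _ _ _] := fI; exact.
(* Induction on the list of cosets to be killed: the operator a - psi(r_j a r_j^-1) annihilates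
   component j and rescales component i by a nonzero factor, since [stab] provides an [a] separating
   the two. *)
have sep (s : seq I) : i \notin s -> exists c : I -> K,
    [/\ c i != 0, forall j, j \in s -> c j = 0 & T (\sum_j c j *: F j)].
  elim: s => [_|j s IH].
    exists (fun=> 1); split; rewrite ?oner_eq0//.
    by under eq_bigr do rewrite scale1r; rewrite -ind_on_decomp.
  rewrite inE negb_or => /andP[ij /IH [c [ci cs Tc]]].
  have [a Aa aij] : exists2 a, A a &
      psi (r i * a * (r i)^-1)%g <> psi (r j * a * (r j)^-1)%g.
    apply: contrapT => /forall2NP nex; case/eqP: ij; apply: rI; apply: stab.
      by apply: LM => //; exact: LV.
    move=> a Aa; have Aa' := Aconj (LV _ (Lr j)) Aa.
    rewrite invgK in Aa'; have [/(_ Aa')//|/contrapT] := nex ((r j)^-1 * a * r j)%g.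
    by rewrite invMg invgK !mulgA => ->; rewrite mulgV mul1g mulgK.
  pose p l := psi (r l * a * (r l)^-1)%g.
  exists (fun l => c l * (p l - p j)); split.
  - by rewrite mulf_neq0// subr_eq0; apply/eqP.
  - by move=> l; rewrite inE => /orP[/eqP->|/cs ->]; rewrite ?subrr ?mulr0 ?mul0r.
  have La : L a by apply: HL; exact: AH.
  have -> : \sum_l (c l * (p l - p j)) *: F l =
      (- p j) *: (\sum_l c l *: F l) + rep_act ind_on a (\sum_l c l *: F l).
    rewrite (smooth_act_sum _ ind_on_smooth)//; last first.
      by move=> l; exact: coset_fun_in.
    rewrite scaler_sumr -big_split; apply: eq_bigr => l _ /=.
    rewrite -[X in _ + c l *: X]/(rep_act ind_on a (coset_fun (f (r l)) (r l))).
    rewrite coset_fun_eigen// -/(p l) !scalerA -scalerDl.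
    by congr (_ *: _); rewrite mulrBr addrC mulNr (mulrC (p j)).
  by apply: TD => //; exact: Tinv.
have [|c [ci cs Tc]] := sep (rem i (enum I)).
  by rewrite mem_rem_uniq ?enum_uniq// inE eqxx.
rewrite (bigD1 i)//= big1 ?addr0 in Tc => [|j ji]; last first.
  by rewrite cs ?scale0r// mem_rem_uniq ?enum_uniq// inE ji mem_enum.
by have := TD (c i)^-1 _ 0 Tc T0; rewrite addr0 scalerA mulVf// scale1r.
Qed.

(** A nonzero invariant subspace contains a nonzero vector supported on one coset, which can be
    moved to the coset of 1. The values of such vectors form an invariant subspace [T1] of [sigma],
    hence all of it, and translating back fills every coset. *)
Lemma ind_on_irreducible : irreducible_rep N H sigma -> irreducible_rep N L ind_on.
Proof.
move=> [_ SN0 Smin]; have [[S0 SD] lin act1 actM smv] := sm.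
have [Lr rcov rI] := rP; have [L1 LM LV] := LG; have [H1 HM HV] := HG.
have nonzero (V : lmodType K) (W : set V) : W 0 -> W <> [set 0] -> exists2 x, W x & x <> 0.
  move=> W0 WN; apply: contrapT => /forall2NP WE; apply: WN.
  apply/seteqP; split=> x /=; last by move=> ->.
  by move=> Wx; have [//|/contrapT] := WE x.
split; first exact: ind_on_smooth.
- have [v Sv v0] := nonzero _ _ S0 SN0 => E.
  have : rep_carrier ind_on (coset_fun v 1) by exact: coset_fun_in.
  rewrite E => /(congr1 (fun f => f 1%g)).
  by rewrite coset_funE mulgV ?act1.
move=> T TI [T0 TD] Tinv; have [|TN0] := pselect (T = [set 0]); first by left.
right; apply/seteqP; split=> // F FI.
have [f Tf f0] := nonzero _ _ T0 TN0.
have fI := TI _ Tf; have Sf g : S (f g) by have [+ _ _ _] := fI; exact.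
have [i fi0] : exists i, f (r i) <> 0.
  apply: contrapT => /forallNP fE; apply: f0.
  rewrite (ind_on_decomp fI) big1// => i _; apply/funext => g.
  have /contrapT -> := fE i; rewrite /coset_fun; case: asboolP => // h.
  by rewrite (smooth_act0 sm).
have Tsep := fun i => ind_on_separate i (conj T0 TD) Tinv fI Tf.
pose T1 : set (rep_space sigma) := [set v | S v /\ T (coset_fun v 1)].
have T1S : T1 = S.
  have [|||T1E|//] := Smin T1.
  - by move=> v [].
  - split=> [|a x y [Sx Tx] [Sy Ty]].
      by split=> //; have := coset_funZ 0 1 S0; rewrite !scale0r => ->.
    by split; [exact: SD|rewrite coset_fun_lin//; exact: TD].
  - move=> h x Hh [Sx Tx]; split.
      by have [_] := lin h Hh; exact.
    have := Tinv h _ (HL Hh) Tx; rewrite coset_fun_act mul1g.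
    by rewrite -[h^-1%g]mulg1 coset_fun_mull.
  have : T1 (f (r i)).
    split=> //; have := Tinv (r i) _ (Lr i) (Tsep i).
    by rewrite coset_fun_act mulgV.
  by rewrite T1E => /fi0.
have TF j : T (coset_fun (F (r j)) (r j)).
  have : S (F (r j)) by have [+ _ _ _] := FI; exact.
  rewrite -T1S => -[_ /(Tinv (r j)^-1%g _ (LV _ (Lr j)))].
  by rewrite coset_fun_act mul1g invgK.
rewrite (ind_on_decomp FI); apply: (big_ind T) => // x y Tx Ty.
by rewrite -[x]scale1r; exact: TD.
Qed.

End Irreducibility.
End Transversal.
End Induction.

Section SmoothInd.
Variables (K : fieldType) (G : groupType) (N : nat -> set G) (H : set G).
Variable sigma : prerep K G.

Lemma smooth_indE : smooth_ind N H sigma = ind_on N H setT sigma.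
Proof.
congr (@Prerep _ _ _ _ _); apply/seteqP; split=> f /=.
  by move=> [f1 f2 f3]; split.
by move=> [f1 f2 f3 _]; split.
Qed.

(** Pointwise multiplication by chi^-1 is the isomorphism: equivariance under [H] survives because
    chi is trivial there, and smoothness because chi is locally constant. *)
Lemma smooth_ind_twist (chi : G -> K) :
    (forall k j, (k <= j)%N -> N j `<=` N k) ->
    (forall g, chi g != 0) -> (forall g h, chi (g * h)%g = chi g * chi h) ->
    (exists k, forall g, N k g -> chi g = 1) -> (forall h, H h -> chi h = 1) ->
    (forall h, H h -> linear_on (rep_carrier sigma) (rep_act sigma h)) ->
    lin_subspace (rep_carrier sigma) ->
  rep_iso setT (smooth_ind N H sigma) (rep_twist (smooth_ind N H sigma) chi).
Proof.
move=> Nle chi0 chiM [k0 chiN] chiH lin [S0 SD].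
have SZ a x : rep_carrier sigma x -> rep_carrier sigma (a *: x).
  by move=> Sx; rewrite -[a *: x]addr0; exact: SD.
have act0 h : H h -> rep_act sigma h 0 = 0.
  move=> Hh; have := lin h Hh 1 0 0 S0 S0; rewrite scaler0 addr0 scale1r => /eqP.
  by rewrite -subr_eq0 opprD addNKr oppr_eq0 => /eqP.
have actZ h a x : H h -> rep_carrier sigma x ->
    rep_act sigma h (a *: x) = a *: rep_act sigma h x.
  by move=> Hh Sx; have := lin h Hh a x 0 Sx S0; rewrite !addr0 act0// addr0.
pose m (e : G -> K) (f : G -> rep_space sigma) := fun x => e x *: f x.
have mI (e : G -> K) f : (forall h g, H h -> e (h * g)%g = e g) ->
    (forall g u, N k0 u -> e (g * u)%g = e g) ->
    rep_carrier (smooth_ind N H sigma) f ->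
    rep_carrier (smooth_ind N H sigma) (m e f).
  move=> eH eN [fS fH [k fN]]; split.
  - by move=> g; exact: SZ.
  - by move=> h g Hh; rewrite /m eH// fH// actZ.
  exists (maxn k k0) => g u Nu; rewrite /m eN ?fN//.
    exact: (Nle _ _ (leq_maxl _ _) _ Nu).
  exact: (Nle _ _ (leq_maxr _ _) _ Nu).
have chiHg h g : H h -> chi (h * g)%g = chi g by move=> Hh; rewrite chiM (chiH h)// mul1r.
have chiNg g u : N k0 u -> chi (g * u)%g = chi g.
  by move=> Nu; rewrite chiM (chiN u)// mulr1.
exists (m (fun x => (chi x)^-1)); split.
- move=> a x y _ _; apply/funext => g.
  by rewrite lincomb_fctE /m lincomb_fctE scalerDr !scalerA mulrC.
- split.
  + move=> f fI; apply: mI => // [h g Hh|g u Nu]; first by rewrite chiHg.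
    by rewrite chiNg.
  + move=> f1 f2 _ _ E; apply/funext => x; have := congr1 (fun f => chi x *: f x) E.
    by rewrite /m !scalerA mulfV// !scale1r.
  + move=> f fI; exists (m chi f); first by apply: mI.
    by apply/funext => x; rewrite /m scalerA mulVf// scale1r.
move=> g f _ _; apply/funext => x.
rewrite -[LHS]/((chi x)^-1 *: f (x * g)%g).
rewrite -[RHS]/(chi g *: ((chi (x * g)%g)^-1 *: f (x * g)%g)).
by rewrite scalerA chiM invfM mulrCA mulfV ?mulr1.
Qed.

End SmoothInd.

(** * The Heisenberg-Weil representation over a finite field *)

Section HeisenbergWeil.
Variables (k : finFieldType) (Q : nat) (K : closedFieldType) (psi : k -> K).
Hypotheses (cardk : #|k| = (Q ^ 2)%N)
  (tauD : forall x y : k, (x + y) ^+ Q = x ^+ Q + y ^+ Q)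
  (psiD : forall x y, psi (x + y) = psi x * psi y)
  (psi_tau : exists x, psi (x ^+ Q) != psi x)
  (K0 : forall m, m%:R = 0 :> K -> m = 0%N).

Let tau (x : k) : k := x ^+ Q.
Let N (x : k) : k := x * tau x.

Let Q_gt1 : (1 < Q)%N.
Proof.
have := finNzRing_gt1 k; rewrite cardk.
by case: Q => [|[|]].
Qed.
Let Q_gt0 : (0 < Q)%N. Proof. exact: ltnW. Qed.

Let QN0 : Q%:R != 0 :> K.
Proof. by apply/eqP => /K0 Q0; have := Q_gt0; rewrite Q0. Qed.

Let natr_inj m1 m2 : m1%:R = m2%:R :> K -> m1 = m2.
Proof.
wlog le12 : m1 m2 / (m1 <= m2)%N.
  by move=> H; case: (leqP m1 m2) => [/H//|/ltnW/H E] /esym/E/esym.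
move/esym/eqP; rewrite -subr_eq0 -natrB// => /eqP/K0/eqP.
by rewrite subn_eq0 => le21; apply/eqP; rewrite eqn_leq le12.
Qed.

Let psi0 : psi 0 = 1.
Proof.
have [x] := psi_tau.
have [p0|p0] := eqVneq (psi 0) 0.
  have pz y : psi y = 0 by rewrite -[y]addr0 psiD p0 mulr0.
  by rewrite !pz eqxx.
by move=> _; apply: (mulfI p0); rewrite -psiD addr0 mulr1.
Qed.

Let psiN0 x : psi x != 0.
Proof.
apply/eqP => px; have /eqP := psi0.
by rewrite -(subrr x) psiD px mul0r eq_sym oner_eq0.
Qed.

Let psiN x : psi (- x) = (psi x)^-1.
Proof. by apply: (mulfI (psiN0 x)); rewrite -psiD subrr psi0 mulfV. Qed.

Let tauM x y : tau (x * y) = tau x * tau y.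
Proof. exact: exprMn. Qed.
Let tau0 : tau 0 = 0.
Proof. by rewrite /tau expr0n eqn0Ngt Q_gt0. Qed.
Let tau1 : tau 1 = 1.
Proof. exact: expr1n. Qed.
Let tauN x : tau (- x) = - tau x.
Proof. by apply/eqP; rewrite -addr_eq0 addrC -tauD addrN -/(tau 0) tau0. Qed.
Let tauK x : tau (tau x) = x.
Proof. by rewrite /tau -exprM mulnn -cardk expf_card. Qed.
Let tauV x : tau x^-1 = (tau x)^-1.
Proof. exact: exprVn. Qed.
Let tauB x y : tau (x - y) = tau x - tau y.
Proof. by rewrite -[LHS]/((x - y) ^+ Q) tauD -[X in _ + X]/(tau (- y)) tauN. Qed.
Let tau_eq0 x : (tau x == 0) = (x == 0).
Proof. by rewrite /tau expf_eq0 Q_gt0. Qed.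

Let psi_nontriv : exists x, psi (x - tau x) != 1.
Proof.
have [x px] := psi_tau; exists x; rewrite psiD psiN.
by apply: contra px => /eqP/(congr1 ( *%R^~ (psi (tau x)))); rewrite mulfVK// mul1r => ->.
Qed.

Let psi_pairing c : c != 0 -> exists x, psi (x * c - tau (x * c)) != 1.
Proof. by move=> c0; have [x px] := psi_nontriv; exists (x / c); rewrite divfK. Qed.

Lemma card_exp_root (m : nat) (t : k) : (0 < m)%N -> (#|[set b : k | b ^+ m == t]%SET| <= m)%N.
Proof.
move=> m0; rewrite cardE.
have := @max_poly_roots k ('X^m - t%:P) (enum [set b : k | b ^+ m == t]%SET).
rewrite size_XnsubC// ltnS; apply.
- by rewrite -size_poly_gt0 size_XnsubC.
- apply/allP => b; rewrite mem_enum inE => /eqP bE.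
  by rewrite rootE !hornerE bE subrr.
- exact: enum_uniq.
Qed.

(** Translation by [t0] preserves the range of summation and multiplies the sum by [f t0], which
    differs from 1. *)
Lemma sum_nontrivial_char (P : pred k) (f : k -> K) (t0 : k) :
    P t0 -> (forall t, P (t0 + t) = P t) -> f t0 != 1 ->
    (forall t, f (t0 + t) = f t0 * f t) ->
  \sum_(t | P t) f t = 0.
Proof.
move=> Pt0 PD f1 fD; apply/eqP.
have E : \sum_(t | P t) f t = f t0 * \sum_(t | P t) f t.
  rewrite big_distrr /= (reindex_inj (addrI t0)) /=.
  by apply: eq_big => t; [rewrite PD|rewrite fD].
have : (1 - f t0) * \sum_(t | P t) f t == 0 by rewrite mulrBl mul1r -E subrr.
by rewrite mulf_eq0 subr_eq0 eq_sym (negPf f1).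
Qed.

Lemma gauss_linear c : \sum_b psi (b * c - tau (b * c)) = if c == 0 then (Q ^ 2)%:R else 0.
Proof.
case: eqP => [->|/eqP c0].
  under eq_bigr do rewrite mulr0 tau0 subr0 psi0.
  by rewrite sumr_const cardk.
have [x px] := psi_pairing c0.
apply: (@sum_nontrivial_char _ _ x) => // t.
by rewrite -psiD; congr psi; rewrite mulrDl /tau tauD; ring.
Qed.

(* The norm map from nonzero elements to the fixed field of tau is onto, with *)
(* fibres of size Q + 1, since (Q + 1)(Q - 1) bounds the total size.          *)
Lemma norm_fiber t : t != 0 -> tau t = t -> #|[set b | N b == t]%SET| = Q.+1.
Proof.
have NE b : N b = b ^+ Q.+1 by rewrite /N exprS.
pose A := [set t : k | (t != 0) && (tau t == t)]%SET.
have AE : A = [set t : k | t ^+ Q.-1 == 1]%SET.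
  apply/finset.setP => t'; rewrite !inE.
  have [->|t0] /= := eqVneq t' 0.
    rewrite expr0n (_ : (Q.-1 == 0%N) = false) ?[0 == 1]eq_sym ?oner_eq0//.
    by case: Q Q_gt1 => [|[]].
  by rewrite -[RHS](inj_eq (mulfI t0)) mulr1 -exprS prednK.
have cA : (#|A| <= Q.-1)%N by rewrite AE card_exp_root// -ltnS prednK.
have fib t' : (#|[set b | N b == t']%SET| <= Q.+1)%N.
  have -> : [set b | N b == t']%SET = [set b : k | b ^+ Q.+1 == t']%SET.
    by apply/finset.setP => b; rewrite !inE NE.
  exact: card_exp_root.
have tot : (\sum_(t' in A) #|[set b | N b == t']%SET| = Q.+1 * Q.-1)%N.
  have -> : (Q.+1 * Q.-1 = #|[set b : k | b != 0%R]%SET|)%N.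
    have := cardsC1 (0 : k); rewrite cardk -subn1.
    have -> : [set~ (0 : k)]%SET = [set b : k | b != 0]%SET by apply/finset.setP => b; rewrite !inE.
    move=> ->; have : (Q.+1 * Q.-1 = Q ^ 2 - 1)%N by rewrite -[1%N](exp1n 2) subn_sqr subn1 addn1 mulnC.
    by move=> ->.
  rewrite -[RHS]sum1_card [RHS](partition_big N (mem A)) /=; last first.
    move=> b; rewrite !inE => b0; rewrite /N mulf_neq0 ?tau_eq0//=.
    by rewrite tauM tauK mulrC.
  apply: eq_bigr => t'; rewrite inE => /andP[t'0 _].
  rewrite -sum1_card; apply: eq_bigl => b; rewrite !inE.
  case: eqP => [bE|]; last by rewrite andbF.
  rewrite andbT; apply/esym; apply: contraNneq t'0 => b0.
  by rewrite -bE b0 /N mul0r.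
move=> t0 tt; have tA : t \in A by rewrite inE t0 tt eqxx.
apply/eqP; rewrite eqn_leq fib /=.
rewrite -(leq_add2r (\sum_(t' in A | t' != t) Q.+1)).
have -> : (Q.+1 + \sum_(t' in A | t' != t) Q.+1 = \sum_(t' in A) Q.+1)%N.
  by rewrite [RHS](bigD1 t).
apply: (@leq_trans (Q.+1 * Q.-1)%N).
  by rewrite sum_nat_const mulnC leq_mul2l cA orbT.
rewrite -tot (bigD1 t)//= leq_add2l.
by apply: leq_sum => t' _; exact: fib.
Qed.

(** Grouping by norms leaves 1 plus Q + 1 times the sum of psi(t s) over nonzero t fixed by tau. As
    s is anti-invariant, t -> psi(t s) is a nontrivial character of the fixed field, so that sum is
    -1 and the total is -Q. *)
Lemma gauss_norm s : s != 0 -> tau s = - s -> \sum_b psi (N b * s) = - Q%:R.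
Proof.
move=> s0 ts.
have Nk b : tau (N b) = N b by rewrite /N tauM tauK mulrC.
rewrite (partition_big N (fun t => tau t == t)) /=; last by move=> b _; rewrite Nk.
have -> : \sum_(t | tau t == t) \sum_(b | N b == t) psi (N b * s) =
    1 + \sum_(t | (tau t == t) && (t != 0)) (Q.+1)%:R * psi (t * s).
  rewrite (bigD1 0)/= ?tau0 ?eqxx//; congr (_ + _).
    rewrite (big_pred1 0) => [|b]; first by rewrite /N mul0r mul0r psi0.
    by rewrite /N /= mulf_eq0 tau_eq0 orbb.
  apply: eq_bigr => t /andP[/eqP tt t0].
  rewrite -(norm_fiber t0 tt) -sum1_card natr_sum mulr_suml.
  apply: eq_big => [b|b /eqP->]; first by rewrite inE.
  by rewrite mul1r.
rewrite -mulr_sumr.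
have : \sum_(t | tau t == t) psi (t * s) = 0.
  have [x px] := psi_nontriv.
  apply: (@sum_nontrivial_char _ _ ((x - tau x) / s)).
  - by rewrite tauM tauV tauB tauK ts invrN mulrN -mulNr opprB.
  - move=> t; rewrite /tau tauD -!/(tau _) tauM tauV tauB tauK ts invrN mulrN -mulNr opprB.
    by rewrite (inj_eq (addrI _)).
  - by rewrite divfK.
  - by move=> t; rewrite mulrDl psiD.
rewrite (bigD1 0)/= ?tau0 ?eqxx// mul0r psi0.
move/eqP; rewrite addrC addr_eq0 => /eqP->.
by rewrite mulrN1 -natr1; ring.
Qed.

Section Algebra.
Variables (A : algType K) (T : k -> A).
Hypotheses (T0 : T 0 = 1)
  (TM : forall b c, T b * T c = psi (b * tau c) *: T (b + c)).

Let X u := \sum_b psi (N b / (1 - u)) *: T b.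
(** The Weil operator of an element u of norm one, written in the twisted group algebra of k; the
    factor -1/Q makes it multiplicative in u. *)
Definition weil_op (u : k) : A := if u == 1 then 1 else - (Q%:R^-1) *: X u.

(** The coefficient of T e is a Gauss sum over b. If uv = 1 the terms quadratic in b cancel, leaving
    a linear sum that vanishes unless e = 0; otherwise completing the square reduces it to
    [gauss_norm]. *)
Lemma weil_sum_mul u v : u * tau u = 1 -> v * tau v = 1 -> u != 1 -> v != 1 ->
  X u * X v = if u * v == 1 then (Q ^ 2)%:R%:A else - Q%:R *: X (u * v).
Proof.
move=> Nu Nv u1 v1.
have u0 : u != 0 by apply: contra_eq_neq Nu => ->; rewrite mul0r eq_sym oner_eq0.
have v0 : v != 0 by apply: contra_eq_neq Nv => ->; rewrite mul0r eq_sym oner_eq0.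
have tu : tau u = u^-1 by apply: (mulfI u0); rewrite Nu mulfV.
have tv : tau v = v^-1 by apply: (mulfI v0); rewrite Nv mulfV.
have d1u : 1 - u != 0 by rewrite subr_eq0 eq_sym.
have d1v : 1 - v != 0 by rewrite subr_eq0 eq_sym.
have -> : X u * X v = \sum_e
    (\sum_b psi (N b / (1 - u) + N (e - b) / (1 - v) + b * tau (e - b))) *: T e.
  rewrite /X mulr_suml.
  under eq_bigr => b _.
    rewrite mulr_sumr (reindex_inj (addIr (- b))) /=.
    under eq_bigr => e _ do
      rewrite -scalerAl -scalerAr TM !scalerA [X in T X]addrC subrK -!psiD.
    over.
  by rewrite exchange_big; apply: eq_bigr => e _; rewrite scaler_suml.
have [uv1|uv1] := eqVneq (u * v) 1.
  have vE : v = u^-1 by apply: (mulfI u0); rewrite uv1 mulfV.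
  have u1' : u - 1 != 0 by rewrite subr_eq0.
  have cE e : \sum_b psi (N b / (1 - u) + N (e - b) / (1 - v) + b * tau (e - b)) =
      psi (N e / (1 - v)) * \sum_b psi (b * (tau e / (1 - u))
         - tau (b * (tau e / (1 - u)))).
    rewrite mulr_sumr; apply: eq_bigr => b _; rewrite -psiD; congr psi.
    rewrite /N !tauB !tauM tauV tauB tau1 tauK tu vE.
    by field; rewrite ?u0 ?d1u ?u1'.
  under eq_bigr do rewrite cE gauss_linear mulf_eq0 invr_eq0 (negPf d1u) orbF tau_eq0.
  rewrite (bigD1 0)//= eqxx big1 ?addr0 => [|e e0].
    by rewrite /N mul0r mul0r psi0 mul1r T0.
  by rewrite (negPf e0) mulr0 scale0r.
(* This is the coefficient of N b, namely 1/(1 - u) + 1/(1 - v) - 1; it is anti-invariant because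
   tau inverts u and v. *)
pose s := (1 - u * v) / ((1 - u) * (1 - v)).
have d1uv : 1 - u * v != 0 by rewrite subr_eq0 eq_sym.
have u1' : u - 1 != 0 by rewrite subr_eq0.
have v1' : v - 1 != 0 by rewrite subr_eq0.
have s0 : s != 0 by rewrite mulf_neq0// invr_eq0 mulf_neq0.
have uv1' : u * v - 1 != 0 by rewrite subr_eq0.
have ts : tau s = - s.
  rewrite /s !tauM tauV !tauM !tauB tauM tau1 tu tv.
  by field; rewrite ?u0 ?v0 ?d1u ?d1v ?u1' ?v1'.
have cE e : \sum_b psi (N b / (1 - u) + N (e - b) / (1 - v) + b * tau (e - b)) =
    psi (N e / (1 - u * v)) * - Q%:R.
  rewrite -(gauss_norm s0 ts) mulr_sumr.
  rewrite [RHS](reindex_inj (addIr (- (e * ((1 - u) / (1 - u * v)))))) /=.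
  apply: eq_bigr => b _; rewrite -psiD; congr psi.
  rewrite /N !tauB !tauM tauV !tauB tauM tau1 tu tv /s.
  by field; rewrite ?u0 ?v0 ?d1u ?d1v ?d1uv ?u1' ?v1' ?uv1'.
rewrite scaler_sumr; apply: eq_bigr => e _.
by rewrite cE mulrC scalerA.
Qed.

Lemma weil_opM u v : u * tau u = 1 -> v * tau v = 1 ->
  weil_op u * weil_op v = weil_op (u * v).
Proof.
move=> Nu Nv; rewrite /weil_op.
have [->|u1] := eqVneq u 1; first by rewrite !mul1r.
have [->|v1] := eqVneq v 1; first by rewrite mulr1 (negPf u1) mulr1.
rewrite -scalerAl -scalerAr scalerA weil_sum_mul//.
case: ifP => _; rewrite scalerA ?natrX.
  rewrite [X in X *: _](_ : _ = 1) ?scale1r//.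
  by field.
congr (_ *: _); by field.
Qed.

(** Shifting the summation variable by c on the left and by c u on the right makes the coefficients
    of each T e agree, as tau u = u^-1. *)
Lemma weil_op_conj c u : u * tau u = 1 -> T c * weil_op u = weil_op u * T (c * u).
Proof.
move=> Nu; rewrite /weil_op.
have [->|u1] := eqVneq u 1; first by rewrite !mulr1 mul1r.
have u0 : u != 0 by apply: contra_eq_neq Nu => ->; rewrite mul0r eq_sym oner_eq0.
have tu : tau u = u^-1 by apply: (mulfI u0); rewrite Nu mulfV.
have d1u : 1 - u != 0 by rewrite subr_eq0 eq_sym.
rewrite -scalerAl -scalerAr; congr (_ *: _).
rewrite mulr_sumr mulr_suml.
rewrite (reindex_inj (addIr (- c))) [RHS](reindex_inj (addIr (- (c * u)))) /=.
apply: eq_bigr => e _.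
rewrite -scalerAl -scalerAr !TM !scalerA subrK (_ : c + (e - c) = e) ?[c + _]addrC ?subrK// -!psiD; congr (psi _ *: _).
rewrite /N !tauB !tauM tu.
by field; rewrite ?u0 ?d1u.
Qed.

End Algebra.

Definition stable_mx m M (C : k -> 'M[K]_M) (W : 'M[K]_(m, M)) : Prop :=
  forall b, (W *m C b <= W)%MS.

Lemma minimal_stable_mx M (C : k -> 'M[K]_M.+1) : exists U : 'M[K]_M.+1,
  [/\ U != 0, stable_mx C U
    & forall W : 'M[K]_M.+1, stable_mx C W -> W != 0 -> (\rank U <= \rank W)%N].
Proof.
pose P r := `[< exists W : 'M[K]_M.+1, [/\ stable_mx C W, W != 0 & \rank W = r] >].
have exP : exists r, P r.
  exists (\rank (1%:M : 'M[K]_M.+1)); apply/asboolP; exists 1%:M; split=> //.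
    by move=> b; exact: submx1.
  exact: oner_neq0.
case: (ex_minnP exP) => r /asboolP[U [Ust U0 Ur]] rmin.
exists U; split=> // W Wst W0; rewrite Ur; apply: rmin.
by apply/asboolP; exists W.
Qed.

(** A nonzero stable subspace of least rank is irreducible; [C'] is the action on it in the basis
    given by the rows of [B]. *)
Lemma stable_mx_restrict M (C : k -> 'M[K]_M.+1) :
  exists d (C' : k -> 'M[K]_d.+1) (B : 'M[K]_(d.+1, M.+1)),
  [/\ row_free B, forall b, B *m C b = C' b *m B
    & forall m (W : 'M[K]_(m, d.+1)), stable_mx C' W -> W != 0 -> row_full W].
Proof.
have [U [U0 Ust Umin]] := minimal_stable_mx C.
have : \rank U != 0%N by rewrite mxrank_eq0.
move: (row_base U) (row_base_free U) (eq_row_base U).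
case: (\rank U) Umin => // d Umin B Bfree BU _.
pose C' b := B *m C b *m pinvmx B.
have CE b : B *m C b = C' b *m B.
  by rewrite mulmxKpV// BU (submx_trans _ (Ust b))// submxMr// BU.
exists d, C', B; split=> // m W Wst W0.
pose V : 'M[K]_M.+1 := (<<W *m B>>)%MS.
have Vst : stable_mx C V.
  move=> b; rewrite (eqmxMr _ (genmxE _)) genmxE -mulmxA CE mulmxA.
  by rewrite submxMr.
have V0 : V != 0.
  rewrite -mxrank_eq0 genmxE mxrankMfree// mxrank_eq0//.
have := Umin V Vst V0; rewrite genmxE mxrankMfree// => le.
by rewrite /row_full eqn_leq rank_leq_col.
Qed.

(** Over a closed field [X] has an eigenvalue, and the eigenspace is a nonzero stable subspace,
    hence everything. *)
Lemma stable_mx_schur d (C : k -> 'M[K]_d.+1) (X : 'M[K]_d.+1) :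
    (forall m (W : 'M[K]_(m, d.+1)), stable_mx C W -> W != 0 -> row_full W) ->
    (forall b, C b *m X = X *m C b) ->
  exists a, X = a%:M.
Proof.
move=> irr comm.
have [a] : exists a, root (char_poly X) a.
  by apply/closed_rootP; rewrite size_char_poly.
rewrite -eigenvalue_root_char => /eigenvalueP[v vX v0].
exists a; apply/eqP; rewrite -subr_eq0.
pose W := kermx (X - a%:M).
have Wst : stable_mx C W.
  move=> b; apply/sub_kermxP.
  rewrite -mulmxA mulmxBr comm scalar_mxC -mulmxBl mulmxA.
  by rewrite mulmx_ker mul0mx.
have W0 : W != 0.
  apply: contraNneq v0 => W0; rewrite -submx0 -W0; apply/sub_kermxP.
  by rewrite mulmxBr vX mul_mx_scalar subrr.
have := irr _ W Wst W0; rewrite -sub1mx => /sub_kermxP.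
by rewrite mul1mx => ->.
Qed.

(* An irreducible constituent of the right regular representation of the      *)
(* Heisenberg group; its dimension follows from Schur orthogonality.          *)
Lemma heisenberg_rep : exists d (T : k -> 'M[K]_d.+1),
  [/\ d.+1 = Q, T 0 = 1,
      forall b c, T b * T c = psi (b * tau c) *: T (b + c),
      forall b, b != 0 -> \tr (T b) = 0
    & forall m (W : 'M[K]_(m, d.+1)),
        stable_mx (fun b => (T b)^T) W -> W != 0 -> row_full W].
Proof.
have [M ME] : exists M, #|k| = M.+1 by exists #|k|.-1; rewrite prednK// cardk expn_gt0 Q_gt0.
pose ev (i : 'I_M.+1) : k := enum_val (cast_ord (esym ME) i).
pose rk (x : k) : 'I_M.+1 := cast_ord ME (enum_rank x).
have evK i : rk (ev i) = i by apply: val_inj; rewrite /rk /ev enum_valK.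
have rkK x : ev (rk x) = x by rewrite /ev /rk cast_ordK enum_rankK.
(* Acting on row vectors reverses the order of products, so the cocycle here is psi(c tau b); the
   transposes taken at the end restore psi(b tau c). *)
pose C0 b : 'M[K]_M.+1 := \matrix_(i, j) (psi (b * tau (ev i)) *+ (ev j == b + ev i)).
have C0M b c : C0 b * C0 c = psi (c * tau b) *: C0 (b + c).
  apply/matrixP => i j; rewrite !mxE (bigD1 (rk (b + ev i)))//= big1 ?addr0.
    rewrite !mxE rkK eqxx mulr1n addrA [c + b]addrC mulrnAr mulrnAr -!psiD.
    by congr (psi _ *+ _); rewrite /tau tauD; ring.
  move=> l li; rewrite !mxE; case: eqP => [lE|_]; last by rewrite mul0r.
  by case/eqP: li; rewrite -lE evK.
have C00 : C0 0 = 1.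
  apply/matrixP => i j; rewrite !mxE mul0r psi0 add0r eq_sym.
  by rewrite (inj_eq (can_inj evK)).
have [d [C [B [Bfree BC irr]]]] := stable_mx_restrict C0.
have CM b c : C b * C c = psi (c * tau b) *: C (b + c).
  apply: (row_free_inj Bfree); rewrite -[C b * C c]/(C b *m C c).
  rewrite -mulmxA -BC mulmxA -BC -mulmxA -scalemxAl -BC scalemxAr.
  by congr (_ *m _); exact: C0M.
have C1 : C 0 = 1.
  by apply: (row_free_inj Bfree); rewrite -BC C00 mulmx1 mul1mx.
have [Ci CV VC] : exists2 Ci : k -> 'M[K]_d.+1,
    forall b, C b * Ci b = 1 & forall b, Ci b * C b = 1.
  exists (fun b => psi (N b) *: C (- b)) => b.
    rewrite -scalerAr CM scalerA subrr C1 -psiD /N mulNr addrN.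
    by rewrite psi0 scale1r.
  rewrite -scalerAl CM scalerA addNr C1 -psiD /N tauN mulrN addrN.
  by rewrite psi0 scale1r.
(* Conjugating [C b] by a suitable [C c] multiplies it by a scalar different from 1 without changing
   its trace. *)
have trC b : b != 0 -> \tr (C b) = 0.
  move=> b0; have [c pc] : exists c, psi (b * tau c - c * tau b) != 1.
    have tb0 : tau b != 0 by rewrite tau_eq0.
    have [x px] := psi_pairing tb0; exists (- x).
    rewrite tauN mulrN mulNr opprK addrC; move: px.
    by rewrite tauM tauK [tau x * b]mulrC.
  have E : C c * C b = psi (b * tau c - c * tau b) *: (C b * C c).
    by rewrite !CM scalerA -psiD subrK [c + b]addrC.
  have := congr1 (fun Y => \tr (Y * Ci c)) E.
  rewrite -scalerAl -mulrA mxtraceZ.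
  rewrite -[C b * C c * Ci c]mulrA CV mulr1.
  rewrite -[C c * (C b * Ci c)]/(C c *m (C b *m Ci c)) mxtrace_mulC.
  rewrite -[C b *m Ci c *m C c]mulmxA -[Ci c *m C c]/(Ci c * C c) VC mulmx1.
  move=> E2; apply/eqP; have : (1 - psi (b * tau c - c * tau b)) * \tr (C b) == 0.
    by rewrite mulrBl mul1r -E2 subrr.
  by rewrite mulf_eq0 subr_eq0 eq_sym (negPf pc).
(* Averaging over conjugates gives an operator commuting with all [C c], hence a scalar, which the
   trace determines. *)
pose E X := \sum_b C b * X * Ci b.
have trE X : \tr (E X) = (Q ^ 2)%:R * \tr X.
  rewrite raddf_sum /= -cardk -sum1_card natr_sum mulr_suml; apply: eq_bigr => b _.
  rewrite -[C b * X * Ci b]/(C b *m X *m Ci b) mxtrace_mulC mulmxA.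
  by rewrite -[Ci b *m C b]/(Ci b * C b) VC mul1mx mul1r.
have Ecomm X c : C c *m E X = E X *m C c.
  rewrite -[LHS]/(C c * E X) -[RHS]/(E X * C c) /E mulr_sumr mulr_suml.
  rewrite [RHS](reindex_inj (addrI c)) /=; apply: eq_bigr => b _.
  have -> : C (c + b) = (psi (b * tau c))^-1 *: (C c * C b).
    by rewrite CM scalerA mulVf// scale1r.
  have -> : Ci (c + b) = psi (b * tau c) *: (Ci b * Ci c).
    have E1 : C c * C b * (Ci b * Ci c) = 1.
      by rewrite mulrA -[C c * C b * Ci b]mulrA CV mulr1 CV.
    by rewrite -[LHS]mulr1 -E1 mulrA CM -scalerAr VC -scalerAl mul1r.
  rewrite -!(scalerAl, scalerAr) scalerA ?mulfV ?mulVf// scale1r.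
  by rewrite !mulrA -[_ * Ci c * C c]mulrA VC mulr1.
have Escal X : exists a, E X = a%:M.
  by apply: (stable_mx_schur irr) => c; exact: Ecomm.
have dN0 : d.+1%:R != 0 :> K by apply/eqP => /K0.
have EX X : E X = ((Q ^ 2)%:R * \tr X / d.+1%:R)%:M.
  have [a aE] := Escal X; rewrite aE; congr (_%:M).
  by apply: (mulIf dN0); rewrite divfK// -trE aE mxtrace_scalar mulr_natr.
(* Schur orthogonality: the same double sum equals the sum of tr(C b) tr(C b^-1), which is the
   square of the dimension since only b = 0 contributes, and equals Q^2 by the scalar formula
   [EX]. *)
have dQ : d.+1 = Q.
  have S1 : \sum_i \sum_j E (delta_mx i j) i j = (d.+1 ^ 2)%:R.
    transitivity (\sum_b \tr (C b) * \tr (Ci b)).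
      transitivity (\sum_i \sum_j \sum_b C b i i * Ci b j j).
        apply: eq_bigr => i _; apply: eq_bigr => j _.
        rewrite /E summxE; apply: eq_bigr => b _.
        rewrite -[C b * _ * _]/(C b *m _ *m _) mxE (bigD1 j)//= big1 ?addr0.
          congr (_ * _); rewrite mxE (bigD1 i)//= big1 ?addr0.
            by rewrite mxE !eqxx mulr1.
          by move=> l li; rewrite mxE (negPf li) mulr0.
        move=> l lj; rewrite mxE big1 ?mul0r// => l' _.
        by rewrite mxE (negPf lj) andbF mulr0.
      under eq_bigr do rewrite exchange_big.
      rewrite exchange_big; apply: eq_bigr => b _ /=.
      by rewrite /mxtrace mulr_suml; apply: eq_bigr => i _; rewrite mulr_sumr.
    rewrite (bigD1 0)//= big1 ?addr0 => [|b b0]; last by rewrite trC// mul0r.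
    have -> : Ci 0 = 1 by have := CV 0; rewrite C1 mul1r.
    by rewrite C1 -[1]/(1%:M) mxtrace1 natrX expr2.
  have S2 : \sum_i \sum_j E (delta_mx i j) i j = (Q ^ 2)%:R.
    transitivity (\sum_(i < d.+1) (Q ^ 2)%:R / d.+1%:R : K).
      apply: eq_bigr => i _; rewrite (bigD1 i)//= big1 ?addr0 => [|j ji].
        rewrite EX mxE eqxx mulr1n -mulrA; congr (_ * _).
        rewrite /mxtrace (bigD1 i)//= big1 ?addr0 => [|l li]; rewrite mxE.
          by rewrite eqxx mul1r.
        by rewrite (negPf li).
      by rewrite EX mxE eq_sym (negPf ji) mulr0n.
    by rewrite sumr_const card_ord -[LHS]mulr_natr divfK.
  have /eqP : (d.+1 ^ 2)%:R = (Q ^ 2)%:R :> K by rewrite -S1 S2.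
  by move/eqP/natr_inj/eqP; rewrite eqn_sqr => /eqP.
exists d, (fun b => (C b)^T); split=> //.
- by rewrite C1 trmx1.
- move=> b c; rewrite -[LHS]/((C b)^T *m (C c)^T) -trmx_mul.
  by rewrite -[C c *m C b]/(C c * C b) CM linearZ addrC.
- by move=> b b0; rewrite mxtrace_tr trC.
move=> m W Wst; apply: irr => b.
by have := Wst b; rewrite trmxK.
Qed.

(** R u b is the Weil operator of u times T b; [weil_op_conj] gives the product rule. In the trace
    only T 0 survives: -1/Q times the dimension Q. *)
Lemma heisenberg_weil : exists d (R : k -> k -> 'M[K]_d.+1),
  [/\ R 1 0 = 1%:M,
      forall u b v c, u * u ^+ Q = 1 -> v * v ^+ Q = 1 ->
        R u b *m R v c = psi (b * v * c ^+ Q) *: R (u * v) (b * v + c),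
      forall u, u * u ^+ Q = 1 -> u != 1 -> \tr (R u 0) = - 1
    & forall m (W : 'M[K]_(m, d.+1)),
        stable_mx (fun b => (R 1 b)^T) W -> W != 0 -> row_full W].
Proof.
have [d [T [dQ T0 TM trT irr]]] := heisenberg_rep.
pose B := weil_op T.
exists d, (fun u b => B u * T b); split.
- by rewrite /B /weil_op eqxx T0 mulr1.
- move=> u b v c Nu Nv; rewrite -[LHS]/(B u * T b * (B v * T c)).
  rewrite -mulrA [T b * _]mulrA (weil_op_conj TM)// -[X in B u * X]mulrA TM.
  by rewrite mulrA (weil_opM T0 TM)// -scalerAr.
- move=> u Nu u1; rewrite T0 mulr1 /B /weil_op (negPf u1).
  rewrite mxtraceZ raddf_sum /= (bigD1 0)//= big1 ?addr0 => [|b b0].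
    rewrite mxtraceZ T0 (mxtrace1 K d.+1 : \tr (1 : 'M[K]_d.+1) = _) dQ /N !mul0r psi0 mul1r.
    by rewrite mulNr mulVf.
  by rewrite mxtraceZ trT// mulr0.
move=> m W Wst; apply: irr => b.
by have := Wst b; rewrite /B /weil_op eqxx mul1r.
Qed.

End HeisenbergWeil.

(** * Valued fields and unramified extensions *)

Lemma expr_small (R : archiRealFieldType) (x e : R) :
  0 < x -> x < 1 -> 0 < e -> exists m, x ^+ m < e.
Proof.
move=> x0 x1 e0; pose t := x^-1 - 1.
have t0 : 0 < t by rewrite subr_gt0 invf_gt1.
have bern m : 1 + t *+ m <= (x^-1) ^+ m.
  elim: m => [|m IH]; first by rewrite mulr0n addr0 expr0.
  have -> : x^-1 = 1 + t by rewrite /t addrC subrK.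
  rewrite exprS (_ : x^-1 = 1 + t) in IH *; last by rewrite /t addrC subrK.
  apply: (@le_trans _ _ ((1 + t) * (1 + t *+ m))).
    rewrite mulrS -subr_ge0 [X in 0 <= X](_ : _ = t * (t *+ m)); last by ring.
    by rewrite mulr_ge0 ?mulrn_wge0// ltW.
  by rewrite ler_pM2l// addr_gt0.
have [m mb] : exists m, e^-1 / t < m%:R.
  exists (Num.Def.archi_bound (e^-1 / t)); apply: archi_boundP.
  by rewrite ltW// divr_gt0// invr_gt0.
exists m; rewrite -[x]invrK exprVn invf_plt ?posrE//; last first.
  by rewrite exprn_gt0// invr_gt0.
apply: lt_le_trans (bern m); rewrite ltr_wpDl//.
by rewrite -mulr_natl -ltr_pdivrMr.
Qed.

Section Valuation.
Variables (R : realType) (K : fieldType) (v : nonarch_abs R K).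

Lemma nabs0 : v 0 = 0.
Proof. by apply/eqP; rewrite nabs_eq0. Qed.

Lemma nabs_gt0 x : x != 0 -> 0 < v x.
Proof. by move=> x0; rewrite lt_neqAle nabs_ge0 andbT eq_sym nabs_eq0. Qed.

Lemma nabsV x : v x^-1 = (v x)^-1.
Proof.
have [->|x0] := eqVneq x 0; first by rewrite invr0 nabs0 invr0.
have vx : v x != 0 by rewrite nabs_eq0.
by apply: (mulfI vx); rewrite -nabsM !mulfV// nabs1.
Qed.

Lemma nabsX x m : v (x ^+ m) = v x ^+ m.
Proof. by elim: m => [|m IH]; rewrite ?expr0 ?nabs1// !exprS nabsM IH. Qed.

Lemma nabsD_le x y e : v x <= e -> v y <= e -> v (x + y) <= e.
Proof. by move=> xe ye; apply: le_trans (nabsD _ _ _) _; rewrite ge_max xe ye. Qed.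

Lemma nabsB_le x y e : v x <= e -> v y <= e -> v (x - y) <= e.
Proof. by move=> xe ye; rewrite nabsD_le// nabsN. Qed.

Lemma nabsD_lt x y e : v x < e -> v y < e -> v (x + y) < e.
Proof. by move=> xe ye; apply: le_lt_trans (nabsD _ _ _) _; rewrite gt_max xe ye. Qed.

Lemma nabsB_lt x y e : v x < e -> v y < e -> v (x - y) < e.
Proof. by move=> xe ye; rewrite nabsD_lt// nabsN. Qed.

Lemma nabsBC x y : v (x - y) = v (y - x).
Proof. by rewrite -nabsN opprB. Qed.

Lemma nabs_sum_le I (s : seq I) (P : pred I) (f : I -> K) e :
  0 <= e -> (forall i, P i -> v (f i) <= e) -> v (\sum_(i <- s | P i) f i) <= e.
Proof.
move=> e0 fe; apply: (big_ind (fun x => v x <= e)) => //; first by rewrite nabs0.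
by move=> x y; exact: nabsD_le.
Qed.

Lemma nabs_eq_dom x y : v (y - x) < v x -> v y = v x.
Proof.
move=> yx; apply/le_anti/andP; split.
  by rewrite -(subrK x y) nabsD_le// ltW.
rewrite leNgt; apply/negP => xy.
have : v (y - (y - x)) < v x by apply: nabsB_lt.
by rewrite opprB addrC subrK ltxx.
Qed.

Variable w : K.
Hypotheses (wU : uniformizer v w) (w0 : w != 0).

Lemma uniformizer_lt1 : v w < 1.
Proof.
have : [set w * y | y in int_ring v] w by exists 1; rewrite /int_ring /= ?nabs1 ?mulr1.
by rewrite -wU.
Qed.

Lemma uniformizer_gt0 : 0 < v w.
Proof. exact: nabs_gt0. Qed.

Lemma nabs_lt1 x : v x < 1 -> v x <= v w.
Proof.
move=> x1; have : max_ideal v x by [].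
rewrite wU => -[y /= y1 <-]; rewrite nabsM ler_piMr//; exact: nabs_ge0.
Qed.

(** Divide by w until the absolute value is 1; the powers of |w| tend to 0, which bounds the number
    of divisions. *)
Lemma nabs_int_pow x : v x <= 1 -> x != 0 -> exists m, v x = v w ^+ m.
Proof.
move=> x1 x0.
have [m vm] := expr_small uniformizer_gt0 uniformizer_lt1 (nabs_gt0 x0).
elim: m x x1 x0 vm => [|m IH] x x1 x0 vm; first by rewrite expr0 ltNge x1 in vm.
have [x1'|] := ltP (v x) 1; last by move=> ?; exists 0%N; apply/le_anti/andP.
have : v (x / w) <= 1 by rewrite nabsM nabsV ler_pdivrMr ?mul1r ?nabs_lt1 ?uniformizer_gt0.
move/IH => [||r rE].
- by rewrite mulf_neq0// invr_eq0.
- by rewrite nabsM nabsV ltr_pdivlMr ?uniformizer_gt0// -exprSr.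
exists r.+1; rewrite exprSr -rE nabsM nabsV divfK//; exact/eqP/eqP/lt0r_neq0/uniformizer_gt0.
Qed.

(** Two natural exponents stand for one integer exponent. *)
Lemma nabs_pow x : x != 0 -> exists m r, v x * v w ^+ r = v w ^+ m.
Proof.
move=> x0; have [x1|x1] := leP (v x) 1.
  by have [m mE] := nabs_int_pow x1 x0; exists m, 0%N; rewrite expr0 mulr1.
have [||m mE] := @nabs_int_pow x^-1; rewrite ?invr_eq0//.
  by rewrite nabsV invf_le1 ?ltW// nabs_gt0.
exists 0%N, m; rewrite -mE nabsV mulfV//; exact/lt0r_neq0/nabs_gt0.
Qed.

End Valuation.

Section Completeness.
Variables (R : realType) (F : fieldType) (v : nonarch_abs R F) (w : F).
Hypotheses (HF : local_field v) (wU : uniformizer v w).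

Lemma local_uniformizer_neq0 : w != 0.
Proof.
apply/eqP => w0; have [[x nx] _] := HF; apply: nx.
rewrite openE => y /= ->; apply/nbhs_ballP; exists 1 => //=.
move=> z; rewrite ballEmdist /= => xz.
have : max_ideal v ((x : F) - (z : F)) by [].
rewrite wU w0 => -[u _]; rewrite mul0r => /esym/eqP.
by rewrite subr_eq0 => /eqP.
Qed.

Let w0 := local_uniformizer_neq0.
Let vw0 : 0 < v w. Proof. exact: uniformizer_gt0. Qed.
Let vw1 : v w < 1. Proof. exact: uniformizer_lt1. Qed.

(** Local compactness supplies a compact neighbourhood of 0. The partial sums scaled by a large w^M
    stay in it and have a cluster point, which is scaled back. *)
Lemma wadic_converge (c : nat -> F) : (forall i, v (c i) <= 1) ->
  exists s, forall m, v (s - \sum_(i < m) w ^+ i * c i) <= v w ^+ m.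
Proof.
move=> c1; have [_ lc] := HF.
have [U] := lc (0 : F) I.
move=> /nbhs_ballP[e /= e0 eU] [Uc _].
have [M Me] := expr_small vw0 vw1 e0.
pose S m := \sum_(i < m) w ^+ i * c i.
have S1 m : v (S m) <= 1.
  apply: nabs_sum_le => // i _; rewrite nabsM nabsX.
  by rewrite mulr_ile1// ?nabs_ge0// ?exprn_ge0 ?exprn_ile1 ?ltW.
have Sd m j : (m <= j)%N -> v (S j - S m) <= v w ^+ m.
  move=> mj; rewrite /S -(subnKC mj) big_split_ord /= addrAC subrr add0r.
  apply: nabs_sum_le => [|i _]; first by rewrite exprn_ge0// ltW.
  rewrite nabsM nabsX exprD -mulrA; apply: ler_piMr; first by rewrite exprn_ge0// ltW.
  by rewrite mulr_ile1// ?nabs_ge0// ?exprn_ge0 ?exprn_ile1 ?ltW.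
pose x m : valued v := w ^+ M * S m.
have xU m : U (x m).
  apply: eU => //; rewrite ballEmdist /= -[mdist _ _]/(v (0 - w ^+ M * S m)) sub0r nabsN nabsM nabsX.
  by apply: le_lt_trans Me; rewrite ler_piMr// exprn_ge0// ltW.
have [p [Up pc]] : U `&` cluster (x @ \oo) !=set0.
  apply: Uc.
  by exists 0%N => // m _; exact: xU.
exists ((p : F) / w ^+ M) => m.
have B0 : 0 < v w ^+ (M + m) by rewrite exprn_gt0.
have FA : (x @ \oo) (x @` [set j | (m <= j)%N]).
  by exists m => // j /= mj; exists j.
have [z []] := pc _ _ FA (nbhsx_ballx p _ B0).
move=> [j /= mj <-]; rewrite ballEmdist /= -[mdist _ _]/(v (p - w ^+ M * S j)) => pj.
have wM0 : w ^+ M != 0 by rewrite expf_neq0.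
have -> : (p : F) / w ^+ M - S m = (p - w ^+ M * S j) / w ^+ M + (S j - S m).
  by rewrite mulrBl [w ^+ M * _]mulrC mulfK// addrA subrK.
apply: nabsD_le; last exact: Sd.
rewrite nabsM nabsV nabsX ler_pdivrMr ?exprn_gt0//.
by rewrite -exprD addnC ltW.
Qed.

End Completeness.

(** * The residue field of a valued field *)

Section ResidueField.
Variables (R : realType) (K : fieldType) (v : nonarch_abs R K).

Definition res_eq (x y : K) : bool := v (x - y) < 1.
(** The residue field is realized on chosen representatives inside [K], so no quotient type is
    required. *)
Definition res_rep x := choose (res_eq x) x.

Let res_eq_refl x : res_eq x x.
Proof. by rewrite /res_eq subrr nabs0 ltr01. Qed.

Let res_eq_sym x y : res_eq x y = res_eq y x.
Proof. by rewrite /res_eq nabsBC. Qed.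

Let res_eq_trans x y z : res_eq x y -> res_eq y z -> res_eq x z.
Proof. by rewrite /res_eq => xy yz; rewrite -(subrK y x) -addrA nabsD_lt. Qed.

Let res_repP x : res_eq x (res_rep x).
Proof. exact: chooseP (res_eq_refl x). Qed.

Let res_rep_eq x y : res_eq x y -> res_rep x = res_rep y.
Proof.
move=> xy; rewrite /res_rep (@eq_choose _ _ (res_eq y)).
  by apply: choose_id; rewrite // res_eq_sym.
move=> z; apply/idP/idP => xz; last exact: res_eq_trans xz.
by apply: res_eq_trans xz; rewrite res_eq_sym.
Qed.

Let res_rep_le1 x : v x <= 1 -> v (res_rep x) <= 1.
Proof.
move=> x1; rewrite -(subrK x (res_rep x)) nabsD_le//.
by have := res_repP x; rewrite res_eq_sym => /ltW.
Qed.

Definition resfield := {x : K | (v x <= 1) && (res_rep x == x)}.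
HB.instance Definition _ := Choice.on resfield.

Definition res_class (x : K) := res_rep (if v x <= 1 then x else 0).

Fact red_subproof x :
  (v (res_class x) <= 1) && (res_rep (res_class x) == res_class x).
Proof.
set y := res_class x; have y1 : v y <= 1.
  by apply: res_rep_le1; case: ifP => // _; rewrite nabs0 ler01.
rewrite y1; apply/eqP/esym; exact: res_rep_eq.
Qed.

Definition red (x : K) : resfield := exist _ (res_class x) (red_subproof x).

Lemma val_resfield_le1 (a : resfield) : v (val a) <= 1.
Proof. by have /andP[] := valP a. Qed.

Lemma redK (a : resfield) : red (val a) = a.
Proof.
apply: val_inj => /=; rewrite /res_class val_resfield_le1.
by have /andP[_ /eqP] := valP a.
Qed.

Lemma red_eq x y : v x <= 1 -> v y <= 1 -> (red x = red y) <-> v (x - y) < 1.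
Proof.
move=> x1 y1; split=> [/(congr1 val)/= | xy].
  rewrite /res_class x1 y1 => xy; apply: (@res_eq_trans x (res_rep x) y) => //.
  by rewrite xy res_eq_sym.
by apply: val_inj => /=; rewrite /res_class x1 y1; exact: res_rep_eq.
Qed.

Lemma val_red x : v x <= 1 -> v (val (red x) - x) < 1.
Proof. by move=> x1; apply/red_eq; rewrite ?val_resfield_le1// redK. Qed.

Definition res_add (a b : resfield) := red (val a + val b).
Definition res_mul (a b : resfield) := red (val a * val b).
Definition res_opp (a : resfield) := red (- val a).
Definition res_inv (a : resfield) := red (val a)^-1.

Let le1 := val_resfield_le1.

Let radd x y : v x <= 1 -> v y <= 1 -> res_add (red x) (red y) = red (x + y).
Proof.
move=> x1 y1; apply/red_eq; rewrite ?nabsD_le//.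
have -> : val (red x) + val (red y) - (x + y) = (val (red x) - x) + (val (red y) - y) by ring.
by rewrite nabsD_lt// val_red.
Qed.

Let rmul x y : v x <= 1 -> v y <= 1 -> res_mul (red x) (red y) = red (x * y).
Proof.
move=> x1 y1; apply/red_eq; rewrite ?nabsM ?mulr_ile1// ?nabs_ge0//.
have -> : val (red x) * val (red y) - x * y =
  (val (red x) - x) * val (red y) + x * (val (red y) - y) by ring.
rewrite nabsD_lt// nabsM.
  by apply: le_lt_trans (val_red x1); rewrite ler_piMr// nabs_ge0.
by apply: le_lt_trans (val_red y1); rewrite ler_piMl// nabs_ge0.
Qed.

Let ropp x : v x <= 1 -> res_opp (red x) = red (- x).
Proof.
move=> x1; apply/red_eq; rewrite ?nabsN//.
by rewrite opprK addrC nabsBC val_red.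
Qed.

Let redP (a : resfield) : exists2 x, v x <= 1 & a = red x.
Proof. by exists (val a); rewrite ?redK. Qed.

Let one1 : v 1 <= 1. Proof. by rewrite nabs1. Qed.
Let zero1 : v 0 <= 1. Proof. by rewrite nabs0. Qed.
Let add1 x y : v x <= 1 -> v y <= 1 -> v (x + y) <= 1. Proof. exact: nabsD_le. Qed.
Let mul1 x y : v x <= 1 -> v y <= 1 -> v (x * y) <= 1.
Proof. by move=> x1 y1; rewrite nabsM mulr_ile1 ?nabs_ge0. Qed.
Let opp1 x : v x <= 1 -> v (- x) <= 1. Proof. by rewrite nabsN. Qed.

Fact res_addA : associative res_add.
Proof.
move=> a b c; have [x x1 ->] := redP a; have [y y1 ->] := redP b; have [z z1 ->] := redP c.
by rewrite !radd// ?addrA// add1.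
Qed.
Fact res_addC : commutative res_add.
Proof. by move=> a b; rewrite /res_add addrC. Qed.
Fact res_add0 : left_id (red 0) res_add.
Proof. by move=> a; have [x x1 ->] := redP a; rewrite radd ?add0r. Qed.
Fact res_addN : left_inverse (red 0) res_opp res_add.
Proof. by move=> a; have [x x1 ->] := redP a; rewrite ropp// radd ?opp1// addNr. Qed.
HB.instance Definition _ :=
  GRing.isZmodule.Build resfield res_addA res_addC res_add0 res_addN.

Fact res_mulA : associative res_mul.
Proof.
move=> a b c; have [x x1 ->] := redP a; have [y y1 ->] := redP b; have [z z1 ->] := redP c.
by rewrite !rmul// ?mulrA// mul1.
Qed.
Fact res_mulC : commutative res_mul.
Proof. by move=> a b; rewrite /res_mul mulrC. Qed.
Fact res_mul1 : left_id (red 1) res_mul.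
Proof. by move=> a; have [x x1 ->] := redP a; rewrite rmul ?mul1r. Qed.
Fact res_mulD : left_distributive res_mul res_add.
Proof.
move=> a b c; have [x x1 ->] := redP a; have [y y1 ->] := redP b; have [z z1 ->] := redP c.
by rewrite radd// !rmul// ?add1// radd ?mul1// mulrDl.
Qed.
Fact res_oner_neq0 : red 1 != red 0.
Proof. by apply/eqP => /(red_eq one1 zero1); rewrite subr0 nabs1 ltxx. Qed.
HB.instance Definition _ := GRing.Zmodule_isComNzRing.Build resfield
  res_mulA res_mulC res_mul1 res_mulD res_oner_neq0.

Lemma redD x y : v x <= 1 -> v y <= 1 -> red (x + y) = red x + red y.
Proof. by move=> x1 y1; rewrite -radd. Qed.
Lemma redM x y : v x <= 1 -> v y <= 1 -> red (x * y) = red x * red y.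
Proof. by move=> x1 y1; rewrite -rmul. Qed.
Lemma red0 : red 0 = 0. Proof. by []. Qed.
Lemma red1 : red 1 = 1. Proof. by []. Qed.

Lemma red_eq0 x : v x <= 1 -> (red x = 0) <-> v x < 1.
Proof. by move=> x1; rewrite -red0 red_eq// subr0. Qed.

Fact res_mulV (a : resfield) : a != 0 -> res_inv a * a = 1.
Proof.
move=> a0; have v1 : v (val a) = 1.
  apply/le_anti; rewrite le1 /= leNgt; apply: contra a0 => a1.
  by apply/eqP; rewrite -[a]redK; apply/red_eq0.
rewrite -[X in _ * X]redK /res_inv -redM// ?nabsV ?v1 ?invr1//.
by rewrite mulVf// -(nabs_eq0 v) v1 oner_eq0.
Qed.
(** The representative of 0 may be a nonzero element of the maximal ideal; its inverse is then not
    integral, and [res_class] sends such elements to the class of 0. *)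
Fact res_inv0 : res_inv 0 = 0.
Proof.
have v0 : v (val (0 : resfield)) < 1 by apply/red_eq0; rewrite ?redK ?le1.
rewrite /res_inv; have [i1|i1] := leP (v (val (0 : resfield))^-1) 1; last first.
  by apply: val_inj; rewrite /= /res_class leNgt i1 /= nabs0 ler01.
apply/red_eq0 => //; move: i1; rewrite nabsV.
have [->|z0] := eqVneq (val (0 : resfield)) 0; first by rewrite nabs0 invr0 ltr01.
by rewrite invf_le1 ?nabs_gt0// leNgt v0.
Qed.
HB.instance Definition _ := GRing.ComNzRing_isField.Build resfield res_mulV res_inv0.

End ResidueField.

(** * Residue field and Galois group of an unramified extension *)

Section UnramifiedExtension.
Variables (R : realType) (F : fieldType) (vF : nonarch_abs R F) (w : F) (q : nat).
Hypotheses (HF : local_field vF) (Hw : uniformizer vF w) (Hq : residue_card vF q).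
Variables (E : splittingFieldType F) (vE : nonarch_abs R E).
Hypotheses (HvE : forall a : F, vE a%:A = vF a) (Hunram : unramified vF vE).
Variable phi : gal_of {:E}.
Hypothesis Hphi : forall x, int_ring vE x -> max_ideal vE (phi x - x ^+ q).

Let w0 : w != 0. Proof. exact: local_uniformizer_neq0 HF Hw. Qed.
Let wE : E := w%:A.
Let wEU : uniformizer vE wE. Proof. exact: Hunram. Qed.
Let wE0 : wE != 0. Proof. by rewrite scaler_eq0 negb_or w0 oner_eq0. Qed.
Let vw : vE wE = vF w. Proof. exact: HvE. Qed.
Let vw0 : 0 < vF w. Proof. exact: uniformizer_gt0. Qed.
Let vw1 : vF w < 1. Proof. exact: uniformizer_lt1. Qed.

Lemma nabs_scale a x : vE (a *: x) = vF a * vE x.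
Proof. by rewrite -mulr_algl nabsM HvE. Qed.

Lemma residue_reps : exists r : 'I_q -> F,
  [/\ forall i, vF (r i) <= 1, forall x, vF x <= 1 -> exists i, vF (x - r i) < 1
    & forall i j, vF (r i - r j) < 1 -> i = j].
Proof.
have /card_set_bijP[f [fim finj fsurj]] : (`I_q #= [set [set y | max_ideal vF (y - x)] | x in int_ring vF])%card.
  by rewrite card_eq_sym.
have /choice [r rP] : forall i : 'I_q, exists x, vF x <= 1 /\ f i = [set y | max_ideal vF (y - x)].
  by move=> i; have [x x1 <-] := fim i (ltn_ord i); exists x.
exists r; split=> [i|x x1|i j ij].
- by have [] := rP i.
- have [|i iq fi] := fsurj [set y | max_ideal vF (y - x)]; first by exists x.
  exists (Ordinal iq); have [_ /= E1] := rP (Ordinal iq).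
  have : [set y | max_ideal vF (y - x)] x by rewrite /= subrr /max_ideal /= nabs0.
  by rewrite -fi E1.
apply: val_inj; apply: finj; rewrite ?inE ?ltn_ord//=.
have [_ ->] := rP i; have [_ ->] := rP j.
apply/seteqP; split=> y; rewrite /max_ideal /= => yr.
  have -> : y - r j = (y - r i) + (r i - r j) by ring.
  exact: nabsD_lt.
have -> : y - r i = (y - r j) - (r i - r j) by ring.
exact: nabsB_lt.
Qed.

Let q_gt1 : (1 < q)%N.
Proof.
have [r [r1 rcov rinj]] := residue_reps.
have [|i0 H0] := rcov 0; first by rewrite nabs0.
have [|i1 H1] := rcov 1; first by rewrite nabs1.
have i01 : i0 != i1.
  apply/eqP => E1; have : vF (1 - 0) < 1.
    by rewrite -(subrK (r i1) 1) -addrA nabsD_lt// -E1 nabsBC.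
  by rewrite subr0 nabs1 ltxx.
have := ltn_ord i0; have := ltn_ord i1.
case: q i0 i1 i01 {r r1 rcov rinj H0 H1} => [[]//|[|//]] i0 i1.
by rewrite !ord1 eqxx.
Qed.

(** Linear independence of the reductions over the residue field of F, stated without forming that
    field. *)
Definition residually_indep f (x : 'I_f -> E) : Prop :=
  (forall i, vE (x i) <= 1) /\
  forall a : 'I_f -> F, (forall i, vF (a i) <= 1) ->
    vE (\sum_i a i *: x i) < 1 -> forall i, vF (a i) < 1.

Lemma residually_indep_card (k : finType) (rd : E -> k) f (x : 'I_f -> E) :
    (forall y z, vE y <= 1 -> vE z <= 1 -> rd y = rd z -> vE (y - z) < 1) ->
  residually_indep x -> (q ^ f <= #|k|)%N.
Proof.
move=> rdP [x1 xind]; have [r [r1 rcov rinj]] := residue_reps.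
pose g (c : {ffun 'I_f -> 'I_q}) := rd (\sum_i r (c i) *: x i).
have gle (c : {ffun 'I_f -> 'I_q}) : vE (\sum_i r (c i) *: x i) <= 1.
  by apply: nabs_sum_le => // i _; rewrite nabs_scale mulr_ile1 ?nabs_ge0.
have gI : injective g.
  move=> c d /rdP; rewrite -sumrB => /(_ (gle c) (gle d)).
  under eq_bigr do rewrite -scalerBl.
  move=> /xind cd; apply/ffunP => i; apply: rinj; apply: cd.
  by move=> j; rewrite nabsB_le.
by have := leq_card g gI; rewrite card_ffun !card_ord.
Qed.

(** By maximality, adjoining y creates a residual relation; its coefficient at y must be a unit,
    since otherwise the [x i] would already be dependent. *)
Lemma residually_spanning f (x : 'I_f -> E) : residually_indep x ->
    (forall x' : 'I_f.+1 -> E, ~ residually_indep x') ->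
  forall y, vE y <= 1 -> exists a : 'I_f -> F,
    (forall i, vF (a i) <= 1) /\ vE (y - \sum_i a i *: x i) < 1.
Proof.
move=> [x1 xind] nmax y y1.
pose x' (i : 'I_f.+1) := oapp x y (unlift ord_max i).
have x'l i : x' (lift ord_max i) = x i by rewrite /x' liftK.
have x'm : x' ord_max = y by rewrite /x' unlift_none.
have x'1 i : vE (x' i) <= 1 by case: (unliftP ord_max i) => [j|] ->; rewrite ?x'l ?x'm.
have /not_andP[//|/existsNP[a /not_implyP[a1 /not_implyP[av /existsNP[i0]]]]] := nmax x'.
move/negP; rewrite -leNgt => ai0.
have sumE : \sum_i a i *: x' i = \sum_i a (lift ord_max i) *: x i + a ord_max *: y.
  rewrite (bigD1_ord ord_max)//= x'm addrC; congr (_ + _).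
  by apply: eq_bigr => i _; rewrite x'l.
rewrite sumE in av.
have am : vF (a ord_max) = 1.
  apply/le_anti; rewrite a1 /= leNgt; apply/negP => am1.
  have : vE (\sum_i a (lift ord_max i) *: x i) < 1.
    rewrite -(addrK (a ord_max *: y) (\sum_i _)) nabsB_lt// nabs_scale.
    by apply: le_lt_trans am1; rewrite ler_piMr ?nabs_ge0.
  move/(xind (fun i => a (lift ord_max i)) (fun i => a1 _)) => all1.
  move: ai0; case: (unliftP ord_max i0) => [j|] ->; apply/negP; rewrite -ltNge//.
have am0 : a ord_max != 0 by rewrite -(nabs_eq0 vF) am oner_eq0.
exists (fun i => - (a (lift ord_max i) / a ord_max)); split.
  by move=> i; rewrite nabsN nabsM nabsV am invr1 mulr1.
have -> : y - \sum_i - (a (lift ord_max i) / a ord_max) *: x i =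
   (a ord_max)^-1 *: (\sum_i a (lift ord_max i) *: x i + a ord_max *: y).
  rewrite scalerDr scalerA mulVf// scale1r addrC; congr (_ + _).
  rewrite scaler_sumr -sumrN; apply: eq_bigr => i _.
  by rewrite scalerA scaleNr opprK mulrC.
by rewrite nabs_scale nabsV am invr1 mul1r.
Qed.

(* Successive approximation: by completeness of F, residual spanning lifts.   *)
Lemma residually_spanning_dim f (x : 'I_f -> E) :
    (forall i, vE (x i) <= 1) ->
    (forall y, vE y <= 1 -> exists a : 'I_f -> F,
      (forall i, vF (a i) <= 1) /\ vE (y - \sum_i a i *: x i) < 1) ->
  (\dim {:E} <= f)%N.
Proof.
move=> x1 span.
have step y : vE y <= 1 -> exists az : ('I_f -> F) * E,
    [/\ forall i, vF (az.1 i) <= 1, vE az.2 <= 1 & y = \sum_i az.1 i *: x i + wE * az.2].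
  move=> y1; have [a [a1 ay]] := span y y1.
  exists (a, (y - \sum_i a i *: x i) / wE); split=> //=.
    rewrite nabsM nabsV ler_pdivrMr ?vw// mul1r -vw.
    exact: (nabs_lt1 wEU).
  by rewrite mulrCA mulfV// mulr1 addrC subrK.
have intspan y : vE y <= 1 -> exists s : 'I_f -> F, y = \sum_i s i *: x i.
  move=> y1.
  have /choice [g gP] : forall z : E, exists az : ('I_f -> F) * E, vE z <= 1 ->
      [/\ forall i, vF (az.1 i) <= 1, vE az.2 <= 1 & z = \sum_i az.1 i *: x i + wE * az.2].
    move=> z; have [z1|z1] := leP (vE z) 1; last by exists ((fun=> 0), 0).
    by have [az azP] := step z z1; exists az.
  pose Y m := iter m (fun z => (g z).2) y.
  pose c m := (g (Y m)).1.
  have Y1 m : vE (Y m) <= 1.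
    by elim: m => //= m IH; have [] := gP _ IH.
  have c1 m i : vF (c m i) <= 1 by have [+ _ _] := gP _ (Y1 m); exact.
  have YE m : y = \sum_i (\sum_(j < m) w ^+ j * c j i) *: x i + wE ^+ m * Y m.
    elim: m => [|m IH].
      rewrite big1 ?add0r ?expr0 ?mul1r// => i _.
      by rewrite big_ord0 scale0r.
    rewrite {1}IH; have [_ _ ->] := gP _ (Y1 m); rewrite -/(c m) -[(g (Y m)).2]/(Y m.+1).
    rewrite mulrDr addrA mulrA -exprSr; congr (_ + _).
    rewrite mulr_sumr -big_split /=; apply: eq_bigr => i _.
    rewrite big_ord_recr /= scalerDl; congr (_ + _).
    by rewrite -[wE ^+ m](rmorphXn (in_alg E)) mulr_algl scalerA.
  have /choice [s sP] : forall i, exists s, forall m,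
      vF (s - \sum_(j < m) w ^+ j * c j i) <= vF w ^+ m.
    by move=> i; exact: (wadic_converge HF Hw (fun j => c1 j i)).
  exists s; apply/eqP; rewrite -subr_eq0; apply/negPn/negP => d0.
  have [m vm] := expr_small vw0 vw1 (nabs_gt0 vE d0).
  suff : vE (y - \sum_i s i *: x i) <= vF w ^+ m by rewrite leNgt vm.
  rewrite (YE m) addrAC -sumrB; apply: nabsD_le.
    apply: nabs_sum_le => [|i _]; first by rewrite exprn_ge0// ltW.
    rewrite -scalerBl nabs_scale nabsBC.
    by apply: le_trans (sP i m); rewrite ler_piMr ?nabs_ge0.
  by rewrite nabsM nabsX vw ler_piMr// exprn_ge0// ltW.
have allspan y : exists s : 'I_f -> F, y = \sum_i s i *: x i.
  have [->|y0] := eqVneq y 0.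
    by exists (fun=> 0); rewrite big1// => i _; rewrite scale0r.
  have [m [r mr]] := nabs_pow wEU wE0 y0.
  have [|s sE] := intspan (wE ^+ r * y).
    by rewrite nabsM nabsX mulrC mr exprn_ile1 ?vw// ltW.
  exists (fun i => w ^- r * s i).
  rewrite -[y]mul1r -(mulVf (expf_neq0 r wE0)) -mulrA sE mulr_sumr.
  apply: eq_bigr => i _.
  by rewrite -[wE ^+ r](rmorphXn (in_alg E)) -fmorphV mulr_algl scalerA.
have le : ({:E} <= <<[seq x i | i : 'I_f]>>)%VS.
  apply/subvP => y _; have [s ->] := allspan y.
  apply: memv_suml => i _; apply: memvZ; apply: memv_span.
  by apply: map_f; rewrite mem_enum.
apply: leq_trans (dimvS le) _; apply: leq_trans (dim_span _) _.
by rewrite size_map -cardE card_ord.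
Qed.

Lemma nabs_gal_le1 x : vE x <= 1 -> vE (phi x) <= 1.
Proof.
move=> x1; rewrite -(subrK (x ^+ q) (phi x)) nabsD_le//.
  by apply: ltW; exact: Hphi.
by rewrite nabsX exprn_ile1 ?nabs_ge0.
Qed.

(** On units, both phi y and phi y^-1 are integral; the general case is scaled to a unit by powers
    of w, which phi fixes. *)
Lemma nabs_gal x : vE (phi x) = vE x.
Proof.
have unit1 y : vE y = 1 -> vE (phi y) = 1.
  move=> y1; have y0 : y != 0 by rewrite -(nabs_eq0 vE) y1 oner_eq0.
  apply/le_anti; rewrite nabs_gal_le1 ?y1//=.
  have : vE (phi y^-1) <= 1 by rewrite nabs_gal_le1// nabsV y1 invr1.
  by rewrite fmorphV nabsV invf_le1// nabs_gt0// fmorph_eq0.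
have [->|x0] := eqVneq x 0; first by rewrite rmorph0.
have [m [r mr]] := nabs_pow wEU wE0 x0.
have vwE0 : vE wE != 0 by rewrite vw lt0r_neq0.
have := unit1 (x * wE ^+ r / wE ^+ m).
rewrite !(nabsM, nabsV, nabsX) mr mulfV ?expf_neq0// => /(_ erefl).
have pw j : phi (wE ^+ j) = wE ^+ j.
  by rewrite rmorphXn /= /wE -(in_algE) rmorph_alg.
rewrite rmorphM rmorphM fmorphV /= !pw !(nabsM, nabsV, nabsX).
move/(congr1 (fun z => z * vE wE ^+ m / vE wE ^+ r)).
rewrite mulfVK ?expf_neq0// mulfK ?expf_neq0// mul1r => ->.
by rewrite -mr mulfK ?expf_neq0.
Qed.

Lemma gal_expg i x : (phi ^+ i)%g x = iter i phi x.
Proof.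
elim: i => [|i IH]; first by rewrite expg0 gal_id.
by rewrite expgSr galM ?memvf//= IH.
Qed.

Lemma nabs_gal_iter i x : vE (iter i phi x) = vE x.
Proof. by elim: i => //= i; rewrite nabs_gal. Qed.

Let kE := resfield vE.

Let redX (x : E) m : vE x <= 1 -> red vE (x ^+ m) = red vE x ^+ m.
Proof.
move=> x1; elim: m => [|m IH]; first by rewrite !expr0 red1.
by rewrite !exprS redM ?IH// nabsX exprn_ile1 ?nabs_ge0.
Qed.

Let red_gal x : vE x <= 1 -> red vE (phi x) = red vE x ^+ q.
Proof.
move=> x1; rewrite -redX//; apply/red_eq; rewrite ?nabs_gal ?nabsX ?exprn_ile1 ?nabs_ge0//.
exact: Hphi.
Qed.

Let red_gal_iter i x : vE x <= 1 -> red vE (iter i phi x) = red vE x ^+ (q ^ i).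
Proof.
move=> x1; elim: i => [|i IH] /=; first by rewrite expn0 expr1.
by rewrite red_gal ?nabs_gal_iter// IH -exprM expnSr.
Qed.

Let kE_expf (a : kE) : a ^+ (q ^ #[phi]%g) = a.
Proof.
rewrite -[a]redK -red_gal_iter ?val_resfield_le1//.
by rewrite -gal_expg expg_order gal_id.
Qed.

Let kE_uniq (s : seq kE) : uniq s -> (size s <= q ^ #[phi]%g)%N.
Proof.
move=> us; have q1 : (1 < q ^ #[phi]%g)%N by rewrite -(exp1n #[phi]%g) ltn_exp2r// order_gt0.
have sz : size ('X^(q ^ #[phi]%g) - 'X : {poly kE}) = (q ^ #[phi]%g).+1.
  by rewrite size_polyDl ?size_polyXn// size_polyN size_polyX ltnS.
have := @max_poly_roots kE ('X^(q ^ #[phi]%g) - 'X) s.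
rewrite sz ltnS; apply=> //.
  by rewrite -size_poly_gt0 sz.
by apply/allP => a _; rewrite rootE !hornerE kE_expf subrr.
Qed.

Let kE_maximal_seq : exists2 s : seq kE,
  uniq s & forall s' : seq kE, uniq s' -> (size s' <= size s)%N.
Proof.
pose P m := `[< exists2 s : seq kE, uniq s & size s = m >].
have exP : exists m, P m by exists 0%N; apply/asboolP; exists nil.
have bP m : P m -> (m <= q ^ #[phi]%g)%N.
  by move=> /asboolP[s /kE_uniq us <-].
case: (ex_maxnP exP bP) => m /asboolP[s us sm] mmax.
exists s => // s' us'; rewrite sm; apply: mmax.
by apply/asboolP; exists s'.
Qed.

(** A cycle of inequalities. If f is the largest size of a residually independent family, then q^f
    <= |k| by counting combinations, and |k| <= q^o for o the order of phi, since every residue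
    satisfies a^(q^o) = a. Moreover o <= dim E by the fixed field of phi, and dim E <= f by
    [residually_spanning_dim]. So all are equalities, and the fixed field of phi is F. *)
Lemma unramified_residue :
  (exists (k : finFieldType) (rd : E -> k),
    [/\ [/\ forall x y, vE x <= 1 -> vE y <= 1 -> rd (x + y) = rd x + rd y,
            forall x y, vE x <= 1 -> vE y <= 1 -> rd (x * y) = rd x * rd y
          & rd 1 = 1],
        forall x, vE x <= 1 -> rd x = 0 <-> vE x < 1,
        forall b, exists2 x, vE x <= 1 & rd x = b,
        forall x, vE x <= 1 -> rd (phi x) = rd x ^+ q
      & #|k| = (q ^ \dim {:E})%N])
  /\ #[phi]%g = \dim {:E} /\ 'Gal({:E} / 1)%g = <[phi]>%g.
Proof.
have := kE_maximal_seq; case=> s us smax.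
have alls a : a \in s.
  apply: contraT => na; have := smax (a :: s); rewrite /= na us => /(_ isT).
  by rewrite ltnn.
have fK : cancel (fun a : kE => index a s) (fun i => nth 0 s i).
  by move=> a; rewrite nth_index.
have fin : Finite.axiom s by move=> a; rewrite count_uniq_mem// alls.
pose k : finFieldType := HB.pack (resfield vE) (CanIsCountable fK) (isFinite.Build (resfield vE) fin).
have rdP (y z : E) : vE y <= 1 -> vE z <= 1 -> red vE y = red vE z :> k -> vE (y - z) < 1.
  by move=> y1 z1; exact: (red_eq y1 z1).1.
have kle : (#|k| <= q ^ #[phi]%g)%N.
  by rewrite cardE; apply: kE_uniq; exact: enum_uniq.
have dfix := dim_fixedField <[phi]>%G.
rewrite -/(#[phi]%g) in dfix.
have ordn : (#[phi]%g <= \dim {:E})%N by rewrite [X in (X <= _)%N]dfix leq_div.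
have [f [[x xind] fmax]] : exists f, (exists x : 'I_f -> E, residually_indep x) /\
    forall f', (exists x : 'I_f' -> E, residually_indep x) -> (f' <= f)%N.
  pose P m := `[< exists x : 'I_m -> E, residually_indep x >].
  have exP : exists m, P m.
    exists 0%N; apply/asboolP; exists (fun=> 0); split; first by case.
    by move=> ? ? ? [].
  have bP m : P m -> (m <= #[phi]%g)%N.
    move=> /asboolP[x /(residually_indep_card rdP) le].
    by have := leq_trans le kle; rewrite leq_exp2l.
  case: (ex_maxnP exP bP) => f /asboolP xf mmax; exists f; split=> // f' xf'.
  by apply: mmax; apply/asboolP.
have dimf : (\dim {:E} <= f)%N.
  apply: (@residually_spanning_dim _ x); first by have [] := xind.
  apply: residually_spanning xind _ => x' x'ind.
  by have := fmax f.+1 (ex_intro _ x' x'ind); rewrite ltnn.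
have qf := residually_indep_card rdP xind.
have fphi : (f <= #[phi]%g)%N by have := leq_trans qf kle; rewrite leq_exp2l.
have on : #[phi]%g = \dim {:E}.
  by apply/eqP; rewrite eqn_leq ordn (leq_trans dimf).
split.
  exists k, (red vE); split.
  - by split=> [x0 y|x0 y|] *; [exact: redD|exact: redM|exact: red1].
  - by move=> x0; exact: red_eq0.
  - by move=> b; exists (val (b : kE)); [exact: val_resfield_le1|exact: redK].
  - exact: red_gal.
  apply/eqP; rewrite eqn_leq -{1}on kle (leq_trans _ qf)//.
  by rewrite leq_exp2l.
split=> //.
have -> : <[phi]>%g = 'Gal({:E} / fixedField <[phi]>)%g by rewrite gal_fixedField.
suff -> : fixedField <[phi]>%g = 1%VS by [].
have dF : (0 < \dim (fixedField <[phi]>%g))%N by rewrite adim_gt0.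
have dE : (0 < \dim {:E})%N by rewrite adim_gt0.
have d1 : \dim (fixedField <[phi]>%g) = 1%N.
  apply/eqP; rewrite eqn_leq dF andbT leqNgt; apply/negP => d2.
  have := ltn_Pdiv d2 dE.
  by rewrite -dfix on ltnn.
apply/eqP; rewrite eq_sym eqEdim sub1v d1 dimv1.
done.
Qed.

End UnramifiedExtension.

(** * Coordinates, norm and symbols in D *)

Section Coordinates.
Variables (F : fieldType) (E : fieldExtType F) (phi : {rmorphism E -> E}).
Variables (n' : nat) (w : F) (D : unitRingType) (pi : {rmorphism twpoly phi -> D}).
Local Notation n := n'.+1.
Hypothesis HD : is_cyclic_quotient n w pi.
Hypothesis phi_n : forall x, iter n phi x = x.
Hypothesis phi_w : phi w%:A = w%:A.

Local Notation T := (twpoly phi).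
Local Notation emb := (embD pi).
Local Notation Pi := (PiD pi).

Lemma twC_mul (a : E) (p : T) : twC phi a * p = a *: (p : {poly E}) :> {poly E}.
Proof.
rewrite -[LHS]/(twmul (twC phi a) p) /twmul /twC size_polyC.
have [->|a0] := eqVneq a 0; first by rewrite big_ord0 scale0r.
by rewrite big_ord1 coefC.
Qed.

Lemma twX_mul (p : T) : twX phi * p = twshift phi p :> {poly E}.
Proof.
rewrite -[LHS]/(twmul (twX phi) p) /twmul /twX size_polyX.
by rewrite big_ord_recr big_ord1 /= !coefX /= scale0r add0r scale1r.
Qed.

Lemma twX_exp i : twX phi ^+ i = 'X^i :> {poly E}.
Proof.
elim: i => [|i IH]; first by rewrite !expr0.
by rewrite exprS twX_mul IH /twshift map_polyXn -exprSr.
Qed.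

Lemma twpoly_sum (p : T) :
  p = \sum_(i < size (p : {poly E})) twC phi (p : {poly E})`_i * twX phi ^+ i.
Proof.
rewrite -[LHS](@coefK E p) poly_def; apply: eq_bigr => i _.
by rewrite [RHS]twC_mul twX_exp.
Qed.

Lemma PiD_emb a : Pi * emb a = emb (phi a) * Pi.
Proof. by rewrite -[LHS]/(pi (twX phi) * pi (twC phi a)) -rmorphM twXC rmorphM. Qed.

Lemma PiDX_emb i a : Pi ^+ i * emb a = emb (iter i phi a) * Pi ^+ i.
Proof.
elim: i a => [|i IH] a; first by rewrite expr0 mul1r mulr1.
by rewrite exprSr -mulrA PiD_emb mulrA IH -mulrA -iterSr.
Qed.

Lemma PiDX_n : Pi ^+ n = emb w%:A.
Proof.
apply/eqP; rewrite -subr_eq0; apply/eqP.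
have [_ ker] := HD; rewrite -[RHS](_ : pi (twX phi ^+ n - twC phi w%:A) = 0).
  by rewrite rmorphB rmorphXn.
by apply/ker; exists [:: (1, 1)]; rewrite big_seq1 mul1r mulr1.
Qed.

Lemma emb_monomial a m :
  emb a * Pi ^+ m = emb (a * w%:A ^+ (m %/ n)) * Pi ^+ (m %% n).
Proof.
rewrite {1}(divn_eq m n) exprD mulnC exprM PiDX_n -rmorphXn mulrA.
by rewrite -rmorphM.
Qed.

Lemma coord_span d : exists a : 'rV[E]_n, d = \sum_j emb (a 0 j) * Pi ^+ j.
Proof.
have [surj _] := HD; have [p <-] := surj d.
rewrite (twpoly_sum p) rmorph_sum /=.
apply: (big_ind (fun d => exists a : 'rV[E]_n, d = \sum_j emb (a 0 j) * Pi ^+ j)).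
- by exists 0; rewrite big1// => j _; rewrite mxE rmorph0 mul0r.
- move=> _ _ [a ->] [b ->]; exists (a + b); rewrite -big_split.
  by apply: eq_bigr => j _; rewrite mxE rmorphD mulrDl.
move=> i _; rewrite rmorphM rmorphXn /= -[pi (twC _ _)]/(emb _) -/Pi emb_monomial.
have im : (i %% n < n)%N by rewrite ltn_mod.
set b := (X in emb X); exists (\row_j (b *+ (j == Ordinal im))).
rewrite (bigD1 (Ordinal im))//= big1 ?addr0 => [|j ji]; rewrite mxE.
  by rewrite eqxx.
by rewrite (negPf ji) rmorph0 mul0r.
Qed.

Let t : T := twX phi ^+ n - twC phi w%:A.

Let tE : (t : {poly E}) = 'X^n - (w%:A)%:P.
Proof. by rewrite -twX_exp. Qed.

Let mul_t (c : T) : c * t = (c : {poly E}) * (t : {poly E}) :> {poly E}.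
Proof.
have st i : iter i (twshift phi) t = (t : {poly E}) * 'X^i.
  elim: i => [|i IH] /=; first by rewrite mulr1.
  rewrite IH /twshift rmorphM /= map_polyXn exprSr mulrA; congr (_ * _ * _).
  by rewrite tE rmorphB /= map_polyXn map_polyC /= phi_w.
rewrite -[LHS]/(twmul c t) /twmul.
rewrite -[X in _ = X * _](@coefK E c) poly_def mulr_suml.
by apply: eq_bigr => i _; rewrite st mulrC scalerAl.
Qed.

Let t_central (c : T) : t * c = c * t.
Proof.
have tC a : t * twC phi a = twC phi a * t.
  have XC i b : twX phi ^+ i * twC phi b = twC phi (iter i phi b) * twX phi ^+ i.
    elim: i b => [|i IH] b; first by rewrite expr0 mul1r mulr1.
    by rewrite exprSr -mulrA twXC mulrA IH -mulrA -iterSr.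
  by rewrite /t mulrBl mulrBr XC phi_n -!rmorphM mulrC.
have tX : t * twX phi = twX phi * t.
  by rewrite /t mulrBl mulrBr twXC phi_w -exprSr -exprS.
rewrite (twpoly_sum c) mulr_suml mulr_sumr; apply: eq_bigr => i _.
rewrite mulrA tC -!mulrA; congr (_ * _).
by elim: (i : nat) => [|j IH]; rewrite ?expr0 ?mulr1 ?mul1r// exprSr mulrA IH -!mulrA tX.
Qed.

(** X^n - w is central because phi^n = 1 and phi w = w, so the two-sided ideal consists of left
    multiples, which are ordinary polynomial multiples of a monic polynomial of degree n. *)
Lemma coord_inj (a : 'rV[E]_n) : \sum_j emb (a 0 j) * Pi ^+ j = 0 -> a = 0.
Proof.
move=> a0; pose p : {poly E} := \sum_(j < n) a 0 j *: 'X^j.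
have szp : (size p <= n)%N.
  apply: (leq_trans (size_sum _ _ _)); apply/bigmax_leqP => j _.
  by rewrite (leq_trans (size_scale_leq _ _))// size_polyXn.
have pT : (p : T) = \sum_j twC phi (a 0 j) * twX phi ^+ j.
  by apply: eq_bigr => j _; rewrite [RHS]twC_mul twX_exp.
have [_ ker] := HD.
have /ker[s sE] : pi (p : T) = 0.
  by rewrite pT rmorph_sum -[RHS]a0; apply: eq_bigr => j _; rewrite rmorphM rmorphXn.
have {sE} : p = ((\sum_(ab <- s) ab.1 * ab.2 : T) : {poly E}) * (t : {poly E}).
  rewrite -mul_t [LHS]sE mulr_suml; apply: eq_bigr => ab _.
  by rewrite -mulrA t_central mulrA.
set c := (X in X * _) => pE.
have p0 : p = 0.
  apply/eqP; apply/negPn/negP => pn0.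
  have c0 : c != 0 by apply: contraNneq pn0 => c0; rewrite pE c0 mul0r.
  have tm : (t : {poly E}) \is monic by rewrite tE monicXnsubC.
  have := size_Mmonic c0 tm; rewrite -pE tE size_XnsubC// => sp.
  move: szp; rewrite sp addnS /= -[X in (_ <= X)%N]add0n leq_add2r leqn0 size_poly_eq0.
  by rewrite (negPf c0).
apply/rowP => j; rewrite mxE.
have := congr1 (fun r : {poly E} => r`_j) p0.
rewrite coef0 /p coef_sum (bigD1 j)//= big1 ?addr0 => [|i ij].
  by rewrite coefZ coefXn eqxx mulr1.
by rewrite coefZ coefXn eq_sym val_eqE (negPf ij) mulr0.
Qed.

Definition coord (d : D) : 'rV[E]_n := projT1 (cid (coord_span d)).

Lemma coordE d : d = \sum_j emb (coord d 0 j) * Pi ^+ j.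
Proof. by rewrite /coord; case: cid. Qed.

Lemma coord_uniq d (a : 'rV[E]_n) : d = \sum_j emb (a 0 j) * Pi ^+ j -> coord d = a.
Proof.
move=> dE; apply/eqP; rewrite -subr_eq0; apply/eqP/coord_inj.
transitivity (d - d); last by rewrite subrr.
rewrite {3}dE {2}(coordE d) -sumrB; apply: eq_bigr => j _.
by rewrite !mxE rmorphB mulrBl.
Qed.

Lemma coordD d e : coord (d + e) = coord d + coord e.
Proof.
apply: coord_uniq; rewrite {1}(coordE d) {1}(coordE e) -big_split.
by apply: eq_bigr => j _; rewrite mxE rmorphD mulrDl.
Qed.

Lemma coordZ a d : coord (emb a * d) = a *: coord d.
Proof.
apply: coord_uniq; rewrite {1}(coordE d) mulr_sumr.
by apply: eq_bigr => j _; rewrite mxE rmorphM mulrA.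
Qed.

Lemma coord0 : coord 0 = 0.
Proof. by apply: coord_uniq; rewrite big1// => j _; rewrite mxE rmorph0 mul0r. Qed.

Lemma coordN d : coord (- d) = - coord d.
Proof. by apply/eqP; rewrite -addr_eq0 -coordD addNr coord0. Qed.

Lemma coordB d e : coord (d - e) = coord d - coord e.
Proof. by rewrite coordD coordN. Qed.

Lemma coord_sum I (s : seq I) (P : pred I) (f : I -> D) :
  coord (\sum_(i <- s | P i) f i) = \sum_(i <- s | P i) coord (f i).
Proof. by apply: (big_morph coord coordD coord0). Qed.

Lemma coord_inj0 d : coord d = 0 -> d = 0.
Proof.
by move=> d0; rewrite (coordE d) d0 big1// => j _; rewrite mxE rmorph0 mul0r.
Qed.

Lemma coord_monomial a m :
  coord (emb a * Pi ^+ m) =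
  (a * w%:A ^+ (m %/ n)) *: delta_mx 0 (inord (m %% n)).
Proof.
apply: coord_uniq; rewrite emb_monomial.
rewrite (bigD1 (inord (m %% n)))//= big1 ?addr0 => [|j ji]; rewrite !mxE.
  by rewrite !eqxx mulr1 inordK ?ltn_mod.
by rewrite (negPf ji) mulr0 rmorph0 mul0r.
Qed.

Lemma coord_embr a d j : coord (d * emb a) 0 j = coord d 0 j * iter j phi a.
Proof.
have -> : coord (d * emb a) = \row_j (coord d 0 j * iter j phi a); last by rewrite mxE.
apply: coord_uniq; rewrite {1}(coordE d) mulr_suml; apply: eq_bigr => i _.
by rewrite -mulrA PiDX_emb mulrA -rmorphM mxE.
Qed.

Definition rmul_mx (g : D) : 'M[E]_n := \matrix_i coord (Pi ^+ i * g).

Lemma rmul_mxE (d g : D) : coord (d * g) = coord d *m rmul_mx g.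
Proof.
rewrite {1}(coordE d) mulr_suml coord_sum mulmx_sum_row; apply: eq_bigr => i _.
by rewrite -mulrA coordZ rowK.
Qed.

Lemma rmul_mxM (g h : D) : rmul_mx (g * h) = rmul_mx g *m rmul_mx h.
Proof. by apply/row_matrixP => i; rewrite row_mul !rowK mulrA rmul_mxE. Qed.

Lemma rmul_mx1 : rmul_mx 1 = 1%:M.
Proof.
apply/row_matrixP => i; rewrite rowK mulr1 row1.
have := coord_monomial 1 i; rewrite rmorph1 mul1r => ->.
by rewrite divn_small// modn_small// expr0 mulr1 scale1r inord_val.
Qed.

(** Right multiplication is E-linear on a space of finite dimension, so injectivity implies
    surjectivity. *)
Lemma right_regular_inv (g : D) : (forall d : D, d * g = 0 -> d = 0) -> exists h, h * g = 1.
Proof.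
move=> reg; have free : row_free (rmul_mx g).
  apply/inj_row_free => v vg.
  pose d := \sum_j emb (v 0 j) * Pi ^+ j.
  have dv : coord d = v by exact: coord_uniq.
  have : d * g = 0 by apply: coord_inj0; rewrite rmul_mxE dv.
  by move/reg => d0; rewrite -dv d0 coord0.
pose u := coord 1 *m invmx (rmul_mx g).
exists (\sum_j emb (u 0 j) * Pi ^+ j).
apply/eqP; rewrite -subr_eq0; apply/eqP/coord_inj0.
rewrite coordB rmul_mxE (coord_uniq (a := u))// /u mulmxKV ?subrr//.
by rewrite -row_free_unit.
Qed.

End Coordinates.
(** The facts about E / F and D used below, gathered so that the analysis of D does not mention the
    Galois group. The reduction [rd] is total but constrained only on integers, and [c], the n-th
    root of |w|, will be the norm of Pi. *)
Record cyclic_setup (R : realType) (F : fieldType) (E : fieldExtType F)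
    (vE : nonarch_abs R E) (phi : {rmorphism E -> E}) (n' : nat) (w : F)
    (D : unitRingType) (pi : {rmorphism twpoly phi -> D})
    (k : finFieldType) (q : nat) (rd : E -> k) (c : R) : Prop := CyclicSetup {
  cs_quot : is_cyclic_quotient n'.+1 w pi;
  cs_phi_n : forall x, iter n'.+1 phi x = x;
  cs_phi_w : phi w%:A = w%:A;
  cs_unif : uniformizer vE w%:A;
  cs_w0 : w%:A != 0 :> E;
  cs_nabs_phi : forall x, vE (phi x) = vE x;
  cs_rdD : forall x y, vE x <= 1 -> vE y <= 1 -> rd (x + y) = rd x + rd y;
  cs_rdM : forall x y, vE x <= 1 -> vE y <= 1 -> rd (x * y) = rd x * rd y;
  cs_rd1 : rd 1 = 1;
  cs_rd0 : forall x, vE x <= 1 -> rd x = 0 <-> vE x < 1;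
  cs_rd_surj : forall b, exists2 x, vE x <= 1 & rd x = b;
  cs_rd_phi : forall x, vE x <= 1 -> rd (phi x) = rd x ^+ q;
  cs_card : #|k| = (q ^ n'.+1)%N;
  cs_n : (0 < n')%N;
  cs_c0 : 0 < c;
  cs_cn : c ^+ n'.+1 = vE w%:A }.

(** * The multiplicative norm on D *)

Section NormAndSymbols.
Variables (R : realType) (F : fieldType) (E : fieldExtType F)
    (vE : nonarch_abs R E) (phi : {rmorphism E -> E}) (n' : nat) (w : F)
    (D : unitRingType) (pi : {rmorphism twpoly phi -> D})
    (k : finFieldType) (q : nat) (rd : E -> k) (c : R).
Hypothesis S : cyclic_setup vE n' w pi q rd c.

Local Notation n := n'.+1.
Local Notation wE := (w%:A : E).
Local Notation emb := (embD pi).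
Local Notation Pi := (PiD pi).
Local Notation coord := (coord (cs_quot S)).

Let wU := cs_unif S.
Let w0 := cs_w0 S.
Let c0 := cs_c0 S.
Let cn := cs_cn S.
Let coord_monomial := coord_monomial (cs_quot S) (cs_phi_n S) (cs_phi_w S).
Let coordE := coordE (cs_quot S).
Let coordD := coordD (cs_quot S) (cs_phi_n S) (cs_phi_w S).
Let coordB := coordB (cs_quot S) (cs_phi_n S) (cs_phi_w S).
Let coordZ := coordZ (cs_quot S) (cs_phi_n S) (cs_phi_w S).

Lemma cs_c1 : c < 1.
Proof.
rewrite ltNge; apply/negP => c1.
have := uniformizer_lt1 wU; rewrite -cn ltNge.
by rewrite exprn_ege1.
Qed.
Let c1 := cs_c1.

Let cX_gt0 m : 0 < c ^+ m. Proof. exact: exprn_gt0. Qed.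
Let cX_ge0 m : 0 <= c ^+ m. Proof. exact: ltW. Qed.

Lemma nabs_wX m : vE (wE ^+ m) = c ^+ (n * m).
Proof. by rewrite nabsX -cn exprM. Qed.

Lemma nabs_cpow a : a != 0 -> exists m r, vE a * c ^+ (n * r) = c ^+ (n * m).
Proof.
move=> a0; have [m [r mr]] := nabs_pow wU w0 a0.
by exists m, r; rewrite !exprM cn.
Qed.

Lemma nabs_discrete a j i : vE a * c ^+ j <= c ^+ i -> vE a * c ^+ j != c ^+ i ->
  vE a * c ^+ j <= c ^+ i.+1.
Proof.
have [->|a0] := eqVneq a 0; first by rewrite nabs0 mul0r => _ _; exact: cX_ge0.
have [m [r mr]] := nabs_cpow a0.
have E1 : vE a * c ^+ j * c ^+ (n * r) = c ^+ (n * m + j).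
  by rewrite mulrAC mr -exprD.
have le l : (vE a * c ^+ j <= c ^+ l) = (l + n * r <= n * m + j)%N.
  by rewrite -(ler_pM2r (cX_gt0 (n * r))) E1 -exprD ler_iXn2l.
have eq l : (vE a * c ^+ j == c ^+ l) = (l + n * r == n * m + j)%N.
  rewrite -(inj_eq (mulIf (lt0r_neq0 (cX_gt0 (n * r))))) E1 -exprD.
  by rewrite eq_le !ler_iXn2l// -eqn_leq eq_sym.
by rewrite !le eq addSn ltn_neqAle => -> ->.
Qed.

(** The extension of |.| from E to D with value [c] at Pi; multiplicativity is only available after
    [dnorm_decomp]. *)
Definition dnorm (d : D) : R := \big[Num.max/0]_(j < n) (vE (coord d 0 j) * c ^+ j).

Lemma dnorm_leP d e : 0 <= e ->
  dnorm d <= e <-> forall j : 'I_n, vE (coord d 0 j) * c ^+ j <= e.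
Proof.
move=> e0; split=> [/bigmax_leP[_ H] j|H]; first exact: H.
by apply/bigmax_leP; split=> // j _.
Qed.

Lemma dnorm_ge0 d : 0 <= dnorm d.
Proof. exact: bigmax_ge_id. Qed.

Lemma dnorm_coord d j : vE (coord d 0 j) * c ^+ j <= dnorm d.
Proof. exact: ((dnorm_leP d (dnorm_ge0 d)).1 (lexx _)). Qed.

Lemma dnorm_eq0 d : dnorm d = 0 -> d = 0.
Proof.
move=> d0; apply: (coord_inj0 (HD := cs_quot S)); apply/rowP => j; rewrite mxE.
have := dnorm_coord d j; rewrite d0 pmulr_lle0// => vj.
by apply/eqP; rewrite -(nabs_eq0 vE) eq_le vj nabs_ge0.
Qed.

Lemma dnorm_gt0 d : d != 0 -> 0 < dnorm d.
Proof.
move=> d0; rewrite lt_neqAle dnorm_ge0 andbT eq_sym.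
by apply: contra d0 => /eqP/dnorm_eq0->.
Qed.

Lemma dnorm_monomial a m : dnorm (emb a * Pi ^+ m) = vE a * c ^+ m.
Proof.
have vm : vE (a * wE ^+ (m %/ n)) * c ^+ (m %% n) = vE a * c ^+ m.
  by rewrite nabsM nabs_wX -mulrA -exprD mulnC -divn_eq.
have e0 : 0 <= vE a * c ^+ m by rewrite mulr_ge0 ?nabs_ge0.
apply/le_anti/andP; split.
  apply/(dnorm_leP _ e0) => j; rewrite coord_monomial !mxE eqxx /=.
  have [->|_] := eqVneq j; last by rewrite mulr0 nabs0 mul0r.
  by rewrite mulr1 inordK ?ltn_mod// vm.
rewrite -vm; apply: le_trans (dnorm_coord _ (inord (m %% n))).
by rewrite coord_monomial !mxE !eqxx mulr1 inordK ?ltn_mod.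
Qed.

Lemma dnorm_emb a : dnorm (emb a) = vE a.
Proof. by have := dnorm_monomial a 0; rewrite !expr0 !mulr1. Qed.

Lemma dnorm_PiX m : dnorm (Pi ^+ m) = c ^+ m.
Proof. by have := dnorm_monomial 1 m; rewrite rmorph1 nabs1 !mul1r. Qed.

Lemma dnorm0 : dnorm 0 = 0.
Proof. by have := dnorm_emb 0; rewrite rmorph0 nabs0. Qed.

Lemma dnorm1 : dnorm 1 = 1.
Proof. by have := dnorm_emb 1; rewrite rmorph1 nabs1. Qed.

Lemma dnormD d d' : dnorm (d + d') <= Num.max (dnorm d) (dnorm d').
Proof.
have e0 : 0 <= Num.max (dnorm d) (dnorm d') by rewrite le_max dnorm_ge0.
apply/(dnorm_leP _ e0) => j; rewrite coordD mxE.
apply: (@le_trans _ _ (Num.max (vE (coord d 0 j)) (vE (coord d' 0 j)) * c ^+ j)).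
  by rewrite ler_pM2r// nabsD.
rewrite maxr_pMl// ge_max !le_max.
by rewrite dnorm_coord (dnorm_coord d') orbT.
Qed.

Lemma dnormN d : dnorm (- d) = dnorm d.
Proof.
apply: eq_bigr => j _.
by rewrite -sub0r coordB (coord0 (cs_quot S) (cs_phi_n S) (cs_phi_w S)) !mxE sub0r nabsN.
Qed.

Lemma dnormD_le d d' e : dnorm d <= e -> dnorm d' <= e -> dnorm (d + d') <= e.
Proof. by move=> de de'; apply: le_trans (dnormD _ _) _; rewrite ge_max de de'. Qed.

Lemma dnormB_le d d' e : dnorm d <= e -> dnorm d' <= e -> dnorm (d - d') <= e.
Proof. by move=> de de'; rewrite dnormD_le// dnormN. Qed.

Lemma dnormD_lt d d' e : dnorm d < e -> dnorm d' < e -> dnorm (d + d') < e.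
Proof. by move=> de de'; apply: le_lt_trans (dnormD _ _) _; rewrite gt_max de de'. Qed.

Lemma dnorm_sum_le I (s : seq I) (P : pred I) (f : I -> D) e :
  0 <= e -> (forall i, P i -> dnorm (f i) <= e) -> dnorm (\sum_(i <- s | P i) f i) <= e.
Proof.
move=> e0 fe; apply: (big_ind (fun x => dnorm x <= e)) => //; first by rewrite dnorm0.
by move=> x y; exact: dnormD_le.
Qed.

Lemma dnorm_eq_dom d d' : dnorm (d' - d) < dnorm d -> dnorm d' = dnorm d.
Proof.
move=> dd; apply/le_anti/andP; split.
  by rewrite -(subrK d d') dnormD_le// ltW.
rewrite leNgt; apply/negP => lt.
have : dnorm (d' - (d' - d)) < dnorm d by rewrite dnormD_lt// dnormN.
by rewrite opprB addrC subrK ltxx.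
Qed.

Lemma nabs_phi_iter i x : vE (iter i phi x) = vE x.
Proof. by elim: i => //= i; rewrite (cs_nabs_phi S). Qed.

Let dnormM_le d d' : dnorm (d * d') <= dnorm d * dnorm d'.
Proof.
have e0 : 0 <= dnorm d * dnorm d' by rewrite mulr_ge0 ?dnorm_ge0.
rewrite {1}(coordE d) {1}(coordE d') mulr_suml.
apply: dnorm_sum_le => // i _; rewrite mulr_sumr.
apply: dnorm_sum_le => // j _.
rewrite mulrA -[_ * Pi ^+ i * _]mulrA PiDX_emb mulrA -rmorphM -mulrA -exprD.
rewrite dnorm_monomial nabsM nabs_phi_iter exprD mulrACA.
by rewrite ler_pM ?dnorm_coord// mulr_ge0 ?nabs_ge0.
Qed.

Lemma Pi_unit : Pi \is a GRing.unit.
Proof.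
rewrite -(@unitrX_pos _ _ n)// (PiDX_n (cs_quot S)).
by rewrite rmorph_unit// unitfE.
Qed.

Lemma emb_unit a : a != 0 -> emb a \is a GRing.unit.
Proof. by move=> a0; rewrite rmorph_unit// unitfE. Qed.

Lemma dnorm_PiV : dnorm Pi^-1 = c^-1.
Proof.
have -> : Pi^-1 = emb wE^-1 * Pi ^+ n'.
  apply: (mulIr Pi_unit); rewrite mulVr ?Pi_unit// -mulrA -exprSr.
  by rewrite (PiDX_n (cs_quot S)) -rmorphM mulVf// rmorph1.
by rewrite dnorm_monomial nabsV -cn exprS invfM mulfVK// lt0r_neq0.
Qed.

Lemma dnorm_Pil d : dnorm (Pi * d) = c * dnorm d.
Proof.
have H d' : dnorm (Pi * d') <= c * dnorm d'.
  by have := dnormM_le Pi d'; rewrite -[X in dnorm X * _]expr1 dnorm_PiX expr1.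
apply/le_anti; rewrite H /= -ler_pdivlMl//.
have := dnormM_le Pi^-1 (Pi * d).
by rewrite mulKr ?Pi_unit// dnorm_PiV.
Qed.

Lemma dnorm_PiXl m d : dnorm (Pi ^+ m * d) = c ^+ m * dnorm d.
Proof.
elim: m => [|m IH]; first by rewrite !expr0 !mul1r.
by rewrite !exprS -!mulrA dnorm_Pil IH.
Qed.

Lemma dnorm_embl a d : dnorm (emb a * d) = vE a * dnorm d.
Proof.
have H a' d' : dnorm (emb a' * d') <= vE a' * dnorm d'.
  by have := dnormM_le (emb a') d'; rewrite dnorm_emb.
have [->|a0] := eqVneq a 0; first by rewrite rmorph0 nabs0 !mul0r dnorm0.
apply/le_anti; rewrite H /= -ler_pdivlMl ?nabs_gt0//.
have := H a^-1 (emb a * d); rewrite nabsV mulrA -rmorphM mulVf//.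
by rewrite rmorph1 mul1r.
Qed.

Let onePlus_dnorm y d : dnorm y < 1 -> dnorm ((1 + y) * d) = dnorm d.
Proof.
move=> y1; have [->|d0] := eqVneq d 0; first by rewrite mulr0.
apply: dnorm_eq_dom; rewrite mulrDl mul1r addrC addKr.
apply: le_lt_trans (dnormM_le _ _) _.
by rewrite gtr_pMl ?dnorm_gt0.
Qed.

(** Submultiplicativity makes right multiplication by 1 + y injective. The left inverse satisfies h
    = 1 - h y, which forces its norm to be at most 1. *)
Let left_inv y : dnorm y < 1 -> exists2 h, h * (1 + y) = 1 & dnorm (h - 1) <= dnorm y.
Proof.
move=> y1; have [|h hy] := right_regular_inv (cs_quot S) (cs_phi_n S)
    (cs_phi_w S) (g := 1 + y).
  move=> d; rewrite mulrDr mulr1 => /eqP; rewrite addr_eq0 => /eqP dE.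
  apply/eqP; apply: contraTT isT => d0.
  have := dnormM_le d y; rewrite -dnormN -dE leNgt.
  by rewrite gtr_pMr ?dnorm_gt0// y1.
exists h => //.
have hE : h - 1 = - (h * y) by rewrite -[X in h - X]hy mulrDr mulr1 opprD addNKr.
have h1 : dnorm h <= 1.
  rewrite leNgt; apply/negP => h1.
  have : dnorm h <= Num.max 1 (dnorm h * dnorm y).
    rewrite -[h in X in X <= _](subrK 1) hE; apply: dnormD_le.
      by rewrite dnormN le_max dnormM_le orbT.
    by rewrite dnorm1 le_max lexx.
  rewrite le_max leNgt h1 /= leNgt gtr_pMr ?y1//.
  exact: lt_trans h1.
rewrite hE dnormN; apply: le_trans (dnormM_le _ _) _.
by rewrite ler_piMl// dnorm_ge0.
Qed.

Lemma onePlus_unit y : dnorm y < 1 ->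
  (1 + y) \is a GRing.unit /\ dnorm ((1 + y)^-1 - 1) <= dnorm y.
Proof.
move=> y1; have [h hy h1] := left_inv y1.
have [h' h'h _] := left_inv (le_lt_trans h1 y1).
rewrite addrC subrK in h'h.
have E1 : h' = 1 + y by rewrite -[LHS]mulr1 -[X in _ * X]hy mulrA h'h mul1r.
have u : (1 + y) \is a GRing.unit.
  by apply/unitrP; exists h; split; rewrite // -E1.
split=> //; have -> : (1 + y)^-1 = h; last by [].
by apply: (mulIr u); rewrite mulVr.
Qed.

(** Norms of elements of E are powers of c^n, so nonzero terms in different degrees j < n have
    different norms; the dominant term is factored out. *)
Lemma dnorm_decomp (d : D) : d != 0 -> exists a j y,
  [/\ a != 0, (j < n)%N, dnorm y < 1 & d = emb a * Pi ^+ j * (1 + y)].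
Proof.
move=> d0; pose f (j : 'I_n) := vE (coord d 0 j) * c ^+ j.
have [j jmax] : exists j, forall i, f i <= f j.
  case: (@arg_maxP _ R _ ord0 xpredT f isT) => j _ jmax.
  by exists j => i; exact: jmax.
have fj0 : 0 < f j.
  apply: lt_le_trans (dnorm_gt0 d0) _; apply/dnorm_leP => //.
  by rewrite mulr_ge0 ?nabs_ge0.
pose a := coord d 0 j.
have a0 : a != 0 by rewrite -(nabs_eq0 vE) gt_eqF//; move: fj0; rewrite pmulr_lgt0.
have fij i : i != j -> f i < f j.
  move=> ij; rewrite lt_neqAle jmax andbT; apply/eqP => fE.
  have b0 : coord d 0 i != 0.
    by rewrite -(nabs_eq0 vE) gt_eqF//; move: fj0; rewrite -fE pmulr_lgt0.
  have [m [r mr]] := nabs_cpow a0; have [m' [r' mr']] := nabs_cpow b0.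
  have : c ^+ (n * m) * c ^+ j * c ^+ (n * r') = c ^+ (n * m') * c ^+ i * c ^+ (n * r).
    rewrite -mr -mr' -[vE a * _ * _]mulrAC -[vE (coord _ _ _) * _ * _]mulrAC.
    by rewrite -/(f j) -/(f i) fE mulrAC.
  rewrite -!exprD.
  move/eqP; rewrite eq_le !ler_iXn2l// -eqn_leq.
  move/eqP => eqn; have {eqn} : ((m' + r) * n + i = (m + r') * n + j)%N by lia.
  move/(congr1 (modn^~ n)); rewrite !modnMDl.
  by rewrite !modn_small// => /val_inj ji; rewrite ji eqxx in ij.
pose g := emb a * Pi ^+ j.
have gu : g \is a GRing.unit by rewrite unitrMl ?unitrX ?Pi_unit// emb_unit.
have dg : dnorm (d - g) < f j.
  apply/bigmax_ltP; split=> // i _; rewrite coordB coord_monomial.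
  rewrite divn_small// modn_small// expr0 mulr1 inord_val !mxE eqxx /=.
  have [->|ij] := eqVneq i j; first by rewrite mulr1 subrr nabs0 mul0r.
  by rewrite mulr0 subr0; exact: fij.
exists a, j, (g^-1 * (d - g)); split=> //.
  have : dnorm (g * (g^-1 * (d - g))) < f j by rewrite mulVKr.
  by rewrite /g -mulrA dnorm_embl dnorm_PiXl mulrA gtr_pMr.
by rewrite mulrDr mulr1 -/g mulVKr// addrC subrK.
Qed.

Lemma dunit (d : D) : d != 0 -> d \is a GRing.unit.
Proof.
move=> /dnorm_decomp[a [j [y [a0 _ y1 ->]]]].
have [u _] := onePlus_unit y1.
by rewrite unitrMl// unitrMl ?unitrX ?Pi_unit// emb_unit.
Qed.

Lemma dnormM d d' : dnorm (d * d') = dnorm d * dnorm d'.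
Proof.
have [->|d0] := eqVneq d 0; first by rewrite mul0r dnorm0 mul0r.
have [a [j [y [_ _ y1 ->]]]] := dnorm_decomp d0.
rewrite -!mulrA !dnorm_embl !dnorm_PiXl onePlus_dnorm// mulrA.
by rewrite -[1 + y]mulr1 onePlus_dnorm// dnorm1 mulr1.
Qed.

Lemma dnormV d : d != 0 -> dnorm d^-1 = (dnorm d)^-1.
Proof.
move=> d0; have dn0 : dnorm d != 0 by rewrite gt_eqF// dnorm_gt0.
by apply: (mulfI dn0); rewrite -dnormM divrr ?dunit// dnorm1 mulfV.
Qed.

Lemma dnorm_unit_neq0 (g : units D) : (g : D) != 0.
Proof. by apply: contraTneq (uvalP g) => ->; rewrite unitr0. Qed.

Lemma dnorm_conj (g : units D) d : dnorm ((g : D) * d * (g : D)^-1) = dnorm d.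
Proof.
have g0 := dnorm_unit_neq0 g.
by rewrite !dnormM dnormV// mulrAC mulfV ?mul1r// gt_eqF// dnorm_gt0.
Qed.

End NormAndSymbols.
Lemma uvalM (A : unitRingType) (g h : units A) : uval (g * h)%g = uval g * uval h.
Proof. by []. Qed.
Lemma uvalV (A : unitRingType) (g : units A) : uval (g^-1)%g = (uval g)^-1.
Proof. by []. Qed.
Lemma uval1 (A : unitRingType) : uval (1%g : units A) = 1.
Proof. by []. Qed.
Lemma uval_inj (A : unitRingType) (g h : units A) : uval g = uval h -> g = h.
Proof. exact: val_inj. Qed.

(** * Symbols: the graded ring of D *)

Section Symbols.
Variables (R : realType) (F : fieldType) (E : fieldExtType F)
    (vE : nonarch_abs R E) (phi : {rmorphism E -> E}) (n' : nat) (w : F)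
    (D : unitRingType) (pi : {rmorphism twpoly phi -> D})
    (k : finFieldType) (q : nat) (rd : E -> k) (c : R).
Hypothesis S : cyclic_setup vE n' w pi q rd c.

Local Notation n := n'.+1.
Local Notation wE := (w%:A : E).
Local Notation emb := (embD pi).
Local Notation Pi := (PiD pi).
Local Notation coord := (coord (cs_quot S)).
Local Notation N := (dnorm S).
Local Notation toD := (units_map (embD pi)).

Let w0 := cs_w0 S.
Let c0 := cs_c0 S.
Let cn := cs_cn S.
Let c1 := cs_c1 S.
Let coord_monomial := coord_monomial (cs_quot S) (cs_phi_n S) (cs_phi_w S).
Let coordD := coordD (cs_quot S) (cs_phi_n S) (cs_phi_w S).
Let coordB := coordB (cs_quot S) (cs_phi_n S) (cs_phi_w S).
Let coordZ := coordZ (cs_quot S) (cs_phi_n S) (cs_phi_w S).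

Let cX_gt0 m : 0 < c ^+ m. Proof. exact: exprn_gt0. Qed.
Let cX_ge0 m : 0 <= c ^+ m. Proof. exact: ltW. Qed.
Let cX_le i j : (i <= j)%N -> c ^+ j <= c ^+ i.
Proof. by move=> ij; rewrite ler_iXn2l. Qed.
Let cX_le1 i : c ^+ i <= 1.
Proof. by rewrite exprn_ile1// ltW. Qed.
Let cX_lt i j : (i < j)%N -> c ^+ j < c ^+ i.
Proof. by move=> ij; rewrite ltr_iXn2l. Qed.

Lemma rdB x y : vE x <= 1 -> vE y <= 1 -> rd (x - y) = rd x - rd y.
Proof.
move=> x1 y1; apply/eqP; rewrite eq_sym subr_eq -(cs_rdD S) ?subrK//.
by rewrite nabsB_le.
Qed.

Lemma rd_eq x y : vE x <= 1 -> vE y <= 1 -> rd x = rd y <-> vE (x - y) < 1.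
Proof.
move=> x1 y1; have xy1 : vE (x - y) <= 1 by rewrite nabsB_le.
split=> [xy|/(cs_rd0 S xy1)/eqP].
  by apply/(cs_rd0 S xy1); rewrite rdB// xy subrr.
by rewrite rdB// subr_eq0 => /eqP.
Qed.

Lemma rd_phi_iter i x : vE x <= 1 -> rd (iter i phi x) = rd x ^+ (q ^ i).
Proof.
move=> x1; elim: i => [|i IH]; first by rewrite expn0 expr1.
by rewrite /= (cs_rd_phi S) ?(nabs_phi_iter S)// IH -exprM expnSr.
Qed.

Lemma expf_qn (x : k) m : x ^+ (q ^ (n * m)) = x.
Proof.
elim: m => [|m IH]; first by rewrite muln0 expn0 expr1.
by rewrite mulnS expnD exprM -(cs_card S) expf_card IH.
Qed.

Lemma expf_qD i (x y : k) : (x + y) ^+ (q ^ i) = x ^+ (q ^ i) + y ^+ (q ^ i).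
Proof.
have [a a1 <-] := cs_rd_surj S x; have [b b1 <-] := cs_rd_surj S y.
rewrite -(cs_rdD S)// -!rd_phi_iter ?nabsD_le//.
have -> : iter i phi (a + b) = iter i phi a + iter i phi b.
  by elim: i => //= i ->; rewrite rmorphD.
by rewrite (cs_rdD S) ?(nabs_phi_iter S).
Qed.

Definition pr (d : D) : E := coord d 0 ord0.

Lemma prD d d' : pr (d + d') = pr d + pr d'.
Proof. by rewrite /pr coordD mxE. Qed.
Lemma prB d d' : pr (d - d') = pr d - pr d'.
Proof. by rewrite /pr coordB !mxE. Qed.
Lemma pr_embl a d : pr (emb a * d) = a * pr d.
Proof. by rewrite /pr coordZ mxE. Qed.
Lemma pr_embr a d : pr (d * emb a) = pr d * a.
Proof. by rewrite /pr (coord_embr (cs_quot S) (cs_phi_n S) (cs_phi_w S)). Qed.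
Lemma pr_emb a : pr (emb a) = a.
Proof.
have := coord_monomial a 0; rewrite expr0 mulr1 /pr => ->.
by rewrite div0n mod0n expr0 mulr1 !mxE (_ : inord 0 = ord0) ?mulr1//; apply: val_inj; rewrite /= inordK.
Qed.
Lemma pr1 : pr 1 = 1. Proof. by rewrite -(rmorph1 emb) pr_emb. Qed.
Lemma pr0 : pr 0 = 0. Proof. by rewrite -(rmorph0 emb) pr_emb. Qed.
Lemma pr_dnorm d : vE (pr d) <= N d.
Proof. by have := dnorm_coord S d ord0; rewrite expr0 mulr1. Qed.

(** Values on E are powers of c^n, so a bound beyond c^(n m) improves to the next multiple of n.
    This is how errors of depth greater than h become invisible to theta. *)
Lemma nabs_round a i m : vE a <= c ^+ i -> (n * m < i)%N -> vE a <= c ^+ (n * m.+1).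
Proof.
have [->|a0] := eqVneq a 0; first by rewrite nabs0 => _ _.
have [m1 [r mr]] := nabs_cpow S a0.
rewrite -(ler_pM2r (cX_gt0 (n * r))) mr -exprD ler_iXn2l// => le lt.
rewrite -(ler_pM2r (cX_gt0 (n * r))) mr -exprD ler_iXn2l// -mulnDr leq_pmul2l//.
rewrite addSn -(@ltn_pmul2l n)// mulnDr; apply: leq_trans le.
by rewrite ltn_add2r.
Qed.

Lemma pr_round d i m : N d <= c ^+ i -> (n * m < i)%N -> vE (pr d) <= c ^+ (n * m.+1).
Proof. by move=> di; apply: nabs_round; exact: le_trans (pr_dnorm d) di. Qed.

(** The coefficient of Pi^i when the coordinate of degree i mod n is rewritten using w = Pi^n. *)
Definition lead (i : nat) (d : D) : E := coord d 0 (inord (i %% n)) / wE ^+ (i %/ n).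
Definition sy (i : nat) (d : D) : k := rd (lead i d).

Lemma lead_abs i d : vE (lead i d) * c ^+ i = vE (coord d 0 (inord (i %% n))) * c ^+ (i %% n).
Proof.
rewrite /lead nabsM nabsV (nabs_wX S) {3}(divn_eq i n) exprD [(_ * n)%N]mulnC.
by rewrite mulrA mulfVK// gt_eqF.
Qed.

Lemma lead_le1 i d : N d <= c ^+ i -> vE (lead i d) <= 1.
Proof.
move=> di; rewrite -(ler_pM2r (cX_gt0 i)) mul1r lead_abs.
apply: le_trans di; have := dnorm_coord S d (inord (i %% n)).
by rewrite inordK// ltn_mod.
Qed.

Lemma leadD i d d' : lead i (d + d') = lead i d + lead i d'.
Proof. by rewrite /lead coordD mxE mulrDl. Qed.
Lemma leadB i d d' : lead i (d - d') = lead i d - lead i d'.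
Proof. by rewrite /lead coordB !mxE mulrBl. Qed.

Lemma lead_monomial a i : lead i (emb a * Pi ^+ i) = a.
Proof.
by rewrite /lead coord_monomial !mxE !eqxx mulr1 mulfK// expf_neq0.
Qed.

Lemma syD i d d' : N d <= c ^+ i -> N d' <= c ^+ i -> sy i (d + d') = sy i d + sy i d'.
Proof. by move=> di di'; rewrite /sy leadD (cs_rdD S) ?lead_le1. Qed.

Lemma syB i d d' : N d <= c ^+ i -> N d' <= c ^+ i -> sy i (d - d') = sy i d - sy i d'.
Proof. by move=> di di'; rewrite /sy leadB rdB ?lead_le1. Qed.

Lemma sy_eq0 i d : N d <= c ^+ i -> sy i d = 0 <-> N d <= c ^+ i.+1.
Proof.
move=> di; have l1 := lead_le1 di; split.
  move/(cs_rd0 S l1) => lt1; apply/dnorm_leP => // j.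
  apply: (nabs_discrete S); first by apply: le_trans di; exact: dnorm_coord.
  apply/eqP => E1.
  have [jE|jN] := eqVneq j (inord (i %% n)).
    move: lt1; rewrite -(ltr_pM2r (cX_gt0 i)) mul1r lead_abs -E1 jE inordK ?ltn_mod//.
    by rewrite ltxx.
  have a0 : coord d 0 j != 0.
    apply: contraTneq (cX_gt0 i) => a0.
    by rewrite -E1 a0 nabs0 mul0r ltxx.
  have [m [r mr]] := nabs_cpow S a0.
  have : c ^+ (n * m) * c ^+ j = c ^+ i * c ^+ (n * r) by rewrite -mr -E1 mulrAC.
  rewrite -!exprD => /eqP; rewrite eq_le !ler_iXn2l// -eqn_leq => /eqP eqn.
  have {eqn} : (r * n + i = m * n + j)%N by lia.
  move/(congr1 (modn^~ n)); rewrite !modnMDl [(j %% n)%N]modn_small// => ij.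
  by case/eqP: jN; apply: val_inj; rewrite /= inordK ?ij.
move=> dS; apply/(cs_rd0 S l1).
rewrite -(ltr_pM2r (cX_gt0 i)) mul1r lead_abs; apply: le_lt_trans (cX_lt (ltnSn i)).
apply: le_trans dS; have := dnorm_coord S d (inord (i %% n)).
by rewrite inordK// ltn_mod.
Qed.

Lemma sy_monomial a i : sy i (emb a * Pi ^+ i) = rd a.
Proof. by rewrite /sy lead_monomial. Qed.

Lemma sy_split i d : N d <= c ^+ i -> N (d - emb (lead i d) * Pi ^+ i) <= c ^+ i.+1.
Proof.
move=> di; have l1 := lead_le1 di.
have mi : N (emb (lead i d) * Pi ^+ i) <= c ^+ i.
  by rewrite dnorm_monomial ler_piMl.
apply/sy_eq0; first exact: dnormB_le.
by rewrite syB// sy_monomial subrr.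
Qed.

Lemma dnormM_cX i j d d' : N d <= c ^+ i -> N d' <= c ^+ j -> N (d * d') <= c ^+ (i + j).
Proof. by move=> di dj; rewrite dnormM exprD ler_pM ?dnorm_ge0. Qed.

Lemma dnorm_le_cX i j d : (j <= i)%N -> N d <= c ^+ i -> N d <= c ^+ j.
Proof. by move=> ji di; apply: le_trans di _; exact: cX_le. Qed.

(** The graded ring of D is the twisted polynomial ring k<Pi>: moving Pi^i past b raises b to the
    power q^i. *)
Lemma syM i j d d' : N d <= c ^+ i -> N d' <= c ^+ j ->
  sy (i + j) (d * d') = sy i d * sy j d' ^+ (q ^ i).
Proof.
move=> di dj; have l1 := lead_le1 di; have l1' := lead_le1 dj.
pose a := lead i d; pose b := lead j d'.
have ai : N (emb a * Pi ^+ i) <= c ^+ i by rewrite dnorm_monomial ler_piMl.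
have dE : d * d' = emb (a * iter i phi b) * Pi ^+ (i + j) +
   (emb a * Pi ^+ i * (d' - emb b * Pi ^+ j) + (d - emb a * Pi ^+ i) * d').
  have -> : emb (a * iter i phi b) * Pi ^+ (i + j) = emb a * Pi ^+ i * (emb b * Pi ^+ j).
    by rewrite rmorphM exprD -!mulrA [Pi ^+ i * (emb b * _)]mulrA PiDX_emb !mulrA.
  rewrite mulrBr mulrBl addrA [_ * (emb b * _) + _]addrC subrK.
  by rewrite [emb a * _ * d' + _]addrC subrK.
have ab1 : vE (a * iter i phi b) <= 1.
  by rewrite nabsM (nabs_phi_iter S) mulr_ile1// nabs_ge0.
have rest : N (emb a * Pi ^+ i * (d' - emb b * Pi ^+ j) + (d - emb a * Pi ^+ i) * d')
    <= c ^+ (i + j).+1.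
  apply: dnormD_le.
    by rewrite -addnS; apply: dnormM_cX => //; exact: sy_split.
  by rewrite -addSn; apply: dnormM_cX => //; exact: sy_split.
have mij : N (emb (a * iter i phi b) * Pi ^+ (i + j)) <= c ^+ (i + j).
  by rewrite dnorm_monomial ler_piMl.
rewrite dE syD//; last exact: (dnorm_le_cX (leqnSn _)) rest.
rewrite [X in _ + X](_ : _ = 0) ?addr0; last first.
  by apply/sy_eq0 => //; exact: (dnorm_le_cX (leqnSn _)) rest.
rewrite sy_monomial (cs_rdM S) ?(nabs_phi_iter S)//.
by rewrite rd_phi_iter.
Qed.

Lemma sy_emb i a : sy i (emb a) = if (n %| i)%N then rd (a / wE ^+ (i %/ n)) else 0.
Proof.
rewrite /sy /lead; have := coord_monomial a 0; rewrite expr0 mulr1 => ->.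
rewrite div0n mod0n expr0 mulr1 !mxE eqxx /= /dvdn.
have -> : (inord (i %% n) == inord 0 :> 'I_n) = (i %% n == 0)%N.
  by rewrite -val_eqE /= !inordK// ltn_mod.
case: eqP => _; first by rewrite mulr1.
by rewrite mulr0 mul0r; apply/(cs_rd0 S); rewrite nabs0.
Qed.

Lemma sy_pr i d : (n %| i)%N -> sy i d = rd (pr d / wE ^+ (i %/ n)).
Proof.
rewrite /dvdn /sy /lead /pr => /eqP ->.
by rewrite (_ : inord 0 = ord0)//; apply: val_inj; rewrite /= inordK.
Qed.

Lemma dnorm_pr d e : N d <= e -> N (emb (pr d)) <= e.
Proof. by move=> de; rewrite dnorm_emb; apply: le_trans (pr_dnorm d) de. Qed.

Lemma sy_subpr i d : N d <= c ^+ i ->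
  sy i (d - emb (pr d)) = if (n %| i)%N then 0 else sy i d.
Proof.
move=> di; rewrite syB ?dnorm_pr// sy_emb.
by case: ifP => [/sy_pr ->|_]; rewrite ?subrr ?subr0.
Qed.

Lemma sy0_emb a : sy 0 (emb a) = rd a.
Proof. by rewrite sy_emb dvdn0 div0n expr0 divr1. Qed.

Lemma sy0_1 : sy 0 1 = 1.
Proof. by rewrite -(rmorph1 emb) sy0_emb (cs_rd1 S). Qed.

Lemma sy_surj i b : exists2 a, vE a <= 1 & sy i (emb a * Pi ^+ i) = b.
Proof. by have [a a1 ab] := cs_rd_surj S b; exists a; rewrite ?sy_monomial. Qed.

Lemma pr_monomial a i : ~~ (n %| i)%N -> pr (emb a * Pi ^+ i) = 0.
Proof.
rewrite /pr coord_monomial !mxE eqxx /= /dvdn.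
have -> : (ord0 == inord (i %% n) :> 'I_n) = (i %% n == 0)%N.
  by rewrite -val_eqE /= inordK ?ltn_mod// eq_sym.
by case: eqP => // _ _; rewrite mulr0.
Qed.

Lemma OD_dnorm d : OD vE n pi d <-> N d <= 1.
Proof.
split.
  move=> [a /= a1 <-]; apply: dnorm_sum_le => // j _.
  rewrite dnorm_monomial mulr_ile1 ?nabs_ge0//; exact: a1.
move=> d1; exists (fun j => coord d 0 j); last by rewrite -(coordE (cs_quot S)).
move=> j; rewrite /int_ring /= leNgt; apply/negP => a1.
have a0 : coord d 0 j != 0.
  by apply: contraTneq a1 => ->; rewrite nabs0 -leNgt.
have [m [r mr]] := nabs_cpow S a0.
have rm : (m < r)%N.
  by rewrite -(@ltn_pmul2l n)// -(ltr_iXn2l c0 c1) -mr ltr_pMl ?cX_gt0.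
have := le_trans (dnorm_coord S d j) d1.
rewrite -(ler_pM2r (cX_gt0 (n * r))) mul1r mulrAC mr -exprD ler_iXn2l//.
by move=> H; have := ltn_ord j; nia.
Qed.

Lemma PD_dnorm m d : PD vE n pi m d <-> N d <= c ^+ m.
Proof.
split.
  move=> [y /OD_dnorm y1 <-].
  by rewrite dnorm_PiXl ler_piMr.
move=> dm; have u : Pi ^+ m \is a GRing.unit by rewrite unitrX// (Pi_unit S).
exists ((Pi ^+ m)^-1 * d); last by rewrite mulVKr.
apply/OD_dnorm; rewrite -(ler_pM2l (cX_gt0 m)) mulr1.
by rewrite -(dnorm_PiXl S m) mulVKr.
Qed.

Lemma UD_dnorm m (g : units D) : UD vE n pi m g <-> N ((g : D) - 1) <= c ^+ m.
Proof. exact: PD_dnorm. Qed.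

Lemma Cperp_pr d : Cperp n pi d <-> pr d = 0.
Proof.
split.
  move=> [a _ <-]; rewrite (big_morph pr prD pr0) big1// => j j0.
  rewrite pr_monomial// /dvdn modn_small// -lt0n//.
move=> d0; exists (fun j => coord d 0 j) => //.
rewrite [RHS](coordE (cs_quot S) d) [RHS](bigD1 ord0)//= -/(pr d) d0 rmorph0 mul0r add0r.
by apply: eq_bigl => j; rewrite lt0n.
Qed.

Lemma UC_dnorm m (g : units D) :
  UC vE n pi m g <-> pr g = 1 /\ N ((g : D) - 1) <= c ^+ m.
Proof.
rewrite /UC /=; split=> [[/Cperp_pr + /PD_dnorm ->]|[g1 gm]]; last first.
  by split; [apply/Cperp_pr; rewrite prB g1 pr1 subrr|apply/PD_dnorm].
by rewrite prB pr1 => /eqP; rewrite subr_eq0 => /eqP.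
Qed.

End Symbols.
Lemma uval_insubd (A : unitRingType) (x : A) : x \is a GRing.unit ->
  uval (insubd (1%g : units A) x) = x.
Proof. by move=> xu; rewrite -[LHS]/(val _) val_insubd xu. Qed.

(** * The groups U_D^m and E^x U_D^m *)

Section UnitGroups.
Variables (R : realType) (F : fieldType) (E : fieldExtType F)
    (vE : nonarch_abs R E) (phi : {rmorphism E -> E}) (n' : nat) (w : F)
    (D : unitRingType) (pi : {rmorphism twpoly phi -> D})
    (k : finFieldType) (q : nat) (rd : E -> k) (c : R).
Hypothesis S : cyclic_setup vE n' w pi q rd c.

Local Notation n := n'.+1.
Local Notation emb := (embD pi).
Local Notation Pi := (PiD pi).
Local Notation N := (dnorm S).
Local Notation pr := (pr S).
Local Notation sy := (sy S).
Local Notation toD := (units_map (embD pi)).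
Local Notation U := (UD vE n pi).

Let c0 := cs_c0 S.
Let c1 := cs_c1 S.

Lemma cX_gt0 m : 0 < c ^+ m. Proof. exact: exprn_gt0. Qed.
Lemma cX_lt1 m : (0 < m)%N -> c ^+ m < 1.
Proof. by move=> m0; rewrite exprn_ilt1 ?ltW// ?c0 ?c1 -?lt0n. Qed.

Lemma toDM x y : toD (x * y)%g = (toD x * toD y)%g.
Proof. apply: uval_inj; exact: (rmorphM emb). Qed.
Lemma toD1 : toD 1%g = 1%g.
Proof. apply: uval_inj; exact: (rmorph1 emb). Qed.
Lemma toDV x : toD (x^-1)%g = (toD x)^-1%g.
Proof. apply: uval_inj; exact: (rmorphV emb (uvalP x)). Qed.

Lemma uval_toD x : uval (toD x) = emb (uval x).
Proof. by []. Qed.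

Lemma units_neq0 (A : fieldType) (x : units A) : uval x != 0.
Proof. by have := uvalP x; rewrite unitfE. Qed.

Definition PiU : units D := Units (Pi_unit S).

Lemma uvalX (A : unitRingType) (g : units A) m : uval (g ^+ m)%g = uval g ^+ m.
Proof. by elim: m => // m IH; rewrite expgS exprS uvalM IH. Qed.

Lemma PiU_toD j x : exists2 y : units E, uval y = iter j phi (uval x) &
  (PiU ^+ j * toD x * (PiU ^+ j)^-1)%g = toD y.
Proof.
have x0 : iter j phi (uval x) != 0.
  by rewrite -(nabs_eq0 vE) (nabs_phi_iter S) nabs_eq0 units_neq0.
have xu : iter j phi (uval x) \is a GRing.unit by rewrite unitfE.
exists (Units xu) => //; apply: uval_inj.
rewrite !uvalM uvalV !uvalX !uval_toD PiDX_emb mulrK//.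
by rewrite unitrX// (Pi_unit S).
Qed.

Lemma PiU_toD_inv j x : exists y : units E,
  ((PiU ^+ j)^-1 * toD x * PiU ^+ j)%g = toD y.
Proof.
have [y yx yE] := PiU_toD (n' * j) x; have [z zy zE] := PiU_toD j y.
exists y; rewrite (_ : x = z) -?zE ?mulgA ?mulVg ?mul1g ?mulgKV//.
apply: uval_inj; rewrite zy yx -iterD -mulSn mulnC.
by elim: j {yx yE zy zE} => // j IH; rewrite mulSn iterD -IH (cs_phi_n S).
Qed.

Lemma UD_norm1 m g : (0 < m)%N -> U m g -> N (uval g) = 1.
Proof.
move=> m0 /(UD_dnorm S) gm; rewrite -(dnorm1 S); apply: dnorm_eq_dom.
by rewrite dnorm1; apply: le_lt_trans gm _; exact: cX_lt1.
Qed.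

Lemma UD_subgroup m : (0 < m)%N -> subgroup (U m).
Proof.
move=> m0; split.
- by apply/(UD_dnorm S); rewrite uval1 subrr dnorm0 ltW ?cX_gt0.
- move=> g h gm hm; have h1 := UD_norm1 m0 hm; apply/(UD_dnorm S).
  have -> : uval (g * h)%g - 1 = (uval g - 1) * uval h + (uval h - 1).
    by rewrite uvalM mulrBl mul1r addrA subrK.
  apply: dnormD_le; last exact/(UD_dnorm S).
  by rewrite dnormM h1 mulr1; exact/(UD_dnorm S).
move=> g gm; have g1 := UD_norm1 m0 gm; apply/(UD_dnorm S).
have -> : uval (g^-1)%g - 1 = - ((uval g)^-1 * (uval g - 1)).
  by rewrite uvalV mulrBr mulVr ?uvalP// mulr1 opprB.
rewrite dnormN dnormM dnormV ?dnorm_unit_neq0// g1 invr1 mul1r.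
exact/(UD_dnorm S).
Qed.

Lemma UD_conj m g u : U m u -> U m (g * u * g^-1)%g.
Proof.
move=> /(UD_dnorm S) um; apply/(UD_dnorm S).
have -> : uval (g * u * g^-1)%g - 1 = uval g * (uval u - 1) * (uval g)^-1.
  by rewrite !uvalM uvalV mulrBr mulr1 mulrBl mulrV ?uvalP.
by rewrite dnorm_conj.
Qed.

Lemma UD_le i j : (i <= j)%N -> U j `<=` U i.
Proof.
move=> ij g /(UD_dnorm S) gj; apply/(UD_dnorm S); exact: dnorm_le_cX gj.
Qed.

Definition Jset m : set (units D) := setmul (Eunits pi) (U m).

Lemma JsetI m x u : U m u -> Jset m (toD x * u)%g.
Proof. by move=> um; exists (toD x); [exists x|exists u]. Qed.

Lemma JsetP m g : Jset m g -> exists x u, U m u /\ g = (toD x * u)%g.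
Proof. by move=> [_ [x _ <-] [u um <-]]; exists x, u. Qed.

Lemma Jset_toD m x : (0 < m)%N -> Jset m (toD x).
Proof. by move=> m0; rewrite -[toD x]mulg1; apply: JsetI; have [] := UD_subgroup m0. Qed.

Lemma UD_Jset m : U m `<=` Jset m.
Proof. by move=> u um; rewrite -[u]mul1g -toD1; exact: JsetI. Qed.

Lemma Jset_subgroup m : (0 < m)%N -> subgroup (Jset m).
Proof.
move=> m0; have [U1 UM UV] := UD_subgroup m0; split.
- exact: UD_Jset.
- move=> _ _ /JsetP[x [u [um ->]]] /JsetP[y [v [vm ->]]].
  have -> : (toD x * u * (toD y * v) =
    toD (x * y) * ((toD y)^-1 * u * (toD y)^-1^-1 * v))%g.
    by rewrite toDM invgK !mulgA mulgK.
  by apply: JsetI; apply: UM => //; exact: UD_conj.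
move=> _ /JsetP[x [u [um ->]]].
have -> : ((toD x * u)^-1 = toD x^-1 * (toD x * u^-1 * (toD x)^-1))%g.
  by rewrite invMg toDV !mulgA mulVg mul1g.
by apply: JsetI; apply: UD_conj; exact: UV.
Qed.

Lemma Jset_le i j : (i <= j)%N -> Jset j `<=` Jset i.
Proof. by move=> ij _ /JsetP[x [u [um ->]]]; apply: JsetI; exact: UD_le um. Qed.

Lemma Jset_conjPi m j g : Jset m g -> Jset m (PiU ^+ j * g * (PiU ^+ j)^-1)%g.
Proof.
move=> /JsetP[x [u [um ->]]]; have [y _ yE] := PiU_toD j x.
have -> : (PiU ^+ j * (toD x * u) * (PiU ^+ j)^-1 =
   toD y * (PiU ^+ j * u * (PiU ^+ j)^-1))%g.
  by rewrite -yE !mulgA mulgKV.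
by apply: JsetI; exact: UD_conj.
Qed.

Lemma Jset_conjPiV m j g : Jset m g -> Jset m ((PiU ^+ j)^-1 * g * PiU ^+ j)%g.
Proof.
move=> /JsetP[x [u [um ->]]]; have [y yE] := PiU_toD_inv j x.
have -> : ((PiU ^+ j)^-1 * (toD x * u) * PiU ^+ j =
   toD y * ((PiU ^+ j)^-1 * u * (PiU ^+ j)^-1^-1))%g.
  by rewrite -yE invgK !mulgA mulgK.
by apply: JsetI; exact: UD_conj.
Qed.

Lemma UD_pr m g : (0 < m)%N -> U m g ->
  vE (pr (uval g) - 1) <= c ^+ m /\ vE (pr (uval g)) = 1.
Proof.
move=> m0 /(UD_dnorm S) gm.
have p1 : vE (pr (uval g) - 1) <= c ^+ m.
  by apply: le_trans gm; rewrite -[X in _ - X](pr1 S) -prB; exact: pr_dnorm.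
split=> //; rewrite -(nabs1 vE); apply: nabs_eq_dom.
by rewrite nabs1; apply: le_lt_trans p1 _; exact: cX_lt1.
Qed.

Lemma Jset_pr m g : (0 < m)%N -> Jset m g ->
  pr (uval g) != 0 /\ N (uval g - emb (pr (uval g))) <= vE (pr (uval g)) * c ^+ m.
Proof.
move=> m0 /JsetP[x [u [um ->]]]; have [p1 pn] := UD_pr m0 um.
rewrite uvalM uval_toD pr_embl; split.
  by rewrite mulf_neq0 ?units_neq0// -(nabs_eq0 vE) pn oner_eq0.
rewrite (rmorphM emb) -mulrBr dnorm_embl nabsM pn mulr1 ler_pM2l ?nabs_gt0 ?units_neq0//.
have -> : uval u - emb (pr (uval u)) = (uval u - 1) - emb (pr (uval u) - 1).
  by rewrite rmorphB rmorph1 opprB addrA subrK.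
apply: dnormB_le; last by rewrite dnorm_emb.
exact/(UD_dnorm S).
Qed.

Lemma UD_decomp (g : units D) : exists x j u,
  [/\ (j < n)%N, U 1 u & g = (toD x * PiU ^+ j * u)%g].
Proof.
have [a [j [y [a0 jn y1 gE]]]] := dnorm_decomp S (dnorm_unit_neq0 g).
have au : a \is a GRing.unit by rewrite unitfE.
have [yu _] := onePlus_unit y1.
exists (Units au), j, (Units yu); split=> //.
  apply/(UD_dnorm S); rewrite /= addrC addKr.
  apply/sy_eq0; first by rewrite expr0 ltW.
  apply/(cs_rd0 S); first by apply: lead_le1; rewrite expr0 ltW.
  rewrite /lead mod0n div0n expr0 divr1.
  have -> : inord 0 = ord0 :> 'I_n by apply: val_inj; rewrite /= inordK.
  exact: le_lt_trans (pr_dnorm S y) y1.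
by apply: uval_inj; rewrite !uvalM uvalX.
Qed.

(** In degrees divisible by n the symbol is that of the projection to E, so dividing by pr g gains
    one degree. *)
Lemma UD_strip i g : (0 < i)%N -> (n %| i)%N -> U i g ->
  exists x h, U i.+1 h /\ g = (toD x * h)%g.
Proof.
move=> i0 ni gi; have [p1 pn] := UD_pr i0 gi.
have a0 : pr (uval g) != 0 by rewrite -(nabs_eq0 vE) pn oner_eq0.
have au : pr (uval g) \is a GRing.unit by rewrite unitfE.
exists (Units au), ((toD (Units au))^-1 * g)%g; split; last by rewrite mulKVg.
apply/(UD_dnorm S); rewrite -toDV uvalM uval_toD uvalV /=.
have -> : emb (pr (uval g))^-1 * uval g - 1 =
    emb (pr (uval g))^-1 * (uval g - emb (pr (uval g))).
  by rewrite mulrBr -rmorphM mulVf// rmorph1.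
rewrite dnorm_embl nabsV pn invr1 mul1r.
have gN : N (uval g - 1) <= c ^+ i by exact/(UD_dnorm S).
have -> : uval g - emb (pr (uval g)) = (uval g - 1) - emb (pr (uval g - 1)).
  by rewrite prB pr1 rmorphB rmorph1 opprB addrA subrK.
apply/sy_eq0; last by rewrite sy_subpr// ni.
by apply: dnormB_le => //; exact: dnorm_pr.
Qed.

Lemma UD_climb (P : units D -> Prop) M :
    (forall x g, P g -> P (toD x * g)%g) ->
    (forall i g, (0 < i < M)%N -> ~~ (n %| i)%N -> P g -> U i g -> U i.+1 g) ->
  forall g, P g -> U 1 g -> Jset M g.
Proof.
move=> PE step g Pg g1.
suff H i : (0 < i <= M)%N -> exists x, U i (toD x * g)%g.
  have [|M0] := posnP M; last first.
    have [|x xg] := H M; first by rewrite M0 /=.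
    have -> : g = (toD x^-1 * (toD x * g))%g by rewrite toDV mulKg.
    exact: JsetI.
  move=> M0; rewrite M0; apply: UD_Jset; exact: UD_le g1.
elim: i => // -[_ _|i IH iM]; first by exists 1%g; rewrite toD1 mul1g.
have [|x xg] := IH; first by case/andP: iM => _ /ltnW.
have [ni|ni] := boolP (n %| i.+1)%N; last first.
  by exists x; apply: step => //; exact: PE.
have [y [h [hi hE]]] := UD_strip (ltn0Sn i) ni xg.
by exists (y^-1 * x)%g; rewrite toDM -mulgA hE toDV mulKg.
Qed.

Lemma UD_symbol_step i g : N (uval g - 1) <= c ^+ i -> sy i (uval g - 1) = 0 -> U i.+1 g.
Proof. by move=> gi s0; apply/(UD_dnorm S)/(sy_eq0 gi). Qed.

Lemma sy0_UD1 m g : (0 < m)%N -> U m g -> sy 0 (uval g) = 1.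
Proof.
move=> m0 /(UD_le m0)/(UD_dnorm S) g1.
have N1 : N (uval g - 1) <= c ^+ 0 by apply: dnorm_le_cX g1.
rewrite -(subrK 1 (uval g)) syD ?dnorm1//.
by rewrite ((sy_eq0 N1).2 g1) add0r sy0_1.
Qed.

(** With y = g - 1 one has g z g^-1 - z = (y z - z y) g^-1, and the last factor has symbol 1 in
    degree 0. *)
Lemma conj_symbol i j g z : (0 < i)%N -> U i g -> N z <= c ^+ j ->
  exists e, [/\ uval g * z * (uval g)^-1 = z + e, N e <= c ^+ (i + j)
    & sy (i + j) e = sy i (uval g - 1) * sy j z ^+ (q ^ i)
                     - sy j z * sy i (uval g - 1) ^+ (q ^ j)].
Proof.
move=> i0 gi zj; have gN : N (uval g - 1) <= c ^+ i by exact/(UD_dnorm S).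
have [_ _ UV] := UD_subgroup i0.
have gVN : N (uval g)^-1 <= c ^+ 0.
  by rewrite expr0 -uvalV (UD_norm1 i0)//; exact: UV.
pose y := uval g - 1.
exists ((y * z - z * y) * (uval g)^-1).
have yz : N (y * z) <= c ^+ (i + j) by exact: dnormM_cX.
have zy : N (z * y) <= c ^+ (i + j) by rewrite addnC; exact: dnormM_cX.
split.
- have -> : y * z - z * y = uval g * z - z * uval g.
    by rewrite mulrBl mulrBr mul1r mulr1 opprB addrA subrK.
  by rewrite mulrBl mulrK ?uvalP// addrC subrK.
- by rewrite -[(i + j)%N]addn0; apply: dnormM_cX => //; exact: dnormB_le.
rewrite -[(i + j)%N]addn0 (syM _ gVN); last exact: dnormB_le.
rewrite -uvalV (sy0_UD1 i0) ?expr1n ?mulr1; last exact: UV.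
by rewrite ?addn0 syB// (syM gN zj) [(i + j)%N]addnC (syM zj gN).
Qed.

(** If g has symbol Y in degree i, its conjugate of x has C' part with symbol Y (x^(q^i) - x) there;
    membership in E^x U_D^M kills it, and regularity gives Y = 0. *)
Lemma fixed_coset1 M (x : units E) g : (0 < M)%N -> vE (uval x) <= 1 ->
    (forall i, ~~ (n %| i)%N -> rd (uval x) ^+ (q ^ i) != rd (uval x)) ->
    U 1 g -> Jset M (g * toD x * g^-1)%g ->
  Jset M g.
Proof.
move=> M0 x1 xreg g1 gx; have [J1 JM JV] := Jset_subgroup M0.
apply: (UD_climb (P := fun g => Jset M (g * toD x * g^-1)%g)) gx g1 => {g}.
  move=> y g gx; have -> : (toD y * g * toD x * (toD y * g)^-1 =
    toD y * (g * toD x * g^-1) * (toD y)^-1)%g by rewrite invMg !mulgA.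
  have yJ := Jset_toD y M0.
  exact: JM _ _ (JM _ _ yJ gx) (JV _ yJ).
move=> i g /andP[i0 iM] ni gx gi; apply: UD_symbol_step; first exact/(UD_dnorm S).
have xN : N (emb (uval x)) <= c ^+ 0 by rewrite dnorm_emb expr0.
have [e [eE eN se]] := conj_symbol i0 gi xN.
rewrite addn0 in eN se.
have [_] := Jset_pr M0 gx.
rewrite !uvalM uvalV uval_toD eE.
set d := emb _ + e => dJ.
have d1 : vE (pr d) <= 1.
  rewrite /d prD pr_emb; apply: nabsD_le => //.
  apply: le_trans (pr_dnorm S e) _; apply: le_trans eN _.
  by rewrite exprn_ile1// ltW.
have de : N (d - emb (pr d)) <= c ^+ i.+1.
  apply: (dnorm_le_cX iM); apply: le_trans dJ _.
  by rewrite ler_piMl// ltW// cX_gt0.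
have dE : d - emb (pr d) = e - emb (pr e).
  by rewrite /d prD pr_emb rmorphD opprD addrACA subrr add0r.
rewrite dE in de.
have eN' : N (e - emb (pr e)) <= c ^+ i by exact: dnorm_le_cX de.
have := (sy_eq0 eN').2 de.
rewrite sy_subpr// (negPf ni) se sy0_emb expn0 expr1 => /eqP.
rewrite [_ * _ ^+ _]mulrC -mulrBl mulf_eq0 subr_eq0 (negPf (xreg i ni)) /=.
by move/eqP.
Qed.

(** Writing g as e Pi^j u, the factor in E^x and the power of Pi normalise E^x U_D^M, so only u in
    U_D^1 has to be treated. *)
Lemma fixed_coset M (x : units E) g : (0 < M)%N -> vE (uval x) <= 1 ->
    (forall i, ~~ (n %| i)%N -> rd (uval x) ^+ (q ^ i) != rd (uval x)) ->
    Jset M (g * toD x * g^-1)%g ->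
  exists2 j, (j < n)%N & Jset M (g * (PiU ^+ j)^-1)%g.
Proof.
move=> M0 x1 xreg; have [y [j [u [jn u1 ->]]]] := UD_decomp g => gx.
have [J1 JM JV] := Jset_subgroup M0.
have yJ := Jset_toD y M0; exists j => //.
have : Jset M u.
  apply: (fixed_coset1 (x := x)) => //.
  have : Jset M (PiU ^+ j * (u * toD x * u^-1) * (PiU ^+ j)^-1)%g.
    have := JM _ _ (JV _ yJ) (JM _ _ gx yJ).
    by rewrite !invMg !mulgA mulVg mul1g mulgKV.
  by move=> /(Jset_conjPiV j); rewrite !mulgA mulVg mul1g mulgKV.
move=> /(Jset_conjPi j) uJ.
have -> : (toD y * PiU ^+ j * u * (PiU ^+ j)^-1 =
  toD y * (PiU ^+ j * u * (PiU ^+ j)^-1))%g by rewrite !mulgA.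
exact: JM.
Qed.

(** Representatives are truncated expansions in Pi with digits lifting elements of k, times Pi^j
    with j < n. *)
Lemma Jset_cover m : (0 < m)%N -> exists (X : finType) (r : X -> units D),
  forall g, exists x, Jset m (g * (r x)^-1)%g.
Proof.
move=> m0; have /choice [s sP] : forall b : k, exists a, vE a <= 1 /\ rd a = b.
  by move=> b; have [a a1 ab] := cs_rd_surj S b; exists a.
pose A (f : {ffun 'I_m -> k}) := \sum_(i < m) emb (s (f i)) * Pi ^+ i.
have approx d : N d <= 1 -> exists f, N (d - A f) <= c ^+ m.
  move=> d1; have : exists f : nat -> k,
      N (d - \sum_(i < m) emb (s (f i)) * Pi ^+ i) <= c ^+ m.
    elim: (m) => [|j [f fj]]; first by exists (fun=> 0); rewrite big_ord0 subr0.
    pose e := d - \sum_(i < j) emb (s (f i)) * Pi ^+ i.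
    exists (fun i => if (i < j)%N then f i else sy j e).
    have [s1 rs] := sP (sy j e).
    have mN : N (emb (s (sy j e)) * Pi ^+ j) <= c ^+ j.
      by rewrite dnorm_monomial ler_piMl// ltW// cX_gt0.
    rewrite big_ord_recr /= ltnn opprD addrA.
    under eq_bigr do rewrite ltn_ord.
    apply/sy_eq0; first exact: dnormB_le.
    by rewrite syB// sy_monomial rs subrr.
  move=> [f fP]; exists [ffun i : 'I_m => f i]; rewrite /A.
  by under eq_bigr do rewrite ffunE.
pose u f : units D := insubd (1%g : units D) (A f).
exists ('I_n * {ffun 'I_m -> k} : finType)%type.
exists (fun x : 'I_n * {ffun 'I_m -> k} => u x.2 * PiU ^+ nat_of_ord x.1)%g => g.
have [x [j [v [jn v1 ->]]]] := UD_decomp g.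
pose v' := (PiU ^+ j * v * (PiU ^+ j)^-1)%g.
have v'1 : U 1 v' by exact: UD_conj.
have v'N := UD_norm1 (ltn0Sn 0) v'1.
have v'le : N (uval v') <= 1 by rewrite v'N.
have [f fP] := approx _ v'le.
have AN : N (A f) = 1.
  rewrite -v'N; apply: dnorm_eq_dom; rewrite -dnormN opprB.
  by apply: le_lt_trans fP _; rewrite v'N; exact: cX_lt1.
have Au : A f \is a GRing.unit.
  apply: (dunit S); apply: contra_eq_neq AN => ->.
  by rewrite dnorm0 eq_sym oner_eq0.
have uE : uval (u f) = A f by rewrite /u uval_insubd.
exists (Ordinal jn, f) => /=.
have -> : (toD x * PiU ^+ j * v * (u f * PiU ^+ j)^-1 = toD x * (v' * (u f)^-1))%g.
  by rewrite invMg /v' !mulgA.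
apply: JsetI; apply/(UD_dnorm S); rewrite uvalM uvalV uE.
have -> : uval v' / A f - 1 = (uval v' - A f) / A f by rewrite mulrBl divrr.
rewrite dnormM dnormV ?AN ?invr1 ?mulr1//.
by apply: contraTneq Au => ->; rewrite unitr0.
Qed.

End UnitGroups.

(** * The function Theta and its stabiliser *)

Section ThetaCharacter.
Variables (R : realType) (F : fieldType) (E : fieldExtType F)
    (vE : nonarch_abs R E) (phi : {rmorphism E -> E}) (n' : nat) (w : F)
    (D : unitRingType) (pi : {rmorphism twpoly phi -> D})
    (k : finFieldType) (q : nat) (rd : E -> k) (c : R).
Hypothesis S : cyclic_setup vE n' w pi q rd c.

Local Notation n := n'.+1.
Local Notation wE := (w%:A : E).
Local Notation emb := (embD pi).
Local Notation Pi := (PiD pi).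
Local Notation N := (dnorm S).
Local Notation pr := (pr S).
Local Notation sy := (sy S).
Local Notation toD := (units_map (embD pi)).
Local Notation U := (UD vE n pi).
Local Notation J := (Jset vE n' pi).
Local Notation PiU := (PiU S).

Let c0 := cs_c0 S.
Let c1 := cs_c1 S.

(** Here [t] is the level minus 1. [th_prim] is primitivity in the form used: some x in U_E^t has
    theta(phi^i x) different from theta(x) whenever n does not divide i. *)
Variables (K : fieldType) (theta : units E -> K) (t : nat).
Hypotheses (t0 : (0 < t)%N)
  (thM : forall x y, theta (x * y)%g = theta x * theta y)
  (thN0 : forall x, theta x != 0)
  (th_level : forall x, vE (uval x - 1) <= c ^+ (n * t.+1) -> theta x = 1)
  (th_prim : forall i, ~~ (n %| i)%N -> exists x y : units E,
    [/\ vE (uval x - 1) <= c ^+ (n * t), uval y = iter i phi (uval x)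
      & theta y != theta x]).

Local Notation h := (n * t)%N.

(** Outside the units, that is at 0, the value is theta 1. *)
Definition thE (a : E) : K := theta (insubd (1%g : units E) a).
Definition Theta (g : units D) : K := thE (pr (uval g)).

Lemma thE_units x : thE (uval x) = theta x.
Proof. by rewrite /thE; congr theta; apply: uval_inj; rewrite uval_insubd ?uvalP. Qed.

Let thEP a : a != 0 -> exists2 x, uval x = a & thE a = theta x.
Proof.
by move=> a0; exists (insubd (1%g : units E) a); rewrite ?uval_insubd// unitfE.
Qed.

Lemma theta1 : theta 1%g = 1.
Proof. by apply: (mulfI (thN0 1%g)); rewrite -thM mulg1 mulr1. Qed.

Lemma thE1 : thE 1 = 1.
Proof. by rewrite -[1](uval1 E) thE_units theta1. Qed.

Lemma thEM a b : a != 0 -> b != 0 -> thE (a * b) = thE a * thE b.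
Proof.
move=> /thEP[x <- ->] /thEP[y <- ->].
by rewrite -uvalM thE_units thM.
Qed.

Lemma thE_neq0 a : thE a != 0.
Proof. exact: thN0. Qed.

Lemma thE_congr a b : b != 0 -> vE (a - b) <= vE b * c ^+ (n * t.+1) -> thE a = thE b.
Proof.
move=> b0 ab; have vb := nabs_gt0 vE b0.
have lt : vE (a - b) < vE b.
  by apply: le_lt_trans ab _; rewrite gtr_pMr// (cX_lt1 S)// muln_gt0.
have a0 : a != 0.
  by rewrite -(nabs_eq0 vE) (nabs_eq_dom lt) nabs_eq0.
have ab0 : a / b != 0 by rewrite mulf_neq0// invr_eq0.
rewrite -[a in LHS](divfK b0) thEM//.
have [x xE ->] := thEP ab0; rewrite th_level ?mul1r// xE.
have -> : a / b - 1 = (a - b) / b by rewrite mulrBl mulfV.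
by rewrite nabsM nabsV ler_pdivrMr// mulrC.
Qed.

Lemma nabs_onePlus (x : E) : vE x < 1 -> vE (1 + x) = 1.
Proof.
by move=> x1; rewrite -(nabs1 vE); apply: nabs_eq_dom; rewrite addrC addKr nabs1.
Qed.

Lemma onePlus_neq0 (x : E) : vE x < 1 -> 1 + x != 0.
Proof. by move=> x1; rewrite -(nabs_eq0 vE) nabs_onePlus// oner_eq0. Qed.

Lemma thE_congr1 a b : vE b = 1 -> vE (a - b) <= c ^+ (n * t.+1) -> thE a = thE b.
Proof.
move=> b1 ab; apply: thE_congr; last by rewrite b1 mul1r.
by rewrite -(nabs_eq0 vE) b1 oner_eq0.
Qed.

(** The additive character that theta induces on U_E^t / U_E^(t+1), evaluated on a chosen lift;
    [psi_rd] shows independence of the lift. *)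
Definition psi (b : k) : K :=
  thE (1 + wE ^+ t * xget 0 [set a | vE a <= 1 /\ rd a = b]).

Let nabs_wt a : vE (wE ^+ t * a) = c ^+ h * vE a.
Proof. by rewrite nabsM (nabs_wX S). Qed.

Let h_gt0 : (0 < h)%N. Proof. by rewrite muln_gt0. Qed.

Let wt_lt1 a : vE a <= 1 -> vE (wE ^+ t * a) < 1.
Proof.
move=> a1; rewrite nabs_wt; apply: le_lt_trans (cX_lt1 S h_gt0).
by rewrite ler_piMr// ltW// (cX_gt0 S).
Qed.

Lemma psi_rd a : vE a <= 1 -> thE (1 + wE ^+ t * a) = psi (rd a).
Proof.
move=> a1; rewrite /psi; case: xgetP => [b _ [b1 /esym/(rd_eq S a1 b1) ab]|]; last first.
  by move=> /(_ a) [].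
apply: thE_congr1; first by rewrite nabs_onePlus// wt_lt1.
have -> : 1 + wE ^+ t * a - (1 + wE ^+ t * b) = wE ^+ t * (a - b) by ring.
rewrite nabs_wt mulnS addnC exprD ler_pM2l ?(cX_gt0 S)// (cs_cn S).
exact: (nabs_lt1 (cs_unif S)).
Qed.

Lemma psiD a b : psi (a + b) = psi a * psi b.
Proof.
have [x x1 <-] := cs_rd_surj S a; have [y y1 <-] := cs_rd_surj S b.
rewrite -(cs_rdD S)// -!psi_rd ?nabsD_le// -thEM ?onePlus_neq0 ?wt_lt1//.
apply/esym/thE_congr1; first by rewrite nabs_onePlus// wt_lt1// nabsD_le.
have -> : (1 + wE ^+ t * x) * (1 + wE ^+ t * y) - (1 + wE ^+ t * (x + y)) =
   (wE ^+ t * x) * (wE ^+ t * y) by ring.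
rewrite nabsM !nabs_wt mulrACA -exprD.
apply: (@le_trans _ _ (c ^+ (h + h))); last by rewrite ler_iXn2l//; nia.
by rewrite ler_piMr ?mulr_ile1 ?nabs_ge0// ltW// (cX_gt0 S).
Qed.

Lemma psi_prim i : ~~ (n %| i)%N -> exists b, psi (b ^+ (q ^ i)) != psi b.
Proof.
move=> /th_prim[x [y [x1 yE yx]]].
pose a := (uval x - 1) / wE ^+ t.
have wt0 : wE ^+ t != 0 by rewrite expf_neq0// (cs_w0 S).
have a1 : vE a <= 1.
  by rewrite nabsM nabsV (nabs_wX S) ler_pdivrMr ?mul1r ?(cX_gt0 S).
have xE : uval x = 1 + wE ^+ t * a by rewrite mulrCA mulfV// mulr1 addrC subrK.
exists (rd a); rewrite -(rd_phi_iter S)// -!psi_rd ?(nabs_phi_iter S)//.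
rewrite -xE thE_units.
have -> : 1 + wE ^+ t * iter i phi a = uval y; last by rewrite thE_units.
rewrite yE xE; elim: i {yE yx} => //= i <-.
by rewrite rmorphD rmorphM rmorph1 rmorphXn /= (cs_phi_w S).
Qed.

Lemma psi_symbol d : N d <= c ^+ h -> thE (1 + pr d) = psi (sy h d).
Proof.
move=> dh; rewrite (sy_pr S)//; last exact: dvdn_mulr.
rewrite mulKn// -psi_rd.
  by rewrite mulrCA mulfV ?mulr1// expf_neq0// (cs_w0 S).
rewrite nabsM nabsV (nabs_wX S) ler_pdivrMr ?mul1r ?(cX_gt0 S)//.
exact: le_trans (pr_dnorm S d) dh.
Qed.

Lemma Theta_toD x : Theta (toD x) = theta x.
Proof. by rewrite /Theta uval_toD pr_emb thE_units. Qed.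

Lemma Theta_toDl x g : pr (uval g) != 0 -> Theta (toD x * g)%g = theta x * Theta g.
Proof.
by move=> g0; rewrite /Theta uvalM uval_toD pr_embl thEM ?units_neq0// thE_units.
Qed.

Lemma Theta_conj_toD x g : Theta (toD x * g * (toD x)^-1)%g = Theta g.
Proof.
rewrite /Theta -toDV !uvalM !uval_toD uvalV pr_embr pr_embl mulrAC mulfV ?mul1r//.
exact: units_neq0.
Qed.

Lemma pr_mul d d' :
  pr (d * d') = pr d * pr d' + pr ((d - emb (pr d)) * (d' - emb (pr d'))).
Proof.
rewrite mulrBl !mulrBr !prB pr_embl !pr_embr pr_emb.
by ring.
Qed.

Lemma dnorm_subpr m g : (0 < m)%N -> U m g -> N (uval g - emb (pr (uval g))) <= c ^+ m.
Proof.
move=> m0 gm; have [_] := Jset_pr S m0 (UD_Jset gm).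
by have [_ ->] := UD_pr S m0 gm; rewrite mul1r.
Qed.

(** By [pr_mul] the error is the projection of a product of C' parts. It has depth i + j > h, hence
    lies in P_E^(t+1) by rounding. *)
Lemma Theta_mul_UD i j g g' : (0 < i)%N -> (0 < j)%N -> (h < i + j)%N ->
  U i g -> U j g' -> Theta (g * g')%g = Theta g * Theta g'.
Proof.
move=> i0 j0 hij gi gj.
have [_ p1] := UD_pr S i0 gi; have [_ p1'] := UD_pr S j0 gj.
have nz (a : E) : vE a = 1 -> a != 0.
  by move=> a1; rewrite -(nabs_eq0 vE) a1 oner_eq0.
rewrite /Theta uvalM pr_mul -thEM ?nz//; apply: thE_congr1.
  by rewrite nabsM p1 p1' mulr1.
rewrite addrC addKr; apply: (pr_round (S := S) _ hij).
by apply: dnormM_cX; exact: dnorm_subpr.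
Qed.

Lemma Theta_mul s g g' : (0 < s)%N -> (h < s + s)%N -> J s g -> J s g' ->
  Theta (g * g')%g = Theta g * Theta g'.
Proof.
move=> s0 hs /JsetP[x [u [us ->]]] /JsetP[y [v [vs ->]]].
have nz z : U s z -> pr (uval z) != 0.
  by move=> zs; have [_ z1] := UD_pr S s0 zs; rewrite -(nabs_eq0 vE) z1 oner_eq0.
have u's : U s ((toD y)^-1 * u * (toD y)^-1^-1)%g by exact: (UD_conj S).
have -> : (toD x * u * (toD y * v) =
    toD (x * y) * ((toD y)^-1 * u * (toD y)^-1^-1 * v))%g.
  by rewrite toDM invgK !mulgA mulgK.
have [_ UM _] := UD_subgroup S s0.
rewrite !Theta_toDl ?nz//; last exact: UM.
rewrite (Theta_mul_UD s0 s0 hs u's vs) -toDV Theta_conj_toD thM.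
by rewrite mulrACA.
Qed.

Lemma Theta_conj_UD i j u g : (0 < i)%N -> (0 < j)%N -> (h < i + j)%N ->
  U i u -> U j g -> Theta (u * g * u^-1)%g = Theta g.
Proof.
move=> i0 j0 hij ui gj; have [_ p1] := UD_pr S j0 gj.
have gN : N (uval g - 1) <= c ^+ j by exact/(UD_dnorm S).
have [e [eE eN _]] := conj_symbol i0 ui gN.
apply: thE_congr1 => //.
have -> : uval (u * g * u^-1)%g = uval g + e.
  rewrite !uvalM uvalV -[uval g in LHS](subrK 1) mulrDr mulrDl eE mulr1 divrr ?uvalP//.
  by rewrite addrAC subrK.
rewrite prD addrC addKr; exact: (pr_round (S := S) eN).
Qed.

Lemma Theta_UD m g : (n * t.+1 <= m)%N -> U m g -> Theta g = 1.
Proof.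
move=> tm gm; have m0 : (0 < m)%N by apply: leq_trans tm; rewrite muln_gt0.
have [p1 _] := UD_pr S m0 gm.
rewrite /Theta -thE1; apply: thE_congr1; first exact: nabs1.
by apply: le_trans p1 _; rewrite ler_iXn2l.
Qed.

Lemma Theta_character s : (0 < s)%N -> (h < s + s)%N ->
  is_character (D_nbhs vE n pi) (J s) Theta.
Proof.
move=> s0 hs; split.
- by move=> g _; exact: thE_neq0.
- by move=> g g'; exact: Theta_mul.
exists (n * t.+1)%N => g _; apply: Theta_UD; exact: leqnSn.
Qed.

Let onePlusU (z : D) : N z < 1 -> exists x : units D, uval x = 1 + z.
Proof. by move=> z1; have [u _] := onePlus_unit z1; exists (Units u). Qed.

(* g conjugates 1 + b Pi^h to an element with symbol b^(q^j) in degree h,     *)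
(* where j is the valuation of g, so primitivity forces j = 0; then testing   *)
(* on 1 + b Pi^(h - i) kills the symbols of g in degrees i prime to n.        *)
Lemma Theta_stabiliser s0 M g : (0 < s0 <= h)%N -> (0 < M)%N ->
    (forall i, (0 < i < M)%N -> ~~ (n %| i)%N -> (i + s0 <= h)%N) ->
    (forall x, U s0 x -> Theta (g * x * g^-1)%g = Theta x) ->
  J M g.
Proof.
move=> /andP[s00 s0h] M0 iM.
pose P g := forall x, U s0 x -> Theta (g * x * g^-1)%g = Theta x.
have PtoD x g' : P g' -> P (toD x * g')%g.
  move=> Pg z zs; rewrite -(Pg z zs) -[RHS](Theta_conj_toD x).
  by congr Theta; rewrite invMg !mulgA.
have [J1 JM JV] := Jset_subgroup S M0.
have [x [j [u [jn u1 ->]]]] := UD_decomp S g => Pg.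
have hE a : emb (wE ^+ t * a) = emb a * Pi ^+ h.
  by rewrite exprM (PiDX_n (cs_quot S)) -rmorphXn -rmorphM mulrC.
(* Test on 1 + w^t a: conjugation by g changes the residue b of a into b^(q^j) up to depth h + 1, so
   psi would be fixed by that power of the Frobenius. *)
have j0 : (n %| j)%N.
  apply/negPn/negP => /psi_prim[b /eqP]; apply.
  have [a a1 <-] := cs_rd_surj S b.
  pose z := emb (wE ^+ t * a).
  have zN : N z <= c ^+ h.
    by rewrite /z hE dnorm_monomial ler_piMl// ltW// (cX_gt0 S).
  have [y yE] := onePlusU (le_lt_trans zN (cX_lt1 S h_gt0)).
  have yU : U s0 y.
    by apply/(UD_dnorm S); rewrite yE addrC addKr; exact: dnorm_le_cX zN.
  have := Pg y yU.
  have [e [eE eN _]] := conj_symbol (ltn0Sn 0) u1 zN.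
  have -> : (toD x * PiU ^+ j * u * y * (toD x * PiU ^+ j * u)^-1 =
    toD x * (PiU ^+ j * (u * y * u^-1) * (PiU ^+ j)^-1) * (toD x)^-1)%g.
    by rewrite !invMg !mulgA.
  rewrite Theta_conj_toD /Theta !uvalM !uvalV uvalX yE.
  have Pju : Pi ^+ j \is a GRing.unit by rewrite unitrX// (Pi_unit S).
  pose e' := Pi ^+ j * e / Pi ^+ j.
  have -> : Pi ^+ j * (uval u * (1 + z) / uval u) / Pi ^+ j =
      1 + emb (iter j phi (wE ^+ t * a)) + e'.
    rewrite mulrDr mulr1 mulrDl divrr ?uvalP// eE !mulrDr !mulrDl mulr1 divrr//.
    by rewrite /z PiDX_emb mulrK// addrA.
  have e'N : N e' <= c ^+ h.+1.
    by have := dnorm_conj S (PiU ^+ j)%g e; rewrite uvalX -/e' => ->; rewrite -add1n.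
  rewrite prD !prD pr1 !pr_emb.
  have -> : iter j phi (wE ^+ t * a) = wE ^+ t * iter j phi a.
    by elim: (j) => //= l ->; rewrite rmorphM rmorphXn /= (cs_phi_w S).
  have pa1 : vE (iter j phi a) <= 1 by rewrite (nabs_phi_iter S).
  rewrite (@thE_congr1 _ (1 + wE ^+ t * iter j phi a)).
  - by rewrite !psi_rd// (rd_phi_iter S).
  - by rewrite nabs_onePlus// wt_lt1.
  by rewrite addrC addKr; exact: (pr_round (S := S) e'N).
have {j0} j0 : j = 0%N.
  by apply/eqP; move: j0; rewrite /dvdn modn_small.
rewrite {}j0 expg0 mulg1 in Pg *.
have xJ : J M (toD x) by exact: (Jset_toD S).
apply: JM => //.
have {Pg} Pu : P u.
  have -> : u = (toD x^-1 * (toD x * u))%g by rewrite toDV mulKg.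
  exact: PtoD.
apply: (UD_climb S PtoD) Pu u1 => i g' /andP[i0 iM'] ni Pg' gi.
have his : (i + s0 <= h)%N by apply: iM; rewrite ?i0.
have gN : N (uval g' - 1) <= c ^+ i by exact/(UD_dnorm S).
apply: (UD_symbol_step (S := S)) => //.
apply: contrapT => /eqP Y0; set Y := sy i _ in Y0.
have [b /eqP] := psi_prim ni; apply.
have ih : (i <= h)%N by apply: leq_trans his; exact: leq_addr.
pose s := (h - i)%N; have is' : (i + s = h)%N by rewrite subnKC.
have ns : ~~ (n %| s)%N.
  by apply: contra ni => ns; rewrite -(dvdn_addl i ns) is' dvdn_mulr.
(* This test symbol makes the commutator have symbol b^(q^i) - b in degree h: the power Y^(q^(i+s))
   equals Y because i + s = h is divisible by n. *)
have [a a1 aE] := sy_surj S s (b / Y ^+ (q ^ s)).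
set z := emb a * Pi ^+ s in aE.
have s0s : (s0 <= s)%N by rewrite leq_subRL.
have sgt0 : (0 < s)%N by exact: leq_trans s0s.
have zN : N z <= c ^+ s.
  by rewrite dnorm_monomial ler_piMl// ltW// (cX_gt0 S).
have [y yE] := onePlusU (le_lt_trans zN (cX_lt1 S sgt0)).
have yU : U s0 y.
  by apply/(UD_dnorm S); rewrite yE addrC addKr; exact: dnorm_le_cX zN.
have := Pg' y yU.
have [e [eE eN eS]] := conj_symbol i0 gi zN.
rewrite /Theta !uvalM uvalV yE mulrDr mulr1 mulrDl divrr ?uvalP// eE.
rewrite !prD pr1 (pr_monomial S _ ns) add0r addr0 thE1.
rewrite is' in eN eS; rewrite psi_symbol// eS aE -/Y.
have Yq : (b / Y ^+ (q ^ s)) ^+ (q ^ i) = b ^+ (q ^ i) / Y.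
  by rewrite exprMn exprVn -exprM -expnD addnC is' (expf_qn S).
rewrite Yq mulrCA mulfV// mulr1 divfK ?expf_neq0//.
move=> p1; rewrite -[b ^+ (q ^ i)](subrK b) psiD p1 mul1r//.
Qed.

End ThetaCharacter.

(** * The reduced norm *)

Lemma det_congr (R : realType) (K : fieldType) (v : nonarch_abs R K) m
    (A B : 'M[K]_m) (e : R) :
    0 <= e -> (forall i j, v (A i j) <= 1) -> (forall i j, v (B i j) <= 1) ->
    (forall i j, v (A i j - B i j) <= e) ->
  v (\det A - \det B) <= e.
Proof.
move=> e0 A1 B1 AB; rewrite /determinant -sumrB; apply: nabs_sum_le => // s _.
rewrite -mulrBr nabsM nabsX nabsN nabs1 expr1n mul1r.
suff [] : [/\ v (\prod_i A i (s i)) <= 1, v (\prod_i B i (s i)) <= 1 &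
    v (\prod_i A i (s i) - \prod_i B i (s i)) <= e] by [].
apply: (big_rec2 (fun x y => [/\ v x <= 1, v y <= 1 & v (x - y) <= e])).
  by rewrite nabs1 subrr nabs0.
move=> i x y _ [x1 y1 xy]; split.
- by rewrite nabsM mulr_ile1 ?nabs_ge0.
- by rewrite nabsM mulr_ile1 ?nabs_ge0.
have -> : A i (s i) * x - B i (s i) * y =
  A i (s i) * (x - y) + (A i (s i) - B i (s i)) * y by ring.
apply: nabsD_le; rewrite nabsM.
  by apply: le_trans xy; rewrite ler_piMl ?nabs_ge0.
by apply: le_trans (AB i (s i)); rewrite ler_piMr ?nabs_ge0.
Qed.

Section ReducedNorm.
Variables (R : realType) (F : fieldType) (E : fieldExtType F)
    (vE : nonarch_abs R E) (phi : {rmorphism E -> E}) (n' : nat) (w : F)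
    (D : unitRingType) (pi : {rmorphism twpoly phi -> D})
    (k : finFieldType) (q : nat) (rd : E -> k) (c : R).
Hypothesis S : cyclic_setup vE n' w pi q rd c.
Hypothesis phi_fix : forall a : E, phi a = a -> exists b : F, a = b%:A.

Local Notation n := n'.+1.
Local Notation emb := (embD pi).
Local Notation Pi := (PiD pi).
Local Notation N := (dnorm S).
Local Notation toD := (units_map (embD pi)).
Local Notation U := (UD vE n pi).
Local Notation coord := (coord (cs_quot S)).
Local Notation sy := (sy S).

Let mx := rmul_mx (cs_quot S).
Let mxM : forall g h : D, mx (g * h) = mx g *m mx h :=
  rmul_mxM (cs_quot S) (cs_phi_n S) (cs_phi_w S).
Let rmul_mxE : forall d g : D, coord (d * g) = coord d *m mx g :=
  rmul_mxE (cs_quot S) (cs_phi_n S) (cs_phi_w S).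
Let coord_monomial := coord_monomial (cs_quot S) (cs_phi_n S) (cs_phi_w S).

Let P : 'M[E]_n := \matrix_i coord (Pi ^+ i.+1).

Let coord_Pil d : coord (Pi * d) = map_mx phi (coord d) *m P.
Proof.
rewrite {1}(coordE (cs_quot S) d) mulr_sumr.
rewrite (coord_sum (cs_quot S) (cs_phi_n S) (cs_phi_w S)) mulmx_sum_row.
apply: eq_bigr => i _.
rewrite mulrA PiD_emb -mulrA -exprS (coordZ (cs_quot S) (cs_phi_n S) (cs_phi_w S)).
by rewrite rowK mxE.
Qed.

Let coord_surj (u : 'rV[E]_n) : exists d, coord d = u.
Proof.
exists (\sum_j emb (u 0 j) * Pi ^+ j).
exact: (coord_uniq (cs_quot S) (cs_phi_n S) (cs_phi_w S)).
Qed.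

Let det_P_neq0 : \det P != 0.
Proof.
rewrite -unitfE -[_ \is a _]/(P \in unitmx) -row_free_unit.
apply/inj_row_free => v vP.
have [d dE] := coord_surj (map_mx (iter n' phi) v).
have vE' : v = map_mx phi (coord d).
  by apply/rowP => i; rewrite dE !mxE -iterS (cs_phi_n S).
have d0 : d = 0.
  apply: (mulrI (Pi_unit S)); rewrite mulr0.
  by apply: (coord_inj0 (HD := cs_quot S)); rewrite coord_Pil -vE'.
by rewrite vE' d0 (coord0 (cs_quot S) (cs_phi_n S) (cs_phi_w S)) map_mx0.
Qed.

(* Left multiplication by Pi is semilinear and commutes with g.               *)
Lemma det_rmul_mx_fixed g : phi (\det (mx g)) = \det (mx g).
Proof.
have PA : P *m mx g = map_mx phi (mx g) *m P.
  apply/row_matrixP => i; rewrite !row_mul.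
  have [d dE] := coord_surj (delta_mx 0 i).
  have rE : delta_mx 0 i = map_mx phi (coord d) :> 'rV[E]_n.
    by rewrite dE map_delta_mx.
  have -> : row i P = coord (Pi * d) by rewrite coord_Pil -rE rowE.
  have -> : row i (map_mx phi (mx g)) = map_mx phi (coord (d * g)).
    by rewrite rowE rE -map_mxM rmul_mxE.
  by rewrite -coord_Pil -rmul_mxE mulrA.
have := congr1 determinant PA; rewrite !det_mulmx mulrC.
by move/(mulIf det_P_neq0) => detE; rewrite {2}detE det_map_mx.
Qed.

Lemma Nrd_det g : (Nrd n pi g)%:A = \det (mx g).
Proof.
have [b bE] := phi_fix (det_rmul_mx_fixed g).
rewrite /Nrd; case: xgetP => [t _ [A AE <-]|/(_ b)].
  congr determinant; apply/row_matrixP => i; rewrite rowK; apply/esym.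
  apply: (coord_uniq (cs_quot S) (cs_phi_n S) (cs_phi_w S)); rewrite AE.
  by apply: eq_bigr => j _; rewrite mxE.
case; exists (mx g) => // i; rewrite [LHS](coordE (cs_quot S)).
by apply: eq_bigr => j _; rewrite mxE.
Qed.

Let alg_inj : injective (fun a : F => a%:A : E).
Proof. exact: (fmorph_inj (in_alg E)). Qed.

Lemma NrdM g h : Nrd n pi (g * h) = Nrd n pi g * Nrd n pi h.
Proof.
apply: alg_inj; rewrite /= Nrd_det mxM det_mulmx -!Nrd_det.
by rewrite -(rmorphM (in_alg E)).
Qed.

Lemma Nrd1 : Nrd n pi 1 = 1.
Proof.
apply: alg_inj; rewrite /= Nrd_det /mx.
by rewrite (rmul_mx1 (cs_quot S) (cs_phi_n S) (cs_phi_w S)) det1 scale1r.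
Qed.

Lemma uval_Nrd_units (g : units D) : uval (Nrd_units n pi g) = Nrd n pi (uval g).
Proof.
apply: uval_insubd; rewrite unitfE; apply/eqP => g0.
have := oner_neq0 F; rewrite -Nrd1 -(divrr (uvalP g)) NrdM g0 mul0r.
by rewrite eqxx.
Qed.

Lemma Nrd_unitsM g h : Nrd_units n pi (g * h)%g = (Nrd_units n pi g * Nrd_units n pi h)%g.
Proof. by apply: uval_inj; rewrite uvalM !uval_Nrd_units NrdM. Qed.

Lemma Nrd_emb x : (Nrd n pi (emb x))%:A = \prod_(i < n) iter i phi x.
Proof.
rewrite Nrd_det.
have -> : mx (emb x) = diag_mx (\row_i iter i phi x).
  apply/row_matrixP => i; rewrite rowK PiDX_emb coord_monomial.
  rewrite divn_small// modn_small// expr0 mulr1 inord_val row_diag_mx mxE.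
  by [].
by rewrite det_diag; apply: eq_bigr => i _; rewrite mxE.
Qed.

(** The weights c^j on coordinates with j < n can cost up to n in depth, which accounts for the drop
    from m + 1 to m. The determinant is then close to that of the identity. *)
Lemma Nrd_UD m (g : units D) : U (n * m.+1)%N g ->
  vE ((Nrd n pi (uval g))%:A - 1) <= c ^+ (n * m).
Proof.
move=> /(UD_dnorm S) gN; rewrite Nrd_det -(det1 E n).
have cX i : 0 < c ^+ i by rewrite exprn_gt0// (cs_c0 S).
have mxd i j : vE (mx (uval g) i j - (1%:M : 'M[E]_n) i j) <= c ^+ (n * m).
  have -> : mx (uval g) i j - (1%:M : 'M[E]_n) i j = coord (Pi ^+ i * (uval g - 1)) 0 j.
    have -> : (1%:M : 'M[E]_n) i j = coord (Pi ^+ i) 0 j.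
      by rewrite -(rmul_mx1 (cs_quot S) (cs_phi_n S) (cs_phi_w S)) mxE mulr1.
    rewrite mulrBr mulr1 (coordB (cs_quot S) (cs_phi_n S) (cs_phi_w S)).
    by rewrite [RHS]mxE [X in _ = _ + X]mxE [in LHS]mxE.
  have := dnorm_coord S (Pi ^+ i * (uval g - 1)) j.
  rewrite dnorm_PiXl => le.
  rewrite -(ler_pM2r (cX j)); apply: le_trans le _.
  apply: (@le_trans _ _ (c ^+ (n * m.+1))).
    apply: le_trans gN; rewrite ler_piMl ?dnorm_ge0//.
    by rewrite exprn_ile1// ltW// ?(cs_c0 S)// (cs_c1 S).
  rewrite -exprD ler_iXn2l ?(cs_c0 S) ?(cs_c1 S)//.
  by rewrite mulnS addnC leq_add2r ltnW.
have e1 : c ^+ (n * m) <= 1 by rewrite exprn_ile1// ltW// ?(cs_c0 S)// (cs_c1 S).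
have id1 i j : vE ((1%:M : 'M[E]_n) i j) <= 1.
  by rewrite mxE; case: (i == j); rewrite ?nabs1 ?nabs0.
apply: det_congr => // [|i j]; first exact: ltW.
rewrite -(subrK ((1%:M : 'M[E]_n) i j) (mx (uval g) i j)); apply: nabsD_le => //.
exact: le_trans (mxd i j) e1.
Qed.

Lemma cs_q_gt1 : (1 < q)%N.
Proof.
have := finNzRing_gt1 k; rewrite (cs_card S).
by case: (q) => [|[|//]]; rewrite ?exp0n ?exp1n.
Qed.

(** For 0 < j < n the equation b^(q^j - 1) = 1 has at most q^j - 1 roots, fewer than the nonzero
    elements of k. *)
Lemma residue_moved i : ~~ (n %| i)%N -> exists b : k, b ^+ (q ^ i) != b.
Proof.
move=> ni; apply/existsP; rewrite -[[exists _, _]]negbK negb_exists; apply/negP.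
move=> /forallP/= fixi.
pose j := (i %% n)%N.
have j0 : (0 < j)%N by rewrite lt0n.
have jn : (j < n)%N by rewrite ltn_mod.
have bj (b : k) : b ^+ (q ^ j) = b.
  have := fixi b; rewrite negbK => /eqP; rewrite {1}(divn_eq i n) mulnC expnD exprM.
  by rewrite (expf_qn S).
have q1 := cs_q_gt1.
have qj : (1 < q ^ j)%N by rewrite -(exp1n j) ltn_exp2r.
have := @card_exp_root k (q ^ j).-1 1.
rewrite -ltnS prednK ?(ltnW qj)// qj => /(_ isT).
have -> : [set b : k | b ^+ (q ^ j).-1 == 1]%SET = [set~ 0]%SET.
  apply/finset.setP => b; rewrite !inE.
  have [->|b0] := eqVneq b 0.
    by rewrite expr0n (_ : (q ^ j).-1 == 0%N = false) ?[0 == 1]eq_sym ?oner_eq0//; case: (q ^ j)%N qj => [|[]].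
  apply/eqP/(mulfI b0); rewrite -exprS prednK ?(ltnW qj)// mulr1; exact: bj.
rewrite cardsC1 (cs_card S) -ltnS !prednK ?(ltnW qj) ?expn_gt0 ?(ltnW q1)//.
by rewrite leqNgt ltn_exp2l// jn.
Qed.

(* Modulo U^(i+1), elements of U^i are products of elements of E and of       *)
(* commutators with units of E.                                               *)
Lemma UD_char_trivial (K : fieldType) (chi : units D -> K) L :
    (forall g h, chi (g * h)%g = chi g * chi h) -> (forall g, chi g != 0) ->
    (forall x, chi (toD x) = 1) -> (forall g, U L.+1 g -> chi g = 1) ->
  forall g, U 1 g -> chi g = 1.
Proof.
move=> chiM chi0 chiE.
have chi1 : chi 1%g = 1 by rewrite -(toD1 pi) chiE.
have chiV g : chi g^-1%g = (chi g)^-1.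
  by apply: (mulfI (chi0 g)); rewrite -chiM mulgV chi1 mulfV.
elim: L => // i IH chiU; apply: IH => g gi.
have gN : N (uval g - 1) <= c ^+ i.+1 by exact/(UD_dnorm S).
have [ni|ni] := boolP (n %| i.+1)%N.
  have [x [h [hi ->]]] := UD_strip S (ltn0Sn i) ni gi.
  by rewrite chiM chiE mul1r; exact: chiU.
have [b0 b0q] := residue_moved ni.
have [a a1 ab0] := cs_rd_surj S b0.
have va : vE a = 1.
  apply/le_anti; rewrite a1 leNgt; apply/negP => lt.
  have b00 : b0 = 0 by rewrite -ab0; apply/(cs_rd0 S).
  by case/eqP: b0q; rewrite b00 expr0n gtn_eqF// expn_gt0 (ltnW cs_q_gt1).
have a0 : a != 0 by rewrite -(nabs_eq0 vE) va oner_eq0.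
have au : a \is a GRing.unit by rewrite unitfE.
pose x : units E := Units au.
have aV1 : vE a^-1 <= 1 by rewrite nabsV va invr1.
have b0N : b0 != 0.
  apply/eqP => b00; have /(cs_rd0 S a1) : rd a = 0 by rewrite ab0.
  by rewrite va ltxx.
have rdV : rd a^-1 = b0^-1.
  by apply: (mulfI b0N); rewrite -ab0 -(cs_rdM S)// !mulfV ?(cs_rd1 S)// ab0.
pose s := (q ^ i.+1)%N; pose Y := sy i.+1 (uval g - 1).
have den : b0 * b0^-1 ^+ s - 1 != 0.
  rewrite subr_eq0 exprVn -[X in _ != X](mulfV (expf_neq0 s b0N)).
  by rewrite (inj_eq (mulIf _)) ?invr_eq0 ?expf_neq0// eq_sym.
(* The commutator of x and 1 + z has symbol z (b0 b0^(-s) - 1), so this z gives it the same symbol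
   as g. *)
have [z0 z01 z0E] := sy_surj S i.+1 (Y / (b0 * b0^-1 ^+ s - 1)).
set z := emb z0 * _ in z0E.
have zN : N z <= c ^+ i.+1.
  by rewrite dnorm_monomial ler_piMl// ltW// (cX_gt0 S).
have [vu _] := onePlus_unit (le_lt_trans zN (cX_lt1 S (ltn0Sn i))).
pose v : units D := Units vu.
have vU : U i.+1 v by apply/(UD_dnorm S); rewrite /= addrC addKr.
have [_ UM UV] := UD_subgroup S (ltn0Sn i).
pose C := (toD x * v * (toD x)^-1 * v^-1)%g.
have CU : U i.+1 C by apply: UM; [exact: (UD_conj S)|exact: UV].
have vV0 : N (uval v)^-1 <= c ^+ 0.
  by rewrite -uvalV expr0 (UD_norm1 S (ltn0Sn i))//; exact: UV.
have xzN : N (emb a * z * emb a^-1) <= c ^+ i.+1.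
  by rewrite (dnormM S _ (emb a^-1)) (dnormM S (emb a) z) !dnorm_emb nabsV va invr1 mul1r mulr1.
have CE : uval C - 1 = (emb a * z * emb a^-1 - z) * (uval v)^-1.
  have -> : emb a * z * emb a^-1 - z = emb a * uval v * emb a^-1 - uval v.
    rewrite -[uval v]/(1 + z) mulrDr mulrDl mulr1 -(rmorphM emb) mulfV// (rmorph1 emb).
    by rewrite opprD addrACA subrr add0r.
  by rewrite mulrBl divrr ?uvalP// /C -toDV !uvalM uvalV uval_toD uval_toD.
have sC : sy i.+1 (uval C - 1) = Y.
  rewrite CE -[i.+1]addn0 (syM _ vV0); last exact: dnormB_le.
  rewrite -uvalV (sy0_UD1 S (ltn0Sn i) (UV _ vU)) expr1n mulr1 ?addn0.
  rewrite syB//.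
  have embN : N (emb a) <= c ^+ 0 by rewrite dnorm_emb expr0.
  have embVN : N (emb a^-1) <= c ^+ 0 by rewrite dnorm_emb expr0.
  have azN : N (emb a * z) <= c ^+ (0 + i.+1) by exact: dnormM_cX.
  have -> : sy i.+1 (emb a * z * emb a^-1) = b0 * sy i.+1 z * b0^-1 ^+ s.
    rewrite -[X in sy X _]addn0 -[X in sy (X + _)%N _]add0n (syM azN embVN) (syM embN zN).
    by rewrite !sy0_emb rdV ab0 expn0 expr1.
  have -> : b0 * sy i.+1 z * b0^-1 ^+ s - sy i.+1 z = sy i.+1 z * (b0 * b0^-1 ^+ s - 1).
    by ring.
  by rewrite z0E divfK.
have -> : g = (g * C^-1 * C)%g by rewrite mulgKV.
have chiC : chi C = 1.
  by rewrite /C !chiM !chiV chiE invr1 mulr1 mul1r mulfV.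
rewrite chiM chiC mulr1; apply: chiU.
have CVN : N (uval C)^-1 <= c ^+ 0.
  by rewrite -uvalV expr0 (UD_norm1 S (ltn0Sn i))//; exact: UV.
have CN : N (uval C - 1) <= c ^+ i.+1 by exact/(UD_dnorm S).
apply: (UD_symbol_step (S := S)).
  by apply/(UD_dnorm S); apply: UM => //; exact: UV.
have -> : uval (g * C^-1)%g - 1 = ((uval g - 1) - (uval C - 1)) * (uval C)^-1.
  by rewrite uvalM uvalV opprB addrA subrK mulrBl divrr ?uvalP.
rewrite -[i.+1]addn0 (syM _ CVN); last exact: dnormB_le.
by rewrite ?addn0 syB// sC subrr mul0r.
Qed.

Lemma eps_Nrd_trivial (K : fieldType) (vF : nonarch_abs R F) (eps : units F -> K) :
    (forall a : F, vE a%:A = vF a) ->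
    is_character (unit_filt vF w) setT eps ->
    (forall (a : units F) (x : units E),
       (uval a)%:A = \prod_(i < n) iter i phi (uval x) -> eps a = 1) ->
  let chi := fun g : units D => eps (Nrd_units n pi g) in
  [/\ forall g, chi g != 0, forall g h, chi (g * h)%g = chi g * chi h,
      forall x, chi (toD x) = 1 & forall g, U 1 g -> chi g = 1].
Proof.
move=> vEF [eps0 epsM [m epsm]] epsN chi.
have chi0 g : chi g != 0 by exact: eps0.
have chiM g h : chi (g * h)%g = chi g * chi h by rewrite /chi Nrd_unitsM epsM.
have chiE x : chi (toD x) = 1.
  by apply: (epsN _ x); rewrite uval_Nrd_units Nrd_emb.
(* One unit of depth is lost in [Nrd_UD]; one more keeps the exponent positive, so that the reduced
   norm is a unit even when m = 0. *)
have chiL g : U (n * m.+2)%N g -> chi g = 1.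
  move=> gU; apply: epsm => //.
  have wF : vF w = c ^+ n by rewrite -vEF (cs_cn S).
  have w0 : w != 0.
    by apply: contraTneq (cs_w0 S) => ->; rewrite scale0r eqxx.
  have le : vF (uval (Nrd_units n pi g) - 1) <= vF w ^+ m.+1.
    rewrite uval_Nrd_units -vEF scalerBl scale1r wF -exprM.
    exact: Nrd_UD.
  have lt1 : vF w ^+ m.+1 < 1.
    by rewrite wF -exprM (cX_lt1 S).
  have v1 : vF (uval (Nrd_units n pi g)) = 1.
    rewrite -(nabs1 vF); apply: nabs_eq_dom; rewrite nabs1.
    exact: le_lt_trans le lt1.
  case: (m) le => [|m'] le; rewrite /unit_filt /=.
    by rewrite /int_ring /= nabsV v1 invr1.
  exists ((uval (Nrd_units n pi g) - 1) / w ^+ m'.+1).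
    rewrite /int_ring /= nabsM nabsV nabsX ler_pdivrMr ?mul1r; last first.
      by rewrite wF -exprM (cX_gt0 S).
    apply: le_trans le _; rewrite wF -!exprM ler_iXn2l ?(cs_c0 S) ?(cs_c1 S)//.
    by rewrite leq_pmul2l.
  by rewrite mulrCA mulfV ?mulr1// expf_neq0.
split=> //; apply: (UD_char_trivial (L := (n * m.+2)%N)) => // g gU.
by apply: chiL; apply: (UD_le S) gU.
Qed.

End ReducedNorm.

(** * Induction from E^x U_D^M *)

Lemma commutator_sub1 (A : pzRingType) (a b : A) :
  (a - 1) * (b - 1) - (b - 1) * (a - 1) = a * b - b * a.
Proof.
have H (x y : A) : (x - 1) * (y - 1) = x * y - (x + y - 1).
  rewrite mulrBr mulrBl mul1r mulr1 -addrA -opprD; congr (_ - _).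
  by rewrite addrA [y + x]addrC.
by rewrite !H [b + a]addrC [- (b * a - _)]opprB addrA subrK.
Qed.

Section InductionJ.
Variables (R : realType) (F : fieldType) (E : fieldExtType F)
    (vE : nonarch_abs R E) (phi : {rmorphism E -> E}) (n' : nat) (w : F)
    (D : unitRingType) (pi : {rmorphism twpoly phi -> D})
    (k : finFieldType) (q : nat) (rd : E -> k) (c : R).
Hypothesis S : cyclic_setup vE n' w pi q rd c.

Local Notation n := n'.+1.
Local Notation emb := (embD pi).
Local Notation Pi := (PiD pi).
Local Notation N := (dnorm S).
Local Notation pr := (pr S).
Local Notation toD := (units_map (embD pi)).
Local Notation U := (UD vE n pi).
Local Notation J := (Jset vE n' pi).
Local Notation PiU := (PiU S).
Local Notation D_N := (D_nbhs vE n pi).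

Variables (K : fieldType) (theta : units E -> K) (t : nat).
Hypotheses (t0 : (0 < t)%N)
  (thM : forall x y, theta (x * y)%g = theta x * theta y)
  (thN0 : forall x, theta x != 0)
  (th_level : forall x, vE (uval x - 1) <= c ^+ (n * t.+1) -> theta x = 1)
  (th_prim : forall i, ~~ (n %| i)%N -> exists x y : units E,
    [/\ vE (uval x - 1) <= c ^+ (n * t), uval y = iter i phi (uval x)
      & theta y != theta x]).

Local Notation h := (n * t)%N.
Local Notation Theta := (Theta S theta).
Local Notation thE := (thE theta).

Lemma D_nbhs_sub j : D_N j.+1 `<=` D_N j.
Proof. exact: (UD_le S). Qed.

Lemma D_nbhs_conj j g u : D_N j u -> D_N j (g * u * g^-1)%g.
Proof. exact: (UD_conj S). Qed.

Lemma D_nbhs_Jset M : exists j, D_N j `<=` J M.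
Proof. by exists M => g /(UD_le S (leqnSn M)) /UD_Jset. Qed.

Lemma Jset_transversal M L : (0 < M)%N -> subgroup L -> J M `<=` L ->
  exists (I : finType) (r : I -> units D), transversal (J M) L r.
Proof.
move=> M0 LG JL; have [X [r rP]] := Jset_cover S M0.
exact: transversal_exists (Jset_subgroup S M0) LG JL (fun g _ => rP g).
Qed.

(** Mackey's criterion with U_D^s0 as the normal subgroup acting by scalars; [Theta_stabiliser]
    supplies the separation of cosets. *)
Lemma ind_J_irreducible s0 M (L : set (units D)) (sigma : prerep K (units D)) :
    (0 < M <= s0)%N -> (s0 <= h)%N ->
    (forall i, (0 < i < M)%N -> ~~ (n %| i)%N -> (i + s0 <= h)%N) ->
    subgroup L -> J M `<=` L ->
    irreducible_rep D_N (J M) sigma ->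
    (forall a v, U s0 a -> rep_carrier sigma v -> rep_act sigma a v = Theta a *: v) ->
  irreducible_rep D_N L (ind_on D_N (J M) L sigma).
Proof.
move=> /andP[M0 Ms] sh iM LG JL irr scal.
have [I [r rP]] := Jset_transversal M0 LG JL.
have [sm _ _] := irr.
apply: (ind_on_irreducible (Jset_subgroup S M0) LG JL D_nbhs_sub D_nbhs_conj
  (D_nbhs_Jset M) sm rP (A := U s0) (psi := Theta)) => //.
- by move=> g /(UD_le S Ms) /UD_Jset.
- by move=> g a _; exact: (UD_conj S).
move=> g _; apply: (Theta_stabiliser t0 thM thN0 th_level th_prim) => //.
by rewrite sh andbT (leq_trans M0).
Qed.

Lemma Jset_PiU M i j : (0 < M)%N -> (i < n)%N -> (j < n)%N ->
  J M (PiU ^+ i * (PiU ^+ j)^-1)%g -> i = j.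
Proof.
move=> M0 ilt jlt /JsetP[x [u [um uE]]].
have : N (uval (PiU ^+ i)%g) = N (uval (toD x * u * PiU ^+ j)%g) by rewrite -uE mulgKV.
rewrite !uvalM !uvalX !dnormM !dnorm_PiX (UD_norm1 S M0 um) uval_toD dnorm_emb mulr1.
have [m [l ml]] := nabs_cpow S (units_neq0 x).
move/(congr1 (fun z => z * c ^+ (n * l))); rewrite [RHS]mulrAC ml -!exprD.
move/eqP; rewrite eq_le !ler_iXn2l ?(cs_c0 S) ?(cs_c1 S)// -eqn_leq => /eqP eqn.
have {eqn} : (m * n + j = l * n + i)%N by lia.
move/(congr1 (modn^~ n)); rewrite !modnMDl !modn_small//.
Qed.

(** Very regularity read in k: no nontrivial Galois conjugate of the residue equals it. *)
Definition regular_unit (x : units E) : Prop :=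
  vE (uval x) <= 1 /\
  forall i, ~~ (n %| i)%N -> rd (uval x) ^+ (q ^ i) != rd (uval x).

Lemma regular_unit_phi j x y : regular_unit x -> uval y = iter j phi (uval x) ->
  regular_unit y.
Proof.
move=> [x1 xreg] yE; split; first by rewrite yE (nabs_phi_iter S).
move=> i ni; rewrite yE (rd_phi_iter S)// -exprM mulnC exprM.
apply: contra (xreg i ni) => /eqP E1.
have inj m (a b : k) : a ^+ (q ^ m) = b ^+ (q ^ m) -> a = b.
  move=> /(congr1 (fun z => z ^+ (q ^ (n' * m)))); rewrite -!exprM -!expnD -mulSn.
  by rewrite !(expf_qn S).
by apply/eqP; apply: inj E1.
Qed.

(** The fixed cosets correspond bijectively to the powers Pi^j with j < n, by [fixed_coset] and
    [Jset_PiU]; conjugating by Pi^j replaces x by phi^j x. *)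
Lemma ind_J_trace M (sigma : prerep K (units D)) sgn x : (0 < M)%N ->
    smooth_rep D_N (J M) sigma ->
    (exists d (b : 'I_d -> rep_space sigma), basis_on (rep_carrier sigma) b) ->
    (forall y, regular_unit y -> rep_trace sigma (toD y) (sgn * theta y)) ->
    regular_unit x ->
  rep_trace (ind_on D_N (J M) setT sigma) (toD x)
    (sgn * \sum_(j < n) thE (iter j phi (uval x))).
Proof.
move=> M0 sm bas trs xreg; have [x1 xreg'] := xreg.
have JG := Jset_subgroup S M0; have [J1 JM JV] := JG.
have [I [r rP]] := Jset_transversal M0 (@subgroupT (units D)) (fun _ _ => Logic.I).
have [_ rcov rI] := rP.
pose fixd i := `[< J M (r i * toD x * (r i)^-1)%g >].
have /choice [js jsP] : forall i, exists j : 'I_n, fixd i -> J M (r i * (PiU ^+ j)^-1)%g.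
  move=> i; have [fi|] := boolP (fixd i); last by exists ord0.
  have [j jn Jj] := fixed_coset S M0 x1 xreg' (asboolW fi).
  by exists (Ordinal jn).
have trP i : J M (r i * toD x * (r i)^-1)%g ->
    rep_trace sigma (r i * toD x * (r i)^-1)%g (sgn * thE (iter (js i) phi (uval x))).
  move=> fi; have Jj := jsP i (introT (asboolP _) fi).
  have [y yE yc] := PiU_toD S (js i) x.
  have -> : (r i * toD x * (r i)^-1 = (r i * (PiU ^+ js i)^-1) * toD y *
      (r i * (PiU ^+ js i)^-1)^-1)%g.
    by rewrite -yc invMg !invgK !mulgA !mulgKV.
  apply: (has_trace_conj JG sm Jj (Jset_toD S y M0)).
  rewrite -yE thE_units; apply: trs; exact: regular_unit_phi yE.
have := ind_on_trace JG (@subgroupT (units D)) (fun _ _ => Logic.I)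
  D_nbhs_sub D_nbhs_conj (D_nbhs_Jset M) sm rP Logic.I bas trP.
congr rep_trace.
have /choice [ix ixP] : forall j : 'I_n, exists i, J M (PiU ^+ j * (r i)^-1)%g.
  by move=> j; exact: rcov.
have ixfix j : fixd (ix j).
  apply/asboolP.
  have [y yE yc] := PiU_toD S j x.
  have Jr : J M (r (ix j) * (PiU ^+ j)^-1)%g.
    by have := JV _ (ixP j); rewrite invMg invgK.
  have -> : (r (ix j) * toD x * (r (ix j))^-1 = (r (ix j) * (PiU ^+ j)^-1) * toD y *
      (r (ix j) * (PiU ^+ j)^-1)^-1)%g.
    by rewrite -yc invMg !invgK !mulgA !mulgKV.
  exact: JM _ _ (JM _ _ Jr (Jset_toD S y M0)) (JV _ Jr).
have ixK j : js (ix j) = j.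
  apply: val_inj; apply/esym; apply: (Jset_PiU M0 (ltn_ord j) (ltn_ord _)).
  by have := JM _ _ (ixP j) (jsP _ (ixfix j)); rewrite mulgA mulgKV.
have jsK i : fixd i -> ix (js i) = i.
  move=> fi; apply: rI; have := JV _ (JM _ _ (jsP i fi) (ixP (js i))).
  by rewrite mulgA mulgKV invMg invgK.
rewrite mulr_sumr (reindex ix); last first.
  by exists js => [j _|i]; [exact: ixK|exact: jsK].
apply: eq_big => [j|j _]; first exact: ixfix.
by rewrite ixK.
Qed.

(** Inside E^x U_D^m every norm is a power of c^n, so among the cosets of Pi^j only j = 0 remains
    and the trace is unchanged. *)
Lemma ind_J_trace_trivial M m (sigma : prerep K (units D)) x a : (0 < m <= M)%N ->
    smooth_rep D_N (J M) sigma ->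
    (exists d (b : 'I_d -> rep_space sigma), basis_on (rep_carrier sigma) b) ->
    rep_trace sigma (toD x) a -> regular_unit x ->
  rep_trace (ind_on D_N (J M) (J m) sigma) (toD x) a.
Proof.
move=> /andP[m0 mM] sm bas tra [x1 xreg].
have M0 : (0 < M)%N by exact: leq_trans mM.
have JG := Jset_subgroup S M0; have [J1 JM JV] := JG.
have LG := Jset_subgroup S m0; have [L1 LM LV] := LG.
have JL := Jset_le S mM.
have [I [r rP]] := Jset_transversal M0 LG JL.
have [Lr rcov rI] := rP.
have fixr i : J M (r i * toD x * (r i)^-1)%g -> J M (r i).
  move=> /(fixed_coset S M0 x1 xreg)[j jn Jj].
  have Lj : J m (PiU ^+ 0 * (PiU ^+ j)^-1)%g.
    rewrite expg0 mul1g.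
    by have := LM _ _ (LV _ (Lr i)) (JL _ Jj); rewrite mulgA mulVg mul1g.
  have j0 := Jset_PiU m0 (ltn0Sn _) jn Lj.
  by move: Jj; rewrite -j0 expg0 invg1 mulg1.
have [i0 Ji0] := rcov 1%g L1.
have Jr0 : J M (r i0) by have := JV _ Ji0; rewrite mul1g invgK.
have xJ := Jset_toD S x M0.
have := ind_on_trace JG LG JL D_nbhs_sub D_nbhs_conj (D_nbhs_Jset M) sm rP
  (JL _ xJ) bas (t := fun=> a).
have -> : \sum_(i | `[< J M (r i * toD x * (r i)^-1)%g >]) a = a.
  rewrite (big_pred1 i0) => // i; apply/asboolP/eqP => [/fixr Ji|->].
    by apply: rI; have := JM _ _ Ji (JV _ Jr0).
  exact: JM _ _ (JM _ _ Jr0 xJ) (JV _ Jr0).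
by apply=> i fi; exact: (has_trace_conj JG sm (fixr i fi) xJ tra).
Qed.

Section ScalarSubgroup.
(** [Z] models F^x U_E^1. A commutator of [Z] with U_D^m differs from 1 by some d / v with d in
    P_D^(m+n) and pr d = 0; multiplying by v^-1 contributes a C' part of depth m, whence the bound h
    < m + n + m. *)
Variables (M m l : nat) (Z : set (units E)).
Hypotheses (m0 : (0 < m)%N) (l0 : (0 < l)%N) (ml : (m <= l)%N)
  (ll : (h < l + l)%N) (mlh : (h < m + l)%N) (mn : (l <= m + n)%N)
  (mmn : (h < m + n + m)%N)
  (Zz : forall x, Z x -> exists z e : units E,
     [/\ x = (z * e)%g, phi (uval z) = uval z & vE (uval e - 1) <= c ^+ n]).

Let phi_iter z i : phi z = z -> iter i phi z = z.
Proof. by move=> pz; elim: i => //= i ->. Qed.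

Let central (z : units E) d : phi (uval z) = uval z -> d * emb (uval z) = emb (uval z) * d.
Proof.
move=> pz; rewrite {1}(coordE (cs_quot S) d) mulr_suml [in RHS](coordE (cs_quot S) d) mulr_sumr.
apply: eq_bigr => j _; rewrite -mulrA PiDX_emb phi_iter// !mulrA -!rmorphM.
by rewrite mulrC.
Qed.

(* The commutator of Z and U^m lies deep enough for Theta to ignore it.       *)
Lemma Theta_conj_Z x u g : Z x -> U l u -> J m g -> exists2 u', U l u' &
  (g * (toD x * u) * g^-1 = toD x * u')%g /\ Theta (toD x * u')%g = Theta (toD x * u)%g.
Proof.
move=> Zx ul /JsetP[y [v [vm ->]]].
have [_ UM UV] := UD_subgroup S l0.
have [_ UmM UmV] := UD_subgroup S m0.
have nz l' u' : (0 < l')%N -> U l' u' -> pr (uval u') != 0.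
  by move=> l'0 u'l; have [_ u1] := UD_pr S l'0 u'l; rewrite -(nabs_eq0 vE) u1 oner_eq0.
suff [u' u'l [u'E u'T]] : exists2 u', U l u' &
    (v * (toD x * u) * v^-1 = toD x * u')%g /\ Theta (toD x * u')%g = Theta (toD x * u)%g.
  exists (toD y * u' * (toD y)^-1)%g; first exact: (UD_conj S).
  have E1 : (toD y * v * (toD x * u) * (toD y * v)^-1 =
      toD x * (toD y * u' * (toD y)^-1))%g.
    transitivity (toD y * (v * (toD x * u) * v^-1) * (toD y)^-1)%g.
      by rewrite invMg !mulgA.
    rewrite u'E -!toDV !mulgA -toDM; congr (_ * _ * _)%g.
    by rewrite -toDM; congr toD; apply: uval_inj; rewrite !uvalM mulrC.
  split=> //; rewrite -u'T !(Theta_toDl thM) ?(nz l)//; last exact: (UD_conj S).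
  by rewrite Theta_conj_toD.
have [z [e [xE pz e1]]] := Zz Zx.
pose cm := (toD x^-1 * v * toD x * v^-1)%g.
pose d := emb (uval e)^-1 * uval v * emb (uval e) - uval v.
have ve : vE (uval e) = 1.
  rewrite -(nabs1 vE); apply: nabs_eq_dom; rewrite nabs1.
  by apply: le_lt_trans e1 _; exact: (cX_lt1 S).
have dE : d = emb (uval e)^-1 * ((uval v - 1) * emb (uval e - 1) - emb (uval e - 1) * (uval v - 1)).
  rewrite rmorphB rmorph1 commutator_sub1 mulrBr mulrA; congr (_ - _).
  by rewrite mulrA -rmorphM mulVf ?units_neq0// rmorph1 mul1r.
have dN : N d <= c ^+ (m + n).
  have vN : N (uval v - 1) <= c ^+ m by exact/(UD_dnorm S).
  have eN : N (emb (uval e - 1)) <= c ^+ n by rewrite dnorm_emb.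
  rewrite dE dnorm_embl nabsV ve invr1 mul1r; apply: dnormB_le.
    exact: dnormM_cX.
  by rewrite addnC; exact: dnormM_cX.
have cmE : uval cm - 1 = d / uval v.
  have -> : uval cm = emb (uval e)^-1 * uval v * emb (uval e) / uval v.
    rewrite /cm !uvalM !uval_toD !uvalV xE uvalM; congr (_ / _).
    have -> : emb (uval z * uval e)^-1 = emb (uval e)^-1 * emb (uval z)^-1.
      by rewrite invfM mulrC (rmorphM emb).
    have -> : emb (uval z * uval e) = emb (uval z) * emb (uval e) by rewrite (rmorphM emb).
    rewrite [in LHS]mulrA -3![in LHS]mulrA -[in RHS]mulrA; congr (_ * _).
    rewrite !mulrA -[_ * uval v * _]mulrA (central (uval v) pz).
    by rewrite !mulrA -(rmorphM emb) mulVf ?units_neq0// (rmorph1 emb) mul1r.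
  by rewrite /d mulrBl divrr ?uvalP.
have cml : U l cm.
  apply/(UD_dnorm S); rewrite cmE dnormM dnormV ?dnorm_unit_neq0// (UD_norm1 S m0 vm).
  by rewrite invr1 mulr1; exact: dnorm_le_cX dN.
have prd : pr d = 0.
  by rewrite /d prB pr_embr pr_embl mulrAC mulVf ?units_neq0// mul1r subrr.
have cmT : Theta cm = 1.
  rewrite /Theta -(thE1 thM thN0); apply: (thE_congr1 S thM th_level); first exact: nabs1.
  have -> : pr (uval cm) - 1 = pr (d * uval v^-1%g).
    by rewrite -[X in _ - X](pr1 S) -prB cmE.
  rewrite (pr_mul S) prd mul0r add0r rmorph0 subr0.
  apply: (pr_round (S := S) (i := (m + n + m)%N)) => //.
  by apply: dnormM_cX => //; apply: dnorm_subpr => //; exact: UmV.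
have vuv : U l (v * u * v^-1)%g by exact: (UD_conj S).
exists (cm * (v * u * v^-1))%g; first exact: UM.
split.
  by rewrite /cm toDV !mulgA mulgV mul1g mulgKV.
rewrite !(Theta_toDl thM) ?(nz l)//; last exact: UM.
rewrite (Theta_mul_UD S thM th_level l0 l0 ll cml vuv) cmT mul1r.
by rewrite (Theta_conj_UD S thM th_level m0 l0 mlh vm ul).
Qed.

(** Moving x u to the left past g replaces u by some u' with the same value of [Theta], so the
    scalar action of the inducing representation persists. *)
Lemma ind_J_scalar (sigma : prerep K (units D)) f g x u : (0 < M <= l)%N -> (m <= M)%N ->
    (forall y v a, Z y -> U l v -> rep_carrier sigma a ->
       rep_act sigma (toD y * v)%g a = Theta (toD y * v)%g *: a) ->
    rep_carrier (ind_on D_N (J M) (J m) sigma) f -> Z x -> U l u ->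
  f (g * (toD x * u))%g = Theta (toD x * u)%g *: f g.
Proof.
move=> /andP[M0 Ml] mM scal [fS fJ _ fL] Zx ul.
have [_ LM LV] := Jset_subgroup S m0.
have xuJ : J m (toD x * u)%g by apply: JsetI; exact: (UD_le S) ul.
have [gJ|gJ] := pselect (J m g); last first.
  rewrite !fL ?scaler0// => gxJ; apply: gJ.
  by have := LM _ _ gxJ (LV _ xuJ); rewrite mulgK.
have [u' u'l [u'E u'T]] := Theta_conj_Z Zx ul gJ.
have -> : (g * (toD x * u) = toD x * u' * g)%g by rewrite -u'E mulgKV.
rewrite fJ; last by apply: JsetI; exact: (UD_le S) u'l.
by rewrite scal ?u'T.
Qed.

End ScalarSubgroup.

End InductionJ.

(** * The Heisenberg representation of E^x U_D^(h/2) for even n and odd t *)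

Section HeisenbergCase.
Variables (R : realType) (F : fieldType) (E : fieldExtType F)
    (vE : nonarch_abs R E) (phi : {rmorphism E -> E}) (n' : nat) (w : F)
    (D : unitRingType) (pi : {rmorphism twpoly phi -> D})
    (k : finFieldType) (q : nat) (rd : E -> k) (c : R).
Hypothesis S : cyclic_setup vE n' w pi q rd c.

Local Notation n := n'.+1.
Local Notation emb := (embD pi).
Local Notation Pi := (PiD pi).
Local Notation N := (dnorm S).
Local Notation pr := (pr S).
Local Notation sy := (sy S).
Local Notation toD := (units_map (embD pi)).
Local Notation U := (UD vE n pi).
Local Notation J := (Jset vE n' pi).
Local Notation D_N := (D_nbhs vE n pi).

Variables (K : closedFieldType) (theta : units E -> K) (t : nat).
Hypotheses (t0 : (0 < t)%N)
  (thM : forall x y, theta (x * y)%g = theta x * theta y)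
  (thN0 : forall x, theta x != 0)
  (th_level : forall x, vE (uval x - 1) <= c ^+ (n * t.+1) -> theta x = 1)
  (th_prim : forall i, ~~ (n %| i)%N -> exists x y : units E,
    [/\ vE (uval x - 1) <= c ^+ (n * t), uval y = iter i phi (uval x)
      & theta y != theta x])
  (K0 : forall m, m%:R = 0 :> K -> m = 0%N).

Local Notation h := (n * t)%N.
Local Notation Theta := (Theta S theta).
Local Notation thE := (thE theta).
Local Notation psi := (psi vE w rd theta t).

Variables (nu M : nat).
Hypotheses (n_nu : n = nu.*2) (t_odd : odd t) (ME : M = (nu * t)%N).

Let nu0 : (0 < nu)%N. Proof. by move: n_nu; case: nu. Qed.
Let M0 : (0 < M)%N. Proof. by rewrite ME muln_gt0 nu0. Qed.
Let MM : (M + M = h)%N. Proof. by rewrite ME n_nu addnn doubleMl. Qed.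

(** Since t is odd, M is congruent to n/2 modulo n, so the twist by q^M is the involution of k. *)
Let Mmod : M = (nu + n * t./2)%N.
Proof. by rewrite ME n_nu -[in LHS](odd_double_half t) t_odd; lia. Qed.

Let nM : ~~ (n %| M)%N.
Proof.
rewrite Mmod dvdn_addl ?dvdn_mulr//; apply/negP => /(dvdn_leq nu0).
by rewrite n_nu; lia.
Qed.

Let expM (x : k) : x ^+ (q ^ M) = x ^+ (q ^ nu).
Proof. by rewrite Mmod expnD exprM (expf_qn S). Qed.

(** With g = a (1 + y), a = pr g: [hcoef] is the element of norm one by which a acts on symbols of
    degree M under conjugation, and [hvec] is the symbol of y, the Heisenberg coordinate. *)
Definition hcoef (g : units D) : k :=
  rd (iter M phi (pr (uval g)) / pr (uval g)).
Definition hvec (g : units D) : k := sy M (emb (pr (uval g))^-1 * uval g - 1).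

Let iter_phiM i x y : iter i phi (x * y) = iter i phi x * iter i phi y.
Proof. by elim: i => //= i ->; rewrite rmorphM. Qed.
Let iter_phiV i x : iter i phi x^-1 = (iter i phi x)^-1.
Proof. by elim: i => //= i ->; rewrite fmorphV. Qed.
Let iter_phiD1 i x : iter i phi (1 + x) = 1 + iter i phi x.
Proof. by elim: i => //= i ->; rewrite rmorphD rmorph1. Qed.

Let twist1 i x : x != 0 -> vE (iter i phi x / x) = 1.
Proof. by move=> x0; rewrite nabsM nabsV (nabs_phi_iter S) mulfV// nabs_eq0. Qed.

Lemma lead_conj i b d : b != 0 ->
  lead S i (emb b^-1 * d * emb b) = lead S i d * (iter i phi b / b).
Proof.
move=> b0; rewrite /lead (coord_embr (cs_quot S) (cs_phi_n S) (cs_phi_w S)).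
rewrite (coordZ (cs_quot S) (cs_phi_n S) (cs_phi_w S)) mxE inordK ?ltn_mod//.
have -> : iter i phi b = iter (i %% n) phi b.
  rewrite {1}(divn_eq i n) addnC iterD; congr (iter _ _ _).
  by elim: (i %/ n)%N => // j IH; rewrite mulSn iterD IH (cs_phi_n S).
by ring.
Qed.

Lemma sy_conj i b d : b != 0 -> N d <= c ^+ i ->
  sy i (emb b^-1 * d * emb b) = sy i d * rd (iter i phi b / b).
Proof.
move=> b0 di; rewrite /sy lead_conj// (cs_rdM S) ?lead_le1//.
by rewrite twist1.
Qed.

Let red_onePlus e : vE e < 1 -> rd (1 + e) = 1.
Proof.
move=> e1; rewrite -(cs_rd1 S); apply/(rd_eq S).
- by rewrite nabs_onePlus.
- by rewrite nabs1.
by rewrite addrC addKr.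
Qed.

Let red_onePlusV e : vE e < 1 -> rd (1 + e)^-1 = 1.
Proof.
move=> e1; have v1 := nabs_onePlus e1.
apply: (mulfI (oner_neq0 k)); rewrite -[X in X * _](red_onePlus e1) -(cs_rdM S).
- by rewrite mulfV ?(cs_rd1 S) ?mulr1 ?(onePlus_neq0 e1).
- by rewrite v1.
by rewrite nabsV v1 invr1.
Qed.

Lemma Jset_normal g : J M g -> exists a y, [/\ a != 0, pr (uval g) = a, pr y = 0,
  N y <= c ^+ M & uval g = emb a * (1 + y)].
Proof.
move=> /(Jset_pr S M0)[a0 gN]; set a := pr (uval g) in a0 gN *.
exists a, (emb a^-1 * uval g - 1); split=> //.
- by rewrite prB pr_embl mulVf// pr1 subrr.
- have -> : emb a^-1 * uval g - 1 = emb a^-1 * (uval g - emb a).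
    by rewrite mulrBr -rmorphM mulVf// rmorph1.
  by rewrite dnorm_embl nabsV mulrC ler_pdivrMr ?nabs_gt0// mulrC.
by rewrite addrC subrK mulrA -rmorphM mulfV// rmorph1 mul1r.
Qed.

Lemma hvecE g a y : a != 0 -> pr (uval g) = a -> uval g = emb a * (1 + y) -> hvec g = sy M y.
Proof.
move=> a0 ga gE; rewrite /hvec ga gE mulrA -rmorphM mulVf// rmorph1 mul1r.
by rewrite addrC addKr.
Qed.

Lemma hcoefN g : J M g -> hcoef g * hcoef g ^+ (q ^ nu) = 1.
Proof.
move=> /(Jset_pr S M0)[a0 _]; rewrite /hcoef; set a := pr (uval g) in a0 *.
have z1 := twist1 M a0; set z := iter M phi a / a in z1 *.
rewrite -expM -(rd_phi_iter S) ?z1// -(cs_rdM S) ?(nabs_phi_iter S) ?z1//.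
have phi2M : iter M phi (iter M phi a) = a.
  rewrite -iterD MM; elim: (t) => [|j IH]; first by rewrite muln0.
  by rewrite mulnS iterD IH (cs_phi_n S).
have pa0 : iter M phi a != 0 by rewrite -(nabs_eq0 vE) (nabs_phi_iter S) nabs_eq0.
rewrite /z iter_phiM iter_phiV phi2M.
rewrite (_ : _ * _ = 1) ?(cs_rd1 S)//; by field; rewrite a0 pa0.
Qed.

(* The group law of J^M modulo the kernel of Theta on U^(M+1).                *)
Lemma Jset_law g g' : J M g -> J M g' ->
  [/\ Theta (g * g')%g = Theta g * Theta g' *
        psi (hvec g * hcoef g' * hvec g' ^+ (q ^ nu)),
      hcoef (g * g')%g = hcoef g * hcoef g'
    & hvec (g * g')%g = hvec g * hcoef g' + hvec g'].
Proof.
move=> /Jset_normal[a [y [a0 ga py yN gE]]] /Jset_normal[b [z [b0 gb pz zN gE']]].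
pose y' := emb b^-1 * y * emb b.
have y'N : N y' <= c ^+ M.
  by rewrite /y' !dnormM !dnorm_emb nabsV mulrAC mulVf ?mul1r// nabs_eq0.
have py' : pr y' = 0 by rewrite /y' pr_embr pr_embl py mulr0 mul0r.
have yzN : N (y' * z) <= c ^+ h by rewrite -MM; exact: dnormM_cX.
pose e := pr (y' * z).
have eN : vE e <= c ^+ h by apply: le_trans yzN; exact: pr_dnorm.
have e1 : vE e < 1.
  by apply: le_lt_trans eN _; apply: (cX_lt1 S); rewrite muln_gt0.
have E1 : uval (g * g')%g = emb (a * b) * (1 + (y' + z + y' * z)).
  rewrite uvalM gE gE' rmorphM.
  have -> : emb a * (1 + y) * (emb b * (1 + z)) = emb a * ((1 + y) * emb b) * (1 + z).
    by rewrite !mulrA.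
  have -> : (1 + y) * emb b = emb b * (1 + y').
    rewrite /y' mulrDl mulrDr mul1r mulr1 !mulrA -(rmorphM emb) mulfV//.
    by rewrite (rmorph1 emb) mul1r.
  rewrite !mulrA -mulrA; congr (_ * _).
  by rewrite mulrDl mul1r mulrDr mulr1 -!addrA; congr (1 + _); rewrite addrCA.
have prgg : pr (uval (g * g')%g) = a * b * (1 + e).
  by rewrite E1 pr_embl !prD pr1 py' pz !add0r.
have e10 := onePlus_neq0 e1.
have hc' : hcoef g' = rd (iter M phi b / b) by rewrite /hcoef gb.
have sy' : sy M y' = hvec g * hcoef g'.
  by rewrite /y' sy_conj// hc' (hvecE a0 ga gE).
have hvz : hvec g' = sy M z by rewrite (hvecE b0 gb gE').
split.
- have -> : Theta (g * g')%g = thE (a * b * (1 + e)) by congr thE.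
  have -> : Theta g = thE a by congr thE.
  have -> : Theta g' = thE b by congr thE.
  rewrite !(thEM thM) ?mulf_neq0//; congr (_ * _).
  rewrite (psi_symbol t0 thM th_level yzN) -{1}MM (syM y'N zN) sy' hvz.
  by rewrite expM.
- rewrite {1}/hcoef prgg hc' iter_phiM iter_phiM iter_phiD1.
  have pe1 : vE (iter M phi e) < 1 by rewrite (nabs_phi_iter S).
  have -> : iter M phi a * iter M phi b * (1 + iter M phi e) / (a * b * (1 + e)) =
     (iter M phi a / a) * (iter M phi b / b) * ((1 + iter M phi e) * (1 + e)^-1).
    by field; rewrite a0 b0 e10.
  have v11 : vE ((1 + iter M phi e) * (1 + e)^-1) <= 1.
    by rewrite nabsM nabsV !nabs_onePlus// invr1 mulr1.
  have rd1 : rd ((1 + iter M phi e) * (1 + e)^-1) = 1.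
    rewrite (cs_rdM S) ?nabsV ?nabs_onePlus ?invr1//.
    by rewrite red_onePlus// red_onePlusV// mulr1.
  have v1 : vE (iter M phi a / a * (iter M phi b / b)) <= 1.
    by rewrite [leLHS]nabsM !twist1// mulr1.
  by rewrite (cs_rdM S v1 v11) rd1 mulr1 (cs_rdM S) ?twist1// /hcoef ga.
have ab0 : a * b * (1 + e) != 0 by rewrite !mulf_neq0.
rewrite {1}/hvec prgg E1.
have -> : emb (a * b * (1 + e))^-1 * (emb (a * b) * (1 + (y' + z + y' * z))) - 1 =
    emb (1 + e)^-1 * (y' + z + (y' * z - emb e)).
  rewrite mulrA -(rmorphM emb).
  have -> : (a * b * (1 + e))^-1 * (a * b) = (1 + e)^-1.
    by rewrite invfM mulrAC mulVf ?mul1r// mulf_neq0.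
  have X1 : emb (1 + e)^-1 * (1 + emb e) = 1.
    by rewrite -(rmorph1 emb) -(rmorphD emb) -(rmorphM emb) mulVf// rmorph1.
  by rewrite -[X in _ - X]X1 -mulrBr opprD addrACA subrr add0r addrA.
have rN : N (y' * z - emb e) <= c ^+ M.+1.
  have Mh : (M.+1 <= h)%N by rewrite -MM -add1n leq_add2r.
  by apply: dnormB_le; [exact: dnorm_le_cX yzN|rewrite dnorm_emb; apply: le_trans eN _; rewrite ler_iXn2l ?(cs_c0 S) ?(cs_c1 S)].
have rN' : N (y' * z - emb e) <= c ^+ M by exact: dnorm_le_cX rN.
have yzN' : N (y' + z) <= c ^+ M by exact: dnormD_le.
have eVN : N (emb (1 + e)^-1) <= c ^+ 0 by rewrite dnorm_emb nabsV nabs_onePlus// invr1.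
rewrite -{1}[M]add0n (syM eVN (dnormD_le yzN' rN')) sy0_emb red_onePlusV// mul1r expn0 expr1.
rewrite syD// ((sy_eq0 rN').2 rN) addr0 syD// sy' hvz.
by [].
Qed.

Lemma hdata_deep g x u : U M.+1 u -> rd (iter M phi (uval x) / uval x) = 1 ->
    g = (toD x * u)%g ->
  hcoef g = 1 /\ hvec g = 0.
Proof.
move=> uM xM ->; have [p1 pn] := UD_pr S (ltn0Sn M) uM.
have pu0 : pr (uval u) != 0 by rewrite -(nabs_eq0 vE) pn oner_eq0.
have prg : pr (uval (toD x * u)%g) = uval x * pr (uval u).
  by rewrite uvalM uval_toD pr_embl.
have lt1 : vE (pr (uval u) - 1) < 1 by apply: le_lt_trans p1 _; exact: (cX_lt1 S).
have rdu z : vE (z - 1) < 1 -> rd (iter M phi z / z) = 1.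
  move=> z1; have zE : z = 1 + (z - 1) by rewrite addrC subrK.
  rewrite zE iter_phiD1 (cs_rdM S).
  - by rewrite red_onePlus ?(nabs_phi_iter S)// red_onePlusV// mulr1.
  - by rewrite nabs_onePlus// (nabs_phi_iter S).
  by rewrite nabsV nabs_onePlus// invr1.
have x0 := units_neq0 x.
split.
  rewrite /hcoef prg iter_phiM invfM mulrACA (cs_rdM S) ?twist1//.
  by rewrite xM mul1r rdu.
rewrite /hvec prg uvalM uval_toD.
have -> : emb (uval x * pr (uval u))^-1 * (emb (uval x) * uval u) - 1 =
    emb (pr (uval u))^-1 * (uval u - emb (pr (uval u))).
  rewrite mulrA -(rmorphM emb) invfM mulrAC mulVf// mul1r mulrBr -(rmorphM emb).
  by rewrite mulVf// (rmorph1 emb).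
have dN : N (emb (pr (uval u))^-1 * (uval u - emb (pr (uval u)))) <= c ^+ M.+1.
  by rewrite dnorm_embl nabsV pn invr1 mul1r; exact: dnorm_subpr.
by apply/sy_eq0 => //; exact: dnorm_le_cX dN.
Qed.

Lemma card_k : #|k| = ((q ^ nu) ^ 2)%N.
Proof. by rewrite (cs_card S) n_nu -expnM muln2. Qed.

Lemma hvec_toD x : hvec (toD x) = 0.
Proof.
rewrite /hvec uval_toD pr_emb -rmorphM mulVf ?units_neq0// rmorph1 subrr.
have N0 m : N 0 <= c ^+ m by rewrite dnorm0 ltW// (cX_gt0 S).
exact/(sy_eq0 (S := S)).
Qed.

Lemma hvec_surj b : exists g, [/\ J M g, hcoef g = 1 & hvec g = b].
Proof.
have [a a1 <-] := sy_surj S M b; set z := emb a * Pi ^+ M.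
have zN : N z <= c ^+ M.
  by rewrite dnorm_monomial ler_piMl// ltW// (cX_gt0 S).
have [gu _] := onePlus_unit (le_lt_trans zN (cX_lt1 S M0)).
pose g : units D := Units gu.
have gE : uval g = 1 + z by [].
have pg : pr (uval g) = 1 by rewrite gE prD pr1 (pr_monomial S _ nM) addr0.
exists g; split.
- by apply: (UD_Jset (m := M)); apply/(UD_dnorm S); rewrite gE addrC addKr.
- by rewrite /hcoef pg invr1 mulr1 (iter_fix _ (rmorph1 phi)) (cs_rd1 S).
by apply: (@hvecE g 1 z) => //; rewrite ?oner_neq0// rmorph1 mul1r.
Qed.

(** The operators Theta(g) R([hcoef] g, [hvec] g) multiply correctly because the cocycle in
    [Jset_law] is the one of [heisenberg_weil]. A regular x has [hvec] 0 and, as n does not divide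
    M, [hcoef] different from 1, so its trace is -theta x. *)
Lemma heisenberg_J : exists sigma : prerep K (units D),
  [/\ irreducible_rep D_N (J M) sigma,
      exists d (b : 'I_d -> rep_space sigma), fin_basis (rep_carrier sigma) b,
      forall x u v, U M.+1 u -> rd (iter M phi (uval x) / uval x) = 1 ->
        rep_act sigma (toD x * u)%g v = Theta (toD x * u)%g *: v
    & forall x, regular_unit vE n' q rd x -> rep_trace sigma (toD x) (- theta x)].
Proof.
have psi_tau : exists b, psi (b ^+ (q ^ nu)) != psi b.
  have [b] := psi_prim S t0 thM th_level th_prim nM.
  by rewrite expM; exists b.
have [d [W [W1 WM Wtr Wirr]]] :=
  heisenberg_weil card_k (expf_qD S nu) (psiD S t0 thM th_level) psi_tau K0.
pose A g := Theta g *: W (hcoef g) (hvec g).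
have AM g g' : J M g -> J M g' -> A (g * g')%g = A g *m A g'.
  move=> Jg Jg'; have [ThM cM vM] := Jset_law Jg Jg'.
  rewrite /A ThM cM vM -scalemxAl -scalemxAr.
  by rewrite [W _ _ *m _](WM _ _ _ _ (hcoefN Jg) (hcoefN Jg')) !scalerA.
have Adeep x u : U M.+1 u -> rd (iter M phi (uval x) / uval x) = 1 ->
    A (toD x * u)%g = (Theta (toD x * u)%g)%:M.
  move=> uM xM; have [cE vE'] := hdata_deep uM xM (erefl _).
  by rewrite /A cE vE' W1 scalemx1.
have [U1 _ _] := UD_subgroup S (ltn0Sn M).
have rd1 : rd (iter M phi (uval (1%g : units E)) / uval (1%g : units E)) = 1.
  by rewrite uval1 (iter_fix _ (rmorph1 phi)) divr1 (cs_rd1 S).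
have A1 : A 1%g = 1%:M.
  have := Adeep 1%g _ U1 rd1; rewrite (toD1 pi) mulg1 => ->.
  by rewrite -(toD1 pi) Theta_toD (theta1 thM thN0).
(* The transpose makes this a left action on row vectors, matching the form of irreducibility in
   [heisenberg_weil]. *)
pose sigma := @Prerep K (units D) 'rV[K]_d.+1 setT (fun g v => v *m (A g)^T).
have sm : smooth_rep D_N (J M) sigma.
  split=> //.
  - by move=> g _; split=> // a x y _ _; rewrite /= mulmxDl scalemxAl.
  - by move=> x _; rewrite /= A1 trmx1 mulmx1.
  - by move=> g g' x Jg Jg' _; rewrite /= AM// trmx_mul mulmxA.
  move=> x _; exists (n * t.+1 + M)%N => g _ gk /=.
  have gM : U M.+1 g by apply: (UD_le S _ gk); rewrite ltnS leq_addl.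
  have := Adeep 1%g g gM rd1; rewrite (toD1 pi) mul1g => ->.
  rewrite (Theta_UD S thM thN0 th_level _ gk) ?trmx1 ?mulmx1//.
  by apply: leq_trans (leqnSn _); exact: leq_addr.
exists sigma; split.
- split=> //.
    move=> /(congr1 (fun X => X (const_mx 1))) /= XE.
    have : (const_mx 1 : 'rV[K]_d.+1) = 0 by rewrite -[_ = _]XE.
    by move/matrixP/(_ 0 0)/eqP; rewrite !mxE oner_eq0.
  move=> T _ [T0 TD] TJ.
  have [TE|/eqP TE] := eqVneq T [set 0]; [by left|right].
  have [v Tv v0] : exists2 v, T v & v != 0.
    apply: contrapT => H; apply: TE; apply/seteqP; split=> v /= => [Tv|->//].
    by apply: contrapT => /eqP v0; apply: H; exists v.
  have TZ a x : T x -> T (a *: x).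
    by move=> Tx; rewrite -[a *: x]addr0; exact: TD.
  have TW b : T (v *m (W 1 b)^T).
    have [g [Jg gc gv]] := hvec_surj b.
    have Thg0 : Theta g != 0 by exact: thN0.
    have := TZ (Theta g)^-1 _ (TJ g v Jg Tv).
    rewrite /= /A gc gv linearZ /= -scalemxAr scalerA mulVf// scale1r.
    by [].
  (* The rows are the translates of v under the Heisenberg operators; their span is stable, hence
     everything. *)
  pose B := \matrix_(i < #|k|) (v *m (W 1 (enum_val i))^T).
  have rowB b : row (enum_rank b) B = v *m (W 1 b)^T by rewrite rowK enum_rankK.
  have /submx_full BT : row_full B.
    apply: (Wirr #|k| B) => [b|].
      apply/row_subP => i; rewrite row_mul rowK -mulmxA -trmx_mul.
      rewrite [W _ _ *m _](WM 1 b 1 (enum_val i)) ?mul1r ?expr1n//.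
      rewrite linearZ /= -scalemxAr scalemx_sub// mulr1 -rowB.
      exact: row_sub.
    apply: contra_neq v0 => B0; have := rowB 0.
    by rewrite W1 trmx1 mulmx1 B0 row0 => <-.
  apply/seteqP; split=> // y _.
  have /submxP[Y ->] := BT _ y; rewrite mulmx_sum_row.
  elim/big_ind: _ => // [x x' Tx Tx'|i _].
    by rewrite -[x]scale1r; exact: TD.
  by apply: TZ; rewrite rowK.
- exists d.+1, (fun i => delta_mx 0 i); split=> // [x _|a].
    by exists (x 0); exact: row_sum_delta.
  move=> a0 i; have := congr1 (fun y : 'rV_d.+1 => y 0 i) a0.
  rewrite summxE (bigD1 i)//= big1 ?addr0 => [|j ji].
    by rewrite !mxE !eqxx mulr1.
  by rewrite !mxE eq_sym (negPf ji) andbF mulr0.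
- move=> x u v uM xM /=.
  by rewrite Adeep// tr_scalar_mx mul_mx_scalar.
move=> x [x1 xr].
have vx := twist1 M (units_neq0 x).
have u1 : hcoef (toD x) != 1.
  apply: contra (xr M nM); rewrite /hcoef uval_toD pr_emb => /eqP u1.
  rewrite -(rd_phi_iter S)// -[iter M phi _](divfK (units_neq0 x)).
  by rewrite (cs_rdM S) ?vx// u1 mul1r.
exists d.+1, (fun i => delta_mx 0 i), (A (toD x)); split.
- split=> // y _; exists y; split; first exact: row_sum_delta.
  by move=> z ->; exact/esym/row_sum_delta.
- move=> j /=; rewrite [LHS]row_sum_delta; apply: eq_bigr => i _.
  by rewrite -rowE !mxE.
rewrite /A hvec_toD Theta_toD linearZ /= Wtr ?mulrN1//.
exact/hcoefN/(Jset_toD S).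
Qed.

End HeisenbergCase.

(** * The representation sigma for even level *)

Section EvenLevel.
Variables (R : realType) (F : fieldType) (E : fieldExtType F)
    (vE : nonarch_abs R E) (phi : {rmorphism E -> E}) (n' : nat) (w : F)
    (D : unitRingType) (pi : {rmorphism twpoly phi -> D})
    (k : finFieldType) (q : nat) (rd : E -> k) (c : R).
Hypothesis S : cyclic_setup vE n' w pi q rd c.

Local Notation n := n'.+1.
Local Notation toD := (units_map (embD pi)).
Local Notation U := (UD vE n pi).
Local Notation J := (Jset vE n' pi).
Local Notation D_N := (D_nbhs vE n pi).

Variables (K : closedFieldType) (theta : units E -> K) (j : nat).
Local Notation t := (j.*2.+1).
Hypotheses (thM : forall x y, theta (x * y)%g = theta x * theta y)
  (thN0 : forall x, theta x != 0)
  (th_level : forall x, vE (uval x - 1) <= c ^+ (n * t.+1) -> theta x = 1)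
  (th_prim : forall i, ~~ (n %| i)%N -> exists x y : units E,
    [/\ vE (uval x - 1) <= c ^+ (n * t), uval y = iter i phi (uval x)
      & theta y != theta x])
  (K0 : forall m, m%:R = 0 :> K -> m = 0%N).

Local Notation h := (n * t)%N.
Local Notation Theta := (Theta S theta).

(** A description of F^x U_E^1 through the fixed points of phi. *)
Definition fixed_times_U1 (x : units E) : Prop := exists z e : units E,
  [/\ x = (z * e)%g, phi (uval z) = uval z & vE (uval e - 1) <= c ^+ n].

Lemma rd_twist_fixed M x : fixed_times_U1 x -> rd (iter M phi (uval x) / uval x) = 1.
Proof.
move=> [z [e [-> pz e1]]]; rewrite uvalM.
have iz : iter M phi (uval z) = uval z by exact: iter_fix.
have -> : iter M phi (uval z * uval e) = uval z * iter M phi (uval e).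
  by rewrite -[in RHS]iz; elim: (M) => //= i ->; rewrite rmorphM.
rewrite invfM mulrACA mulfV ?units_neq0// mul1r.
have e1' : vE (uval e - 1) < 1 by apply: le_lt_trans e1 _; exact: (cX_lt1 S).
have ve : vE (uval e) = 1.
  by rewrite -(nabs1 vE); apply: nabs_eq_dom; rewrite nabs1.
have rdl : rd (uval e) = 1.
  by rewrite -(cs_rd1 S); apply/(rd_eq S); rewrite ?ve ?nabs1.
apply: (mulIf (oner_neq0 k)); rewrite -[X in _ * X = _]rdl -(cs_rdM S) ?ve//.
  by rewrite divfK ?units_neq0// (rd_phi_iter S) ?ve// rdl expr1n mulr1.
by rewrite nabsM nabsV (nabs_phi_iter S) ve mulfV// oner_neq0.
Qed.

Local Notation m := (n * j + 1)%N.
Local Notation kk := (n * j.+1)%N.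

(** Transfers a representation from depth M to depth m by induction. The bound M + s0 <= h + 1 is
    what the stabiliser argument needs: i + s0 <= h for every i < M. *)
Lemma ind_J_level M s0 (sigma : prerep K (units D)) (a : K) :
    (m <= M <= s0)%N -> (s0 <= kk)%N -> (M + s0 <= h.+1)%N ->
    irreducible_rep D_N (J M) sigma ->
    (exists d (b : 'I_d -> rep_space sigma), fin_basis (rep_carrier sigma) b) ->
    (forall x u v, U s0 u -> fixed_times_U1 x -> rep_carrier sigma v ->
       rep_act sigma (toD x * u)%g v = Theta (toD x * u)%g *: v) ->
    (forall x, regular_unit vE n' q rd x -> rep_trace sigma (toD x) (a * theta x)) ->
  let ind := ind_on D_N (J M) (J m) sigma in
  [/\ irreducible_rep D_N (J m) ind,
      forall x, regular_unit vE n' q rd x -> rep_trace ind (toD x) (a * theta x),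
      exists d (b : 'I_d -> rep_space ind), basis_on (rep_carrier ind) b
    & forall x u v, U kk u -> fixed_times_U1 x -> rep_carrier ind v ->
       rep_act ind (toD x * u)%g v = Theta (toD x * u)%g *: v].
Proof.
move=> /andP[mM Ms] skk Msh irr [d [b bP]] scal tra ind.
have m0 : (0 < m)%N by rewrite addn1.
have M0 : (0 < M)%N by exact: leq_trans mM.
have [sm _ _] := irr.
have JG := Jset_subgroup S M0; have LG := Jset_subgroup S m0.
have JL := Jset_le S mM.
have n0 := cs_n S.
split.
- have Ms' : (0 < M <= s0)%N by rewrite M0.
  have s0h : (s0 <= h)%N by apply: leq_trans skk _; nia.
  have iM i : (0 < i < M)%N -> ~~ (n %| i)%N -> (i + s0 <= h)%N by move=> /andP[i0 iM] _; lia.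
  apply: (ind_J_irreducible (S := S) (t := t) isT thM thN0 th_level th_prim Ms' s0h iM LG JL irr).
  move=> u v us; have one : fixed_times_U1 1%g.
    exists 1%g, 1%g; rewrite mulg1 uval1 rmorph1 subrr nabs0.
    by split=> //; rewrite ltW// (cX_gt0 S).
  by move=> /(scal _ _ _ us one); rewrite (toD1 pi) mul1g.
- move=> x xr; have mM' : (0 < m <= M)%N by rewrite m0.
  apply: (ind_J_trace_trivial S (t := t) isT mM' sm _ (tra x xr) xr).
  by eexists; eexists; exact: fin_basis_basis_on bP.
- have [I [r rP]] := Jset_transversal S M0 LG JL.
  have bI := ind_on_basis JG LG JL (@D_nbhs_sub _ _ _ _ _ _ _ _ _ _ _ _ _ S)
    (@D_nbhs_conj _ _ _ _ _ _ _ _ _ _ _ _ _ S) (D_nbhs_Jset S M) sm rP (fun=> bP).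
  by eexists; eexists; exact: fin_basis_basis_on bI.
move=> x u f ul Zx fI; apply/funext => g; rewrite [LHS]/=.
have Mk : (0 < M <= kk)%N by rewrite M0 (leq_trans Ms).
have kk0 : (0 < kk)%N by rewrite muln_gt0.
have mk : (m <= kk)%N by exact: leq_trans mM (leq_trans Ms skk).
have kkh : (h < kk + kk)%N by nia.
have mkh : (h < m + kk)%N by nia.
have kmn : (kk <= m + n)%N by nia.
have hmm : (h < m + n + m)%N by nia.
apply: (ind_J_scalar (S := S) thM thN0 th_level m0 kk0 mk kkh mkh kmn hmm
  (fun _ z => z) g Mk mM _ fI Zx ul) => y v a' Zy vk.
by apply: scal => //; exact: (UD_le S) vk.
Qed.

(** The depth h/2 or (h + 1)/2 is chosen by the parity of n, and the sign (-1)^(n - 1) is the Weil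
    trace -1 for n even and 1 for n odd. *)
Lemma even_level_rep : exists sigma : prerep K (units D),
  [/\ irreducible_rep D_N (J m) sigma,
      forall x, regular_unit vE n' q rd x ->
        rep_trace sigma (toD x) ((-1) ^+ n' * theta x),
      exists d (b : 'I_d -> rep_space sigma), basis_on (rep_carrier sigma) b
    & forall x u v, U kk u -> fixed_times_U1 x -> rep_carrier sigma v ->
       rep_act sigma (toD x * u)%g v = Theta (toD x * u)%g *: v].
Proof.
have n0 := cs_n S.
have [n_odd|n_even] := boolP (odd n); last first.
  have [nu nE] : exists nu, n = nu.*2 by exists n./2; rewrite even_halfK.
  have t_odd : odd t by rewrite /= odd_double.
  have [sigma [irr [d [b bP]] scal tra]] := heisenberg_J S (ltn0Sn j.*2) thM thN0 th_level
    th_prim K0 nE t_odd (erefl (nu * t)%N).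
  exists (ind_on D_N (J (nu * t)) (J m) sigma).
  (* Scalars act only from depth M + 1 on, so s0 = M + 1 and M + s0 is exactly h + 1. *)
  apply: (@ind_J_level (nu * t)%N (nu * t).+1); try nia.
  - exact: irr.
  - by exists d, b.
  - by move=> x u v um Zx _; apply: scal => //; exact: rd_twist_fixed.
  move=> x xr; rewrite -signr_odd; move: n_even; rewrite /= negbK => ->.
  by rewrite mulN1r; exact: tra.
have [nu nE] : exists nu, n = nu.*2.+1.
  by exists n./2; rewrite -[LHS](odd_double_half n) n_odd.
(* This is (h + 1)/2, since h = n (2j + 1) with n = 2 nu + 1. *)
pose M := (n * j + nu.+1)%N.
have M0 : (0 < M)%N by rewrite /M addnS.
have MM : (h < M + M)%N by rewrite /M; nia.
exists (ind_on D_N (J M) (J m) (char_rep Theta)).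
apply: (@ind_J_level M M); try (rewrite /M; nia).
- apply: char_rep_irreducible; last exact: (Jset_subgroup S).
  exact: (Theta_character S thM thN0 th_level).
- by exists 1%N, (one_basis Theta); exact: char_rep_basis.
- by [].
move=> x xr; rewrite -signr_odd; move: n_odd; rewrite /= => /negPf ->.
by rewrite mul1r -(Theta_toD S theta); exact: char_rep_trace.
Qed.

End EvenLevel.

(** * The representations of D^x *)

Lemma exists_root_real (R : realType) (v : R) n : 0 < v -> exists2 c, 0 < c & c ^+ n.+1 = v.
Proof.
move=> v0; pose p : {poly R} := 'X^(n.+1) - v%:P; pose b := 1 + v.
have b1 : 1 <= b by rewrite lerDl ltW.
have b0 : 0 <= b by apply: le_trans b1.
have pE x : p.[x] = x ^+ n.+1 - v by rewrite !hornerE.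
have p0 : p.[0] <= 0 by rewrite pE expr0n /= sub0r oppr_le0 ltW.
have pb : 0 <= p.[b].
  by rewrite pE subr_ge0 exprS (@le_trans _ _ b) ?lerDr// ler_peMr ?exprn_ege1.
have [c /andP[c0 _] /rootP] := poly_ivt b0 (introT andP (conj p0 pb)).
rewrite pE => /eqP; rewrite subr_eq0 => /eqP cE.
exists c => //; rewrite lt_neqAle c0 andbT eq_sym; apply/eqP => c00.
by move: cE; rewrite c00 expr0n /= => /esym/eqP; rewrite (gt_eqF v0).
Qed.

Section LadicClosure.
Variables (R : realType) (l : nat) (Ql : fieldType) (v : nonarch_abs R Ql).
Hypothesis HQl : ladic_field v l.

Lemma nabs_nat m : v m%:R <= 1.
Proof.
elim: m => [|m IH]; first by rewrite nabs0.
by rewrite -addn1 natrD nabsD_le// nabs1.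
Qed.

(** After removing powers of l, a vanishing integer would be prime to l; by Bezout 1 would be a
    multiple of l in the field, contradicting |l| < 1. *)
Lemma ladic_natr_eq0 m : prime l -> m%:R = 0 :> Ql -> m = 0%N.
Proof.
have [HF Hw _] := HQl.
have l0 : l%:R != 0 :> Ql := local_uniformizer_neq0 HF Hw.
have l1 : v l%:R < 1 := uniformizer_lt1 Hw.
move=> pl m0; case: (posnP m) => // mgt0.
have [m' cop mE] := pfactor_coprime pl mgt0.
have m'0 : m'%:R = 0 :> Ql.
  by move/eqP: m0; rewrite mE natrM natrX mulf_eq0 expf_eq0 (negPf l0) andbF orbF => /eqP.
have l_gt0 := prime_gt0 pl.
have [a b ab _] := egcdnP m' l_gt0.
move: ab; rewrite (eqP cop) => /(congr1 (fun z : nat => z%:R : Ql)).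
rewrite natrD !natrM m'0 mulr0 add0r => la.
have : v (a%:R * l%:R) < 1.
  by rewrite nabsM; apply: le_lt_trans l1; rewrite ler_piMl ?nabs_ge0 ?nabs_nat.
by rewrite la nabs1 ltxx.
Qed.
End LadicClosure.

(** * The Galois group, the Frobenius and the existence of [cyclic_setup] *)

Section GaloisSetup.
Variables (R : realType) (F : fieldType) (vF : nonarch_abs R F) (w : F) (q : nat)
  (HF : local_field vF) (Hw : uniformizer vF w) (Hq : residue_card vF q)
  (n' : nat) (n0 : (0 < n')%N)
  (E : splittingFieldType F) (vE : nonarch_abs R E)
  (HE : \dim {:E} = n'.+1) (HvE : forall a : F, vE a%:A = vF a)
  (Hunram : unramified vF vE)
  (phi : gal_of {:E}) (Hphi : forall x, int_ring vE x ->
                                max_ideal vE (phi x - x ^+ q))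
  (D : unitRingType) (pi : {rmorphism twpoly phi -> D})
  (HD : is_cyclic_quotient n'.+1 w pi).
Local Notation n := n'.+1.

Lemma gal_order : #[phi]%g = n /\ 'Gal({:E} / 1)%g = <[phi]>%g.
Proof.
by have [_ [oE gE]] := unramified_residue HF Hw Hq HvE Hunram Hphi; rewrite -HE.
Qed.

Lemma cyclic_setup_exists : exists (k : finFieldType) (rd : E -> k) (c : R),
  cyclic_setup vE n' w pi q rd c.
Proof.
have [[k [rd [[rdD rdM rd1] rd0 rds rdp kE]]] [oE gE]] :=
  unramified_residue HF Hw Hq HvE Hunram Hphi.
have w0 := local_uniformizer_neq0 HF Hw.
have wE0 : w%:A != 0 :> E by rewrite scaler_eq0 oner_eq0 orbF.
have [c c0 cn] := exists_root_real n' (nabs_gt0 vE wE0).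
exists k, rd, c; apply: CyclicSetup => //.
- move=> x; rewrite -[LHS](gal_expg phi n) -HE -oE expg_order; exact: gal_id.
- exact: (rmorph_alg phi).
- exact: Hunram.
- exact: (nabs_gal HF Hw HvE Hunram Hphi).
by rewrite -HE.
Qed.

(** The group generated by phi has order n = dim E, so its fixed field has dimension 1. *)
Lemma gal_fixed a : phi a = a -> exists b : F, a = b%:A.
Proof.
have [oE gE] := gal_order; move=> pa.
pose L : {subfield E} := [aspace of fixedField 'Gal({:E} / 1)%g].
have gal1 : 'Gal({:E} / L)%g = 'Gal({:E} / 1)%g by exact: gal_fixedField.
have dimL : (n %/ \dim L)%N = n.
  rewrite -[X in (X %/ _)%N]HE.
  by rewrite (galois_dim (fixedField_galois _)) gal1 gE -[#|_|]/(#[phi]%g).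
have L1 : L = 1%VS :> {vspace E}.
  apply/esym/eqP; rewrite eqEdim sub1v dimv1 /=.
  have [//|d1] := leqP (\dim L) 1.
  by have := ltn_Pdiv d1 (ltn0Sn n'); rewrite dimL ltnn.
have : a \in L.
  apply/fixedFieldP => [|g]; first exact: memvf.
  by rewrite gE => /cyclePmin[i _ ->]; rewrite gal_expg; exact: iter_fix.
by rewrite L1 => /vlineP.
Qed.

Lemma big_gal (T : Type) (idx : T) (op : Monoid.com_law idx) (f : gal_of {:E} -> T) :
  \big[op/idx]_(g in 'Gal({:E} / 1)%g) f g = \big[op/idx]_(j < n) f (phi ^+ j)%g.
Proof.
have [oE ->] := gal_order.
have <- : [set (phi ^+ (j : 'I_n))%g | j in 'I_n]%SET = <[phi]>%g.
  apply/finset.setP => g; apply/imsetP/idP => [[j _ ->]|/cyclePmin[j jn ->]].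
    exact: mem_cycle.
  by rewrite oE in jn; exists (Ordinal jn).
rewrite big_imset => // i j _ _ /eqP; rewrite cyclic.eq_expg_mod_order oE !modn_small//.
by move/eqP/val_inj.
Qed.

End GaloisSetup.
Lemma scalar_on_basis (K : fieldType) (V : lmodType K) (A : set V) d (b : 'I_d -> V)
    (f : V -> V) a : lin_subspace A -> linear_on A f -> basis_on A b ->
  (forall i, f (b i) = a *: b i) -> forall x, A x -> f x = a *: x.
Proof.
move=> [A0 AD] fL [bA span] fb x /span[y [-> _]].
have f0 : f 0 = 0.
  by have := fL 1 0 0 A0 A0; rewrite !scale1r addr0 -[LHS]addr0 => /addrI.
suff [] : A (\sum_i y 0 i *: b i) /\ f (\sum_i y 0 i *: b i) = a *: \sum_i y 0 i *: b i by [].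
apply: (big_rec (fun z => A z /\ f z = a *: z)) => [|i z _ [Az fz]].
  by rewrite f0 scaler0.
by split; [exact: AD|rewrite fL// fb fz scalerDr !scalerA mulrC].
Qed.

Section SplitUnits.
Variables (R : realType) (F : fieldType) (E : fieldExtType F)
    (vE : nonarch_abs R E) (phi : {rmorphism E -> E}) (n' : nat) (w : F)
    (D : unitRingType) (pi : {rmorphism twpoly phi -> D})
    (k : finFieldType) (q : nat) (rd : E -> k) (c : R).
Hypothesis S : cyclic_setup vE n' w pi q rd c.

(** Dividing by the projection e = pr u leaves an element of 1 + C'. A character with prescribed
    values on E^x and on 1 + (C' cap P_D^m) is thereby determined. *)
Lemma UD_split m u : (0 < m)%N -> UD vE n'.+1 pi m u -> exists e u',
  [/\ u = (units_map (embD pi) e * u')%g, vE (uval e - 1) <= c ^+ m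
    & UC vE n'.+1 pi m u'].
Proof.
move=> m0 um; have [p1 pn] := UD_pr S m0 um.
have a0 : pr S (uval u) != 0 by rewrite -(nabs_eq0 vE) pn oner_eq0.
have aU : pr S (uval u) \is a GRing.unit by rewrite unitfE.
pose e : units E := Units aU.
exists e, (units_map (embD pi) e^-1%g * u)%g; split=> //.
  by rewrite mulgA -toDM mulgV toD1 mul1g.
have u'E : uval (units_map (embD pi) e^-1%g * u)%g - 1 =
    embD pi (uval e)^-1 * (uval u - embD pi (uval e)).
  by rewrite uvalM uval_toD uvalV mulrBr -(rmorphM (embD pi)) mulVf// (rmorph1 (embD pi)).
apply/(UC_dnorm S); split.
  by rewrite uvalM uval_toD pr_embl uvalV mulVf.
rewrite u'E dnorm_embl nabsV pn invr1 mul1r; exact: dnorm_subpr.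
Qed.

End SplitUnits.

(** * Central character, twist and trace of the representation rho *)

Section InducedRepresentation.
Variables (R : realType) (F : fieldType) (vF : nonarch_abs R F) (w : F) (q : nat)
  (HF : local_field vF) (Hw : uniformizer vF w) (Hq : residue_card vF q)
  (n' : nat) (n0 : (0 < n')%N)
  (E : splittingFieldType F) (vE : nonarch_abs R E)
  (HE : \dim {:E} = n'.+1) (HvE : forall a : F, vE a%:A = vF a)
  (Hunram : unramified vF vE)
  (phi : gal_of {:E}) (Hphi : forall x, int_ring vE x ->
                                max_ideal vE (phi x - x ^+ q))
  (D : unitRingType) (pi : {rmorphism twpoly phi -> D})
  (HD : is_cyclic_quotient n'.+1 w pi)
  (K : closedFieldType)
  (eps : units F -> K) (Heps : is_character (unit_filt vF w) setT eps)
  (Hker : forall a : units F, eps a = 1 <->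
     exists x : units E, (uval a)%:A = galNorm 1 {:E} (uval x))
  (theta : units E -> K) (t : nat)
  (Htheta : primitive_character vE w%:A theta t.+1)
  (k : finFieldType) (rd : E -> k) (c : R)
  (S : cyclic_setup vE n' w pi q rd c).
Local Notation n := n'.+1.
Local Notation toD := (units_map (embD pi)).
Local Notation J := (Jset vE n' pi).
Local Notation D_N := (D_nbhs vE n pi).

Let gal_phi i : (phi ^+ i)%g \in 'Gal({:E} / 1)%g.
Proof.
have [_ ->] := gal_order HF Hw Hq HE HvE Hunram Hphi; exact: mem_cycle.
Qed.

Let gal_phi_neq1 i : ~~ (n %| i)%N -> (phi ^+ i)%g != 1%g.
Proof.
by have [<- _] := gal_order HF Hw Hq HE HvE Hunram Hphi; rewrite cyclic.order_dvdn.
Qed.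

Lemma unit_filtE m x :
  unit_filt vE w%:A m.+1 x <-> vE (uval x - 1) <= c ^+ (n * m.+1).
Proof.
rewrite /unit_filt /= /ideal_pow /=; split=> [[y y1 <-]|xm].
  by rewrite nabsM (nabs_wX S) ler_piMr// ltW// (cX_gt0 S).
have wX0 : (w%:A : E) ^+ m.+1 != 0 by rewrite expf_neq0// (cs_w0 S).
exists ((uval x - 1) / w%:A ^+ m.+1).
  by rewrite /= /int_ring /= nabsM nabsV (nabs_wX S) ler_pdivrMr ?mul1r ?(cX_gt0 S).
by rewrite mulrCA mulfV// mulr1.
Qed.

(** Minimality of the level t + 1 of theta / theta^g says that this quotient is nontrivial on U_E^t,
    which yields the witnesses x. *)
Lemma primitive_level : [/\ (0 < t)%N,
  forall x y, theta (x * y)%g = theta x * theta y,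
  forall x, theta x != 0,
  forall x, vE (uval x - 1) <= c ^+ (n * t.+1) -> theta x = 1
  & forall i, ~~ (n %| i)%N -> exists x y : units E,
    [/\ vE (uval x - 1) <= c ^+ (n * t), uval y = iter i phi (uval x)
      & theta y != theta x]].
Proof.
have [[thN0 thM _] [lev _] t2 prim] := Htheta.
have t0 : (0 < t)%N by rewrite -ltnS.
split=> //.
- by move=> x y; exact: thM.
- by move=> x; exact: thN0.
- by move=> x /unit_filtE; exact: lev.
move=> i /gal_phi_neq1 /(prim _ (gal_phi i)) [_ min].
apply: contrapT => H; have := min t; rewrite ltnn => /(_ _)/wrap[|//] x.
move: (t0) H; case: (t) => // t' _ H /unit_filtE xt.
have xy : theta (gal_units (phi ^+ i)%g x) = theta x.
  apply: contrapT => /eqP ne; apply: H.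
  by exists x, (gal_units (phi ^+ i)%g x); split=> //; rewrite -gal_expg.
by rewrite xy divff// thN0.
Qed.

Lemma very_regular_unit x : very_regular vE w%:A x -> regular_unit vE n' q rd x.
Proof.
move=> [[x1 xV1] reg]; split=> // i ni; apply: contra_neqN (gal_phi_neq1 ni) => /eqP xr.
apply: reg (gal_phi i) _; apply/unit_filtE; rewrite muln1 (cs_cn S).
apply: (nabs_lt1 (cs_unif S)).
have vx : vE (uval x) = 1.
  apply/eqP; rewrite eq_le x1 /=; move: xV1.
  by rewrite /int_ring /= nabsV invf_le1// nabs_gt0// units_neq0.
rewrite uvalM uvalV -[X in _ - X](mulfV (units_neq0 x)) -mulrBl nabsM nabsV vx invr1 mulr1.
rewrite /gal_units /= gal_expg.
by apply/(rd_eq S) => //; rewrite ?(nabs_phi_iter S)// (rd_phi_iter S).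
Qed.

(** This direction lets the trace condition imposed on sigma at very regular elements feed the coset
    argument, which works with residues. *)
Lemma regular_very_unit x : regular_unit vE n' q rd x -> very_regular vE w%:A x.
Proof.
move=> [x1 reg]; have vx : vE (uval x) = 1.
  apply/eqP; rewrite eq_le x1 leNgt; apply/negP => /(cs_rd0 S x1) rx0.
  have n1 : ~~ (n %| 1)%N by rewrite dvdn1 eqSS -lt0n.
  have q0 : (0 < q)%N.
    by have := finNzRing_gt1 k; rewrite lt0n (cs_card S); apply: contraTneq => ->; rewrite exp0n.
  by have := reg 1%N n1; rewrite rx0 expn1 expr0n (gtn_eqF q0) eqxx.
split; first by split=> //; rewrite /int_ring /= nabsV vx invr1.
move=> g; have [oE ->] := gal_order HF Hw Hq HE HvE Hunram Hphi.
move=> /cyclePmin[i _ ->] /unit_filtE; rewrite muln1 (cs_cn S) => gx.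
apply/eqP; rewrite -cyclic.order_dvdn oE; apply/negPn/negP => /reg /eqP; apply.
rewrite -(rd_phi_iter S)//; apply/(rd_eq S); rewrite ?(nabs_phi_iter S)//.
have -> : iter i phi (uval x) - uval x =
    (uval (gal_units (phi ^+ i)%g x * x^-1)%g - 1) * uval x.
  by rewrite mulrBl mul1r uvalM uvalV divfK ?units_neq0// /gal_units /= gal_expg.
by rewrite nabsM vx mulr1; apply: le_lt_trans gx (uniformizer_lt1 (cs_unif S)).
Qed.

Lemma sum_gal x : \sum_(g in 'Gal({:E} / 1)%g) theta (gal_units g x) =
  \sum_(j < n) thE theta (iter j phi (uval x)).
Proof.
rewrite (big_gal HF Hw Hq HE HvE Hunram Hphi); apply: eq_bigr => j _.
by rewrite -gal_expg -thE_units.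
Qed.

(** Part (c) for both parities at once, with [sgn] the sign in the trace of sigma: F^x is central,
    eps o Nrd is trivial on the inducing group, and [ind_J_trace] sums over cosets. *)
Lemma induced_properties m (sigma : prerep K (units D)) sgn : (0 < m)%N ->
    smooth_rep D_N (J m) sigma ->
    (exists d (b : 'I_d -> rep_space sigma), basis_on (rep_carrier sigma) b) ->
    (forall (a : units F) v, rep_carrier sigma v ->
       rep_act sigma (toD (unitsFE E a)) v = theta (unitsFE E a) *: v) ->
    (forall x, regular_unit vE n' q rd x -> rep_trace sigma (toD x) (sgn * theta x)) ->
  let rho := smooth_ind D_N (J m) sigma in
  [/\ forall (a : units F) x, rep_carrier rho x ->
        rep_act rho (toD (unitsFE E a)) x = theta (unitsFE E a) *: x,
      rep_iso setT rho (rep_twist rho (fun g => eps (Nrd_units n pi g)))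
    & forall x, very_regular vE w%:A x -> rep_trace rho (toD x)
        (sgn * \sum_(g in 'Gal({:E} / 1)%g) theta (gal_units g x))].
Proof.
move=> m0 sm bas cen tra rho.
have [t0 _ _ _ _] := primitive_level.
have phi_fix := gal_fixed HF Hw Hq HE HvE Hunram Hphi.
have [carS linS _ _ _] := sm.
split.
- move=> a f [fS fJ _]; apply/funext => g; rewrite [LHS]/=.
  have -> : (g * toD (unitsFE E a) = toD (unitsFE E a) * g)%g.
    apply: uval_inj; rewrite !uvalM uval_toD.
    rewrite {1}(coordE (cs_quot S) (uval g)) mulr_suml.
    rewrite [in RHS](coordE (cs_quot S) (uval g)) mulr_sumr.
    apply: eq_bigr => j _; rewrite -mulrA PiDX_emb iter_fix; last first.
      exact: (rmorph_alg phi).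
    by rewrite !mulrA -!(rmorphM (embD pi)) mulrC.
  by rewrite fJ ?cen//; exact: (Jset_toD S).
- have epsN a x : (uval a)%:A = \prod_(i < n) iter i phi (uval x) -> eps a = 1.
    move=> aE; apply/Hker; exists x; rewrite aE /galNorm.
    rewrite (big_gal HF Hw Hq HE HvE Hunram Hphi).
    by apply: eq_bigr => i _; rewrite gal_expg.
  have [chi0 chiM chi_toD chiU] := eps_Nrd_trivial S phi_fix HvE Heps epsN.
  have chiU' i g : (0 < i)%N -> UD vE n pi i g -> eps (Nrd_units n pi g) = 1.
    by move=> i0 /(UD_le S i0); exact: chiU.
  apply: smooth_ind_twist => //.
  + by move=> i j ij; exact: (UD_le S).
  + by exists 0%N => g; exact: chiU'.
  + by move=> g /JsetP[x [u [um ->]]]; rewrite chiM chi_toD mul1r; exact: chiU' um.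
  + by move=> g /linS[].
move=> x /very_regular_unit xr; rewrite sum_gal /rho smooth_indE.
exact: (ind_J_trace S t0 m0 sm bas tra xr).
Qed.
End InducedRepresentation.

Theorem theorem2p6
  (R : realType)
  (* the local field F, with uniformizer w and residue field F_q *)
  (F : fieldType) (vF : nonarch_abs R F) (w : F) (p q : nat)
  (HF : local_field vF) (Hw : uniformizer vF w)
  (Hq : residue_card vF q) (Hp : prime p) (HFp : vF p%:R < 1)
  (* the unramified extension E of F of degree n *)
  (n : nat) (Hn : (2 <= n)%N)
  (E : splittingFieldType F) (vE : nonarch_abs R E)
  (HE : \dim {:E} = n) (HvE : forall a : F, vE a%:A = vF a)
  (Hunram : unramified vF vE)
  (* the Frobenius generator of Gal(E / F) *)
  (phi : gal_of {:E}) (Hphi : forall x, int_ring vE x ->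
                                max_ideal vE (phi x - x ^+ q))
  (* the division algebra D = E<Pi> / (Pi^n - w) *)
  (D : unitRingType) (pi : {rmorphism twpoly phi -> D})
  (HD : is_cyclic_quotient n w pi)
  (* the algebraic closure K of the field of l-adic numbers *)
  (l : nat) (Hl : prime l) (Hlp : l <> p)
  (Ql : fieldType) (vl : nonarch_abs R Ql) (HQl : ladic_field vl l)
  (K : closedFieldType) (iota : {rmorphism Ql -> K})
  (HK : algebraic_closure iota)
  (* the character eps of F^x with kernel the norm group of E / F *)
  (eps : units F -> K) (Heps : is_character (unit_filt vF w) setT eps)
  (Hker : forall a : units F, eps a = 1 <->
     exists x : units E, (uval a)%:A = galNorm 1 {:E} (uval x))
  (theta : units E -> K) (r0 : nat)
  (Htheta : primitive_character vE w%:A theta r0) :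
  let toD := units_map (embD pi) in
  let D_N := D_nbhs vE n pi in
  let U_D := UD vE n pi in
  let E_U_D m := setmul (Eunits pi) (U_D m) in
  let F_UE1 := setmul (Funits pi) (toD @` unit_filt vE w%:A 1) in
  let properties (rho : prerep K (units D)) :=
    [/\ forall (a : units F) x, rep_carrier rho x ->
          rep_act rho (toD (unitsFE E a)) x = theta (unitsFE E a) *: x,
        rep_iso setT rho (rep_twist rho (fun g => eps (Nrd_units n pi g)))
      & forall x, very_regular vE w%:A x ->
          rep_trace rho (toD x)
            ((-1) ^+ ((r0 - 1) * (n - 1))
              * \sum_(g in 'Gal({:E} / 1)%g) theta (gal_units g x))] in
  (odd r0 ->
    let m := ((n * (r0 - 1)) %/ 2 + 1)%N in
    let extends_theta (chi : units D -> K) :=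
      [/\ is_character D_N (E_U_D m) chi,
          forall x, chi (toD x) = theta x
        & forall g, UC vE n pi m g -> chi g = 1] in
    exists theta' : units D -> K,
      [/\ extends_theta theta',
          forall chi, extends_theta chi ->
            forall g, E_U_D m g -> chi g = theta' g
        & let rho := smooth_ind D_N (E_U_D m) (char_rep theta') in
          irreducible_rep D_N setT rho /\ properties rho]) /\
  (~~ odd r0 ->
    let m := ((n * (r0 - 2)) %/ 2 + 1)%N in
    let k := ((n * r0) %/ 2)%N in
    let is_sigma (sigma : prerep K (units D)) :=
      [/\ irreducible_rep D_N (E_U_D m) sigma,
          forall x, very_regular vE w%:A x ->
            rep_trace sigma (toD x)
              ((-1) ^+ (n - 1) * theta x)
        & exists psi : units D -> K,
            [/\ is_character D_N (setmul F_UE1 (U_D k)) psi,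
                forall x, F_UE1 (toD x) -> psi (toD x) = theta x,
                forall g, UC vE n pi k g -> psi g = 1
              & sum_of_copies (setmul F_UE1 (U_D k)) sigma psi]] in
    (exists sigma, is_sigma sigma) /\
    forall sigma, is_sigma sigma ->
      let rho := smooth_ind D_N (E_U_D m) sigma in
      irreducible_rep D_N setT rho /\ properties rho).
Proof.
move=> toD D_N U_D E_U_D F_UE1 properties.
case: n Hn HE HD @D_N @U_D @E_U_D @properties => [//|n'] n0 HE' HD' D_N U_D E_U_D properties.
case: r0 Htheta @properties => [[]//|t] Htheta' properties.
have [k [rd [c S]]] := cyclic_setup_exists HF Hw Hq n0 HE' HvE Hunram Hphi HD'.
have [t0 thM thN0 th_level th_prim] :=
  primitive_level HF Hw Hq HE' HvE Hunram Hphi Htheta' S.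
have K0 m : m%:R = 0 :> K -> m = 0%N.
  move=> m0; apply: (ladic_natr_eq0 HQl Hl); apply: (fmorph_inj iota).
  by rewrite rmorph_nat rmorph0.
have props := induced_properties HF Hw Hq HE' HvE Hunram Hphi Heps Hker Htheta' S.
have n'0 := cs_n S.
pose Th := Theta S theta.
have ThUC m g : UC vE n'.+1 pi m g -> Th g = 1.
  by move=> /(UC_dnorm S)[p1 _]; rewrite /Th /Theta p1 (thE1 thM thN0).
have JG m : (0 < m)%N -> subgroup (E_U_D m) by exact: (Jset_subgroup S).
have UCU m g : UC vE n'.+1 pi m g -> U_D m g by case.
split=> [r0_odd|r0_even].
- move=> m; have [j tE] : exists j, t = j.*2.
    by exists t./2; move: r0_odd; rewrite /= => /even_halfK.
  have mE : m = (n'.+1 * j + 1)%N by rewrite /m tE; nia.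
  clearbody m; move=> ext.
  have m0 : (0 < m)%N by rewrite mE addn1.
  have hm : (n'.+1 * t < m + m)%N by rewrite mE tE; nia.
  have Thchar := Theta_character S thM thN0 th_level m0 hm.
  have Thext : ext Th.
    by split=> //; [exact: (Theta_toD S theta)|exact: ThUC].
  exists Th; split=> //.
    (* Every element is a unit x e of E times some u' in 1 + C', where the conditions fix both
       values. *)
    move=> chi chiext g /JsetP[x [u [um ->]]].
    have [e [u' [-> _ u'C]]] := UD_split S m0 um.
    suff val chi' : ext chi' -> chi' (toD x * (toD e * u'))%g = theta (x * e)%g.
      by rewrite !val.
    move=> [[_ chiM _] chi_th chiC]; rewrite mulgA -toDM chiM ?chi_th ?chiC ?mulr1//.
      exact: (Jset_toD S).
    by apply: UD_Jset; exact: UCU u'C.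
  move=> rho.
  have irr := char_rep_irreducible Thchar (JG m m0).
  have [sm _ _] := irr.
  split.
    rewrite /rho smooth_indE.
    apply: (ind_J_irreducible (S := S) t0 thM thN0 th_level th_prim (s0 := m)) => //.
    + by rewrite m0 leqnn.
    + by rewrite mE tE; nia.
    (* Degrees below m = n j + 1 not divisible by n are below n j, so i + m <= 2 n j = h. *)
    move=> i /andP[i0 im] ni; have : i != (n'.+1 * j)%N.
      by apply: contraNneq ni => ->; exact: dvdn_mulr.
    by rewrite mE tE in im *; nia.
  have sgnE : (-1) ^+ ((t.+1 - 1) * (n'.+1 - 1)) = 1 :> K.
    by rewrite -signr_odd oddM subn1 /= tE odd_double.
  rewrite /properties sgnE; apply: (props m (char_rep Th) 1 m0 sm).
  + by eexists; eexists; exact: fin_basis_basis_on (char_rep_basis Th).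
  + by move=> a v _ /=; rewrite /Th Theta_toD.
  by move=> x _; rewrite mul1r -(Theta_toD S theta); exact: char_rep_trace.
move=> m kk; have [j tE] : exists j, t = j.*2.+1.
  by exists t./2; move: r0_even; rewrite /= negbK => todd; rewrite -[LHS]odd_double_half todd.
have mE : m = (n'.+1 * j + 1)%N by rewrite /m tE; nia.
have kE : kk = (n'.+1 * j.+1)%N by rewrite /kk tE; nia.
clearbody m kk; move=> is_sigma.
have m0 : (0 < m)%N by rewrite mE addn1.
have k0 : (0 < kk)%N by rewrite kE muln_gt0.
have hk : (n'.+1 * t < kk + kk)%N by rewrite kE tE; nia.
(* As r0 - 1 is odd, the exponent has the parity of n - 1. *)
have sgnE : (-1) ^+ ((t.+1 - 1) * (n'.+1 - 1)) = (-1) ^+ (n'.+1 - 1) :> K.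
  by rewrite -signr_odd oddM [(t.+1 - 1)%N]subn1 /= tE /= odd_double /= signr_odd.
have F_UE1P g : F_UE1 g -> exists2 x, g = toD x & fixed_times_U1 vE phi n' c x.
  move=> [_ [a _ <-] [_ [e /(unit_filtE S) e1 <-] <-]].
  exists (unitsFE E a * e)%g; first exact/esym/toDM.
  exists (unitsFE E a), e; split=> //; last by rewrite muln1 in e1.
  exact: (rmorph_alg phi).
have UE1_F e : vE (uval e - 1) <= c ^+ n'.+1 -> F_UE1 (toD e).
  move=> e1; exists 1%g; last exists (toD e); rewrite ?mul1g//.
    have uFE1 : unitsFE E 1%g = 1%g by apply: uval_inj; exact: (rmorph1 (in_alg E)).
    by exists 1%g => //; rewrite -[LHS]/(toD (unitsFE E 1%g)) uFE1; exact: toD1.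
  by exists e => //; apply/(unit_filtE S); rewrite muln1.
split.
  subst t; have [sigma [irr tra bas scal]] := even_level_rep S thM thN0 th_level th_prim K0.
  rewrite -mE -kE in irr scal; exists sigma; split=> //.
    by move=> x /(very_regular_unit HF Hw Hq HE' HvE Hunram Hphi S) xr; rewrite subn1; exact: tra.
  have [d [b bP]] := bas.
  have FJ g : setmul F_UE1 (U_D kk) g -> E_U_D kk g.
    by move=> [_ /F_UE1P[x -> _] [u uk <-]]; exact: JsetI.
  have [_ _ [i iP]] := Theta_character S thM thN0 th_level k0 hk.
  exists Th; split.
  - split; first by move=> g _; exact: thN0.
      by move=> g g' /FJ Jg /FJ Jg'; exact: (Theta_mul S thM th_level k0 hk).
    by exists i => g /FJ; exact: iP.
  - by move=> x _; exact: (Theta_toD S theta).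
  - by move=> g; exact: ThUC.
  exists d, b; split=> // _ i' [_ /F_UE1P[x -> xf] [u uk <-]].
  by apply: scal => //; case: bP.
(* For an arbitrary sigma, the action on F^x U_E^1 U_D^kk through psi and the trace condition
   replace any knowledge of its construction. *)
move=> sigma [irr tra [psi [[psi0 psiM _] psi_th psiC [d [b [bP bact]]]]]] rho.
have [sm _ _] := irr; have [carS linS _ _ _] := sm.
have kn : c ^+ kk <= c ^+ n'.+1.
  by rewrite ler_iXn2l ?(cs_c0 S) ?(cs_c1 S)// kE; nia.
have F1 : F_UE1 1%g.
  by rewrite -(toD1 pi); apply: UE1_F; rewrite uval1 subrr nabs0 ltW// (cX_gt0 S).
have U1 : U_D kk 1%g by have [] := UD_subgroup S k0.
have mk : (m <= kk)%N by rewrite mE kE; nia.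
have FkJ g : setmul F_UE1 (U_D kk) g -> E_U_D m g.
  by move=> [_ /F_UE1P[x -> _] [u uk <-]]; apply: JsetI; exact: (UD_le S mk).
have scal g v : setmul F_UE1 (U_D kk) g -> rep_carrier sigma v ->
    rep_act sigma g v = psi g *: v.
  move=> gF; have [lin _] := linS g (FkJ g gF).
  by apply: (scalar_on_basis carS lin bP) => i; exact: bact.
have FU g : F_UE1 g -> setmul F_UE1 (U_D kk) g.
  by move=> gF; exists g => //; exists 1%g; rewrite ?mulg1.
(* On U_D^kk both psi and [Theta] are theta on the factor from E and trivial on the factor in 1 +
   C', by [UD_split]. *)
have psiTh u : U_D kk u -> psi u = Th u.
  move=> uk; have [e [u' [-> e1 u'C]]] := UD_split S k0 uk.
  have eF : F_UE1 (toD e) by apply: UE1_F; exact: le_trans kn.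
  have u'k : U_D kk u' by exact: UCU.
  rewrite psiM; [|exact: FU|by exists 1%g => //; exists u'; rewrite ?mul1g].
  rewrite psi_th// psiC// mulr1 /Th Theta_toDl//; last first.
    by have [p1 _] := (UC_dnorm S kk u').1 u'C; rewrite p1 oner_neq0.
  by rewrite -/Th (ThUC kk)// mulr1.
split.
  rewrite /rho smooth_indE.
  apply: (ind_J_irreducible (S := S) t0 thM thN0 th_level th_prim (s0 := kk)) => //.
  + by rewrite m0 mk.
  + by rewrite kE tE; nia.
  (* Again i < n j, so i + kk < n j + n (j + 1) = h. *)
  + move=> i /andP[i0 im] ni; have : i != (n'.+1 * j)%N.
      by apply: contraNneq ni => ->; exact: dvdn_mulr.
    by rewrite mE in im; rewrite kE tE; nia.
  move=> u v uk vS; rewrite scal//; first by rewrite psiTh.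
  by exists 1%g => //; exists u; rewrite ?mul1g.
rewrite /properties sgnE; apply: (props m sigma _ m0 sm).
- by exists d, b.
- move=> a v vS; have aF : F_UE1 (toD (unitsFE E a)).
    exists (toD (unitsFE E a)); first by exists a.
    exists 1%g; rewrite ?mulg1//; exists 1%g; last exact: toD1.
    by apply/(unit_filtE S); rewrite uval1 subrr nabs0 ltW// (cX_gt0 S).
  by rewrite scal ?psi_th//; exact: FU.
by move=> x /(regular_very_unit HF Hw Hq n0 HE' HvE Hunram Hphi S) xr; exact: tra.
Qed.
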